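(* Let $M$ and $N$ be smooth manifolds, let $A = C^\infty(M)\otimes_{\mathbb{R}} C^\infty(N)$, regarded as a subalgebra of its smooth envelope $\overline{A}=C^\infty(M\times N)$, and let $\overline{\Lambda^1(A)}=\overline{A}\otimes_A\Lambda^1(A)$. Then the $\overline{A}$-module homomorphism $$\varphi:\overline{\Lambda^1(A)}\longrightarrow\Lambda^1(\overline{A}),\qquad \varphi(\overline{a}\otimes da)=\overline{a}\,da\qquad(\overline{a}\in\overline{A},\ a\in A\subset\overline{A}),$$ is bijective. In particular, $\Lambda^1(\overline{A})\cong\overline{\Lambda^1(A)}$.
   Context: Smooth manifolds are finite-dimensional, Hausdorff and second countable; $C^\infty(M)$ is the $\mathbb{R}$-algebra of smooth real-valued functions on $M$. Spectrum and geometric algebras. For a commutative unital $\mathbb{R}$-algebra $A$, the spectrum $|A|$ is the set of unital $\mathbb{R}$-algebra homomorphisms $h:A\to\mathbb{R}$, and $\mu_h=\ker h$. Elements of $A$ define functions on $|A|$ by $a(h)=h(a)$; $A$ is geometric if $\bigcap_{h\in|A|}\mu_h=0$, so that $A$ is an algebra of functions on $|A|$. Smooth envelope. For geometric $A$, the smooth envelope $\overline{A}$ is the algebra of all functions on $|A|$ of the form $H\circ(a_1,\dots,a_k)$ with $k\ge 0$, $a_1,\dots,a_k\in A$ and $H\in C^\infty(\mathbb{R}^k)$. For $A=C^\infty(M)\otimes_{\mathbb{R}}C^\infty(N)$ one has $|A|=M\times N$, the element $f\otimes g$ being the function $(x,y)\mapsto f(x)g(y)$, and $\overline{A}=C^\infty(M\times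 N)$. Differential forms. For a geometric algebra $A$, an $A$-module $P$ is geometric if $\bigcap_{h\in|A|}\mu_hP=0$. $\Lambda^1(A)$, with its universal derivation $d:A\to\Lambda^1(A)$, is the module of 1-forms of $A$: the representing object of the functor $P\mapsto D(A,P)$ ($\mathbb{R}$-linear derivations of $A$ with values in $P$) on the category of geometric $A$-modules. Explicitly, it is the quotient of the module of Kähler differentials $\Omega_{A/\mathbb{R}}$ by the submodule $\bigcap_{h\in|A|}\mu_h\Omega_{A/\mathbb{R}}$. For $A=C^\infty(M)$ it is the module of smooth sections of $T^*M$. In the formula for $\varphi$, the symbol $da$ on the left is the differential of $a$ in $\Lambda^1(A)$, and on the right it is the differential of $a$, seen as an element of $\overline{A}$, in $\Lambda^1(\overline{A})$. Smoothening. For an $A$-module $P$, its smoothening is the $\overline{A}$-module $\overline{P}=\overline{A}\otimes_AP$. *)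

(* Defs.v *)
From HB Require Import structures.
From mathcomp Require Import all_boot all_order all_algebra.
From mathcomp Require Import all_classical all_reals all_analysis.

Set Implicit Arguments.
Unset Strict Implicit.
Unset Printing Implicit Defensive.

Import Order.TTheory GRing.Theory Num.Theory.
Import numFieldNormedType.Exports.

Local Open Scope classical_set_scope.
Local Open Scope ring_scope.
Local Open Scope quotient_scope.

Record submodule (A : pzRingType) (V : lmodType A) := Submodule {
  submod_set :> V -> Prop;
  submod0 : submod_set 0;
  submodD : forall u v, submod_set u -> submod_set v -> submod_set (u + v);
  submodZ : forall a u, submod_set u -> submod_set (a *: u) }.

Section ModQuotient.
Variables (A : pzRingType) (V : lmodType A) (W : submodule V).

Lemma submodN u : W u -> W (- u).
Proof. by move=> Wu; rewrite -scaleN1r; exact: submodZ. Qed.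

Lemma submodB u v : W u -> W v -> W (u - v).
Proof. by move=> Wu Wv; apply: submodD => //; exact: submodN. Qed.

Definition modq_equiv (u v : V) : bool := `[< W (u - v) >].

Lemma modq_equivP : equiv_class_of modq_equiv.
Proof.
split=> [u|u v|v u w]; rewrite /modq_equiv.
- by apply/asboolP; rewrite subrr; exact: submod0.
- by apply/asboolP/asboolP => /submodN; rewrite opprB.
- move=> /asboolP uv /asboolP vw; apply/asboolP.
  by rewrite -(subrKA v); exact: submodD.
Qed.

Canonical modq_equiv_rel := EquivRelPack modq_equivP.

Definition modq := {eq_quot modq_equiv_rel}.
HB.instance Definition _ := Choice.on modq.

Definition modq_pi (u : V) : modq := \pi u.

Lemma modq_piP u v : modq_pi u = modq_pi v <-> W (u - v).
Proof.
split=> [/eqmodP /asboolP //|uv]; by apply/eqmodP/asboolP.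
Qed.

Lemma modq_piK q : modq_pi (repr q) = q. Proof. exact: reprK. Qed.

Lemma modq_repr u : W (repr (modq_pi u) - u).
Proof. by apply/modq_piP; rewrite modq_piK. Qed.

Definition modq_add (p q : modq) := modq_pi (repr p + repr q).
Definition modq_opp (p : modq) := modq_pi (- repr p).
Definition modq_scale (a : A) (p : modq) := modq_pi (a *: repr p).

Lemma modq_addE u v : modq_add (modq_pi u) (modq_pi v) = modq_pi (u + v).
Proof.
apply/modq_piP; rewrite opprD addrACA; apply: submodD; exact: modq_repr.
Qed.

Lemma modq_oppE u : modq_opp (modq_pi u) = modq_pi (- u).
Proof. by apply/modq_piP; rewrite -opprD; apply: submodN; exact: modq_repr. Qed.

Lemma modq_scaleE a u : modq_scale a (modq_pi u) = modq_pi (a *: u).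
Proof. by apply/modq_piP; rewrite -scalerBr; apply: submodZ; exact: modq_repr. Qed.

Lemma modq_ind (P : modq -> Prop) : (forall u, P (modq_pi u)) -> forall q, P q.
Proof. by move=> Pu q; rewrite -(modq_piK q). Qed.

Lemma modq_addA : associative modq_add.
Proof.
elim/modq_ind=> u; elim/modq_ind=> v; elim/modq_ind=> w.
by rewrite !modq_addE addrA.
Qed.
Lemma modq_addC : commutative modq_add.
Proof. by elim/modq_ind=> u; elim/modq_ind=> v; rewrite !modq_addE addrC. Qed.
Lemma modq_add0 : left_id (modq_pi 0) modq_add.
Proof. by elim/modq_ind=> u; rewrite !modq_addE add0r. Qed.
Lemma modq_addN : left_inverse (modq_pi 0) modq_opp modq_add.
Proof. by elim/modq_ind=> u; rewrite modq_oppE modq_addE addNr. Qed.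

HB.instance Definition _ :=
  GRing.isZmodule.Build modq modq_addA modq_addC modq_add0 modq_addN.

Lemma modq_scaleA a b p : modq_scale a (modq_scale b p) = modq_scale (a * b) p.
Proof. by elim/modq_ind: p => u; rewrite !modq_scaleE scalerA. Qed.
Lemma modq_scale1 : left_id 1 modq_scale.
Proof. by elim/modq_ind=> u; rewrite !modq_scaleE scale1r. Qed.
Lemma modq_scaleDr : right_distributive modq_scale +%R.
Proof.
move=> a; elim/modq_ind=> u; elim/modq_ind=> v.
rewrite [_ + _]modq_addE !modq_scaleE [RHS]modq_addE.
by rewrite scalerDr.
Qed.
Lemma modq_scaleDl p : {morph modq_scale^~ p : a b / a + b}.
Proof.
move=> a b; elim/modq_ind: p => u.
by rewrite !modq_scaleE [RHS]modq_addE scalerDl.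
Qed.

HB.instance Definition _ := GRing.Zmodule_isLmodule.Build A modq
  modq_scaleA modq_scale1 modq_scaleDr modq_scaleDl.

Lemma modq_pi_is_linear : linear modq_pi.
Proof. by move=> a u v; rewrite -modq_addE -modq_scaleE. Qed.
HB.instance Definition _ :=
  GRing.isLinear.Build A V modq _ modq_pi modq_pi_is_linear.

Lemma modq_piZ a u : modq_pi (a *: u) = a *: modq_pi u.
Proof. exact: linearZ. Qed.
Lemma modq_piD u v : modq_pi (u + v) = modq_pi u + modq_pi v.
Proof. exact: linearD. Qed.

End ModQuotient.

(* [comb I setT] is the submodule I V when I is an ideal, and [comb setT G] is
   the submodule generated by G. *)
Definition comb (A : pzRingType) (V : lmodType A) (I : set A) (G : set V) : set V :=
  [set w | exists2 s : seq (A * V),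
     forall p, p \in s -> I p.1 /\ G p.2 & w = \sum_(p <- s) p.1 *: p.2].

Section Comb.
Variables (A : comPzRingType) (V : lmodType A) (I : set A) (G : set V).

Lemma comb0 : comb I G 0.
Proof. by exists [::]; rewrite ?big_nil. Qed.

Lemma combD u v : comb I G u -> comb I G v -> comb I G (u + v).
Proof.
move=> [s sP ->] [t tP ->]; exists (s ++ t); last by rewrite big_cat.
by move=> p; rewrite mem_cat => /orP[/sP|/tP].
Qed.

Lemma combZ : (forall a b, I b -> I (a * b)) ->
  forall a u, comb I G u -> comb I G (a *: u).
Proof.
move=> IM a u [s sP ->]; exists [seq (a * p.1, p.2) | p <- s].
  by move=> _ /mapP[p /sP[Ip Gp] ->]; split=> //; exact: IM.
by rewrite scaler_sumr big_map; apply: eq_bigr => p _; rewrite scalerA.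
Qed.

End Comb.

Definition span (A : comPzRingType) (V : lmodType A) (G : set V) : submodule V :=
  Submodule (comb0 setT G) (@combD _ _ setT G) (combZ (fun _ _ _ => I)).

Section Tensor.
Variables (S : Type) (P Q : zmodType) (aP : S -> P -> P) (aQ : S -> Q -> Q).

(* The list [:: (p1, q1); ..; (pn, qn)] stands for the formal sum
   p1 ⊗ q1 + .. + pn ⊗ qn; [tens_rel] is the congruence generated by the
   relations of P ⊗_S Q. *)
Inductive tens_rel : seq (P * Q) -> seq (P * Q) -> Prop :=
| tens_refl s : tens_rel s s
| tens_sym s t : tens_rel s t -> tens_rel t s
| tens_trans s t u : tens_rel s t -> tens_rel t u -> tens_rel s u
| tens_cat s s' t t' :
    tens_rel s s' -> tens_rel t t' -> tens_rel (s ++ t) (s' ++ t')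
| tens_catC s t : tens_rel (s ++ t) (t ++ s)
| tens_zero q : tens_rel [:: (0, q)] [::]
| tens_addl p p' q : tens_rel [:: (p + p', q)] [:: (p, q); (p', q)]
| tens_addr p q q' : tens_rel [:: (p, q + q')] [:: (p, q); (p, q')]
| tens_mid a p q : tens_rel [:: (aP a p, q)] [:: (p, aQ a q)].

Definition tens_equiv (s t : seq (P * Q)) : bool := `[< tens_rel s t >].

Lemma tens_equivP : equiv_class_of tens_equiv.
Proof.
split=> [s|s t|t s u]; rewrite /tens_equiv.
- by apply/asboolP; exact: tens_refl.
- by apply/asboolP/asboolP; exact: tens_sym.
- by move=> /asboolP st /asboolP tu; apply/asboolP; exact: tens_trans st tu.
Qed.

Canonical tens_equiv_rel := EquivRelPack tens_equivP.

Definition tens := {eq_quot tens_equiv_rel}.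
HB.instance Definition _ := Choice.on tens.

Definition tens_pi (s : seq (P * Q)) : tens := \pi s.
Definition pure (p : P) (q : Q) : tens := tens_pi [:: (p, q)].

Lemma tens_piP s t : tens_pi s = tens_pi t <-> tens_rel s t.
Proof. by split=> [/eqmodP /asboolP //|st]; apply/eqmodP/asboolP. Qed.

Lemma tens_piK t : tens_pi (repr t) = t. Proof. exact: reprK. Qed.

Lemma tens_repr s : tens_rel (repr (tens_pi s)) s.
Proof. by apply/tens_piP; rewrite tens_piK. Qed.

Let neg (s : seq (P * Q)) := [seq (- x.1, x.2) | x <- s].

Definition tens_add (t u : tens) := tens_pi (repr t ++ repr u).
Definition tens_opp (t : tens) := tens_pi (neg (repr t)).

Lemma tens_addE s t : tens_add (tens_pi s) (tens_pi t) = tens_pi (s ++ t).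
Proof. by apply/tens_piP/tens_cat; exact: tens_repr. Qed.

Lemma tens_pi_ind (C : tens -> Prop) : (forall s, C (tens_pi s)) -> forall t, C t.
Proof. by move=> Cs t; rewrite -(tens_piK t). Qed.

Lemma tens_addA : associative tens_add.
Proof.
elim/tens_pi_ind=> s; elim/tens_pi_ind=> t; elim/tens_pi_ind=> u.
by rewrite !tens_addE catA.
Qed.
Lemma tens_addC : commutative tens_add.
Proof.
elim/tens_pi_ind=> s; elim/tens_pi_ind=> t; rewrite !tens_addE.
by apply/tens_piP; exact: tens_catC.
Qed.
Lemma tens_add0 : left_id (tens_pi [::]) tens_add.
Proof. by elim/tens_pi_ind=> s; rewrite !tens_addE. Qed.

Lemma tens_addN : left_inverse (tens_pi [::]) tens_opp tens_add.
Proof.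
move=> t; rewrite -[in X in tens_add _ X](tens_piK t) tens_addE.
apply/tens_piP; elim: (repr t) => [|[p q] s IHs]; first exact: tens_refl.
have -> : neg ((p, q) :: s) ++ (p, q) :: s
        = ([:: (- p, q)] ++ (neg s ++ [:: (p, q)])) ++ s.
  by rewrite /= -catA.
have H1 : tens_rel ([:: (- p, q)] ++ (neg s ++ [:: (p, q)]))
                   ([:: (- p, q)] ++ ([:: (p, q)] ++ neg s)).
  by apply: tens_cat; [exact: tens_refl|exact: tens_catC].
have H2 : tens_rel ([:: (- p, q)] ++ [:: (p, q)]) [::].
  apply: tens_trans (tens_zero q); rewrite -(addNr p).
  exact/tens_sym/tens_addl.
apply: tens_trans (tens_cat H1 (tens_refl s)) _.
rewrite catA -catA; exact: (tens_cat H2 IHs).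
Qed.

HB.instance Definition _ :=
  GRing.isZmodule.Build tens tens_addA tens_addC tens_add0 tens_addN.

Lemma tens_pi_cat s t : tens_pi (s ++ t) = tens_pi s + tens_pi t.
Proof. by rewrite -tens_addE. Qed.

Lemma tens_ind (C : tens -> Prop) :
  C 0 -> (forall p q, C (pure p q)) ->
  (forall t u, C t -> C u -> C (t + u)) -> forall t, C t.
Proof.
move=> C0 Cp CD; elim/tens_pi_ind; elim=> [//|[p q] s IHs].
by rewrite -cat1s tens_pi_cat; apply: CD; [exact: Cp|exact: IHs].
Qed.

Record balanced (G : zmodType) (f : P -> Q -> G) : Prop := Balanced {
  bal_addl : forall p p' q, f (p + p') q = f p q + f p' q;
  bal_addr : forall p q q', f p (q + q') = f p q + f p q';
  bal_mid : forall a p q, f (aP a p) q = f p (aQ a q) }.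

Section Balanced.
Variables (G : zmodType) (f : P -> Q -> G).
Hypothesis fP : balanced f.

Lemma bal_0l q : f 0 q = 0.
Proof. by apply: (addrI (f 0 q)); rewrite -(bal_addl fP) !addr0. Qed.
Lemma bal_0r p : f p 0 = 0.
Proof. by apply: (addrI (f p 0)); rewrite -(bal_addr fP) !addr0. Qed.
Lemma bal_oppl p q : f (- p) q = - f p q.
Proof. by apply: (addrI (f p q)); rewrite -(bal_addl fP) !subrr bal_0l. Qed.
Lemma bal_oppr p q : f p (- q) = - f p q.
Proof. by apply: (addrI (f p q)); rewrite -(bal_addr fP) !subrr bal_0r. Qed.
End Balanced.

Lemma pure_balanced : balanced pure.
Proof.
split=> *; rewrite /pure -?tens_pi_cat; apply/tens_piP;
  [exact: tens_addl|exact: tens_addr|exact: tens_mid].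
Qed.

(* Only meaningful for a balanced f: see [tens_lift_pure] and [tens_liftD]. *)
Definition tens_lift (G : zmodType) (f : P -> Q -> G) (t : tens) : G :=
  \sum_(x <- repr t) f x.1 x.2.

Section Lift.
Variables (G : zmodType) (f : P -> Q -> G).
Hypothesis fP : balanced f.

Lemma tens_lift_pi s : tens_lift f (tens_pi s) = \sum_(x <- s) f x.1 x.2.
Proof.
have H u t : tens_rel u t ->
    \sum_(x <- u) f x.1 x.2 = \sum_(x <- t) f x.1 x.2; last exact/H/tens_repr.
elim=> {u t s} [//||||||||].
- by move=> ? ? _ ->.
- by move=> ? ? ? _ -> _ ->.
- by move=> ? ? ? ? _ IHs _ IHt; rewrite !big_cat /= IHs IHt.
- by move=> ? ?; rewrite !big_cat /= addrC.
- move=> q; rewrite big_seq1 big_nil /=.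
  by apply: (addrI (f 0 q)); rewrite -(bal_addl fP) !addr0.
- by move=> p p' q; rewrite !big_cons !big_nil !addr0 (bal_addl fP).
- by move=> p q q'; rewrite !big_cons !big_nil !addr0 (bal_addr fP).
- by move=> a p q; rewrite !big_cons !big_nil !addr0 (bal_mid fP).
Qed.

Lemma tens_lift_pure p q : tens_lift f (pure p q) = f p q.
Proof. by rewrite tens_lift_pi big_seq1. Qed.

Lemma tens_liftD t u : tens_lift f (t + u) = tens_lift f t + tens_lift f u.
Proof.
elim/tens_pi_ind: t => s; elim/tens_pi_ind: u => s'.
by rewrite -tens_pi_cat !tens_lift_pi big_cat.
Qed.

Lemma tens_lift0 : tens_lift f 0 = 0.
Proof. by rewrite [LHS](tens_lift_pi [::]) big_nil. Qed.

End Lift.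

End Tensor.

Section BaseChange.
Variables (A : pzRingType) (B : comPzRingType) (i : {rmorphism A -> B}).
Variable P : lmodType A.

(* B ⊗_A P, with B an A-module through i, as a B-module *)
Definition basechange :=
  tens (fun (a : A) (b : B) => i a * b) (fun (a : A) (p : P) => a *: p).
HB.instance Definition _ := GRing.Zmodule.on basechange.

Definition btens (b : B) (p : P) : basechange := pure _ _ b p.

Definition bscale (b : B) (t : basechange) : basechange :=
  tens_lift (fun b' p => btens (b * b') p) t.

Let bal (G : zmodType) (f : B -> P -> G) : Prop :=
  balanced (fun (a : A) (b : B) => i a * b) (fun (a : A) (p : P) => a *: p) f.

Lemma btens_balanced : bal btens.
Proof. exact: pure_balanced. Qed.

Lemma bscale_balanced b : bal (fun b' p => btens (b * b') p).
Proof.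
have H := btens_balanced; split=> *.
- by rewrite mulrDr (bal_addl H).
- by rewrite (bal_addr H).
- by rewrite mulrCA (bal_mid H).
Qed.

Lemma bscale_tens b b' p : bscale b (btens b' p) = btens (b * b') p.
Proof. exact: tens_lift_pure (bscale_balanced b) _ _. Qed.

Lemma bscaleD b : {morph bscale b : t u / t + u}.
Proof. by move=> t u; exact: tens_liftD (bscale_balanced b) _ _. Qed.

Lemma bscale0 b : bscale b 0 = 0.
Proof. exact: tens_lift0 (bscale_balanced b). Qed.

Lemma bscaleA a b t : bscale a (bscale b t) = bscale (a * b) t.
Proof.
elim/tens_ind: t => [|p q|t u IHt IHu]; first by rewrite !bscale0.
  by rewrite -/(btens p q) !bscale_tens mulrA.
by rewrite !bscaleD IHt IHu.
Qed.
Lemma bscale1 : left_id 1 bscale.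
Proof.
elim/tens_ind => [|p q|t u IHt IHu]; first by rewrite !bscale0.
  by rewrite -/(btens p q) !bscale_tens mul1r.
by rewrite !bscaleD IHt IHu.
Qed.
Lemma bscaleDr : right_distributive bscale +%R.
Proof. by move=> b t u; exact: bscaleD. Qed.
Lemma bscaleDl t : {morph bscale^~ t : a b / a + b}.
Proof.
move=> a b; elim/tens_ind: t => [|p q|t u IHt IHu].
- by rewrite !bscale0 addr0.
- by rewrite -/(btens p q) !bscale_tens mulrDl (bal_addl btens_balanced).
- by rewrite !bscaleD IHt IHu addrACA.
Qed.

HB.instance Definition _ := GRing.Zmodule_isLmodule.Build B basechange
  bscaleA bscale1 bscaleDr bscaleDl.

End BaseChange.

(* Commutative R-algebras given by their structure morphism; unlike the
   library's [comAlgType], the zero algebra (C^oo of the empty manifold) is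
   allowed. *)
HB.mixin Record isCAlg (R : pzRingType) A of GRing.ComPzRing A := {
  scal : {rmorphism R -> A} }.

#[short(type="calgType")]
HB.structure Definition CAlg (R : pzRingType) :=
  {A of isCAlg R A & GRing.ComPzRing A}.

Section AlgTensor.
Variables (R : comPzRingType) (X Y : calgType R).

Definition atens :=
  tens (fun (k : R) (x : X) => scal k * x) (fun (k : R) (y : Y) => scal k * y).
HB.instance Definition _ := GRing.Zmodule.on atens.

Definition apure (x : X) (y : Y) : atens := pure _ _ x y.

Let bal (G : zmodType) (f : X -> Y -> G) : Prop :=
  balanced (fun (k : R) (x : X) => scal k * x)
           (fun (k : R) (y : Y) => scal k * y) f.

Lemma apure_balanced : bal apure. Proof. exact: pure_balanced. Qed.
Let aD := bal_addl apure_balanced.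
Let Da := bal_addr apure_balanced.
Let aZ := bal_mid apure_balanced.

Lemma atens_ind (C : atens -> Prop) :
  C 0 -> (forall x y, C (apure x y)) ->
  (forall t u, C t -> C u -> C (t + u)) -> forall t, C t.
Proof. exact: tens_ind. Qed.

Definition amul1 (x : X) (y : Y) (u : atens) : atens :=
  tens_lift (fun x' y' => apure (x * x') (y * y')) u.
Definition amul (t u : atens) : atens := tens_lift (fun x y => amul1 x y u) t.

Lemma amul1_balanced x y : bal (fun x' y' => apure (x * x') (y * y')).
Proof.
split=> *; first by rewrite mulrDr aD.
  by rewrite mulrDr Da.
by rewrite mulrCA (mulrCA y) aZ.
Qed.

Lemma amul1_pure x y x' y' : amul1 x y (apure x' y') = apure (x * x') (y * y').
Proof. exact: tens_lift_pure (amul1_balanced x y) _ _. Qed.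
Lemma amul1D x y t u : amul1 x y (t + u) = amul1 x y t + amul1 x y u.
Proof. exact: tens_liftD (amul1_balanced x y) _ _. Qed.
Lemma amul10 x y : amul1 x y 0 = 0.
Proof. exact: tens_lift0 (amul1_balanced x y). Qed.

Lemma amul_balanced u : bal (fun x y => amul1 x y u).
Proof.
split=> [x x' y|x y y'|k x y]; elim/atens_ind: u => [|x0 y0|t u IHt IHu];
  rewrite ?amul10 ?addr0 //.
- by rewrite !amul1_pure mulrDl aD.
- by rewrite !amul1D IHt IHu addrACA.
- by rewrite !amul1_pure mulrDl Da.
- by rewrite !amul1D IHt IHu addrACA.
- by rewrite !amul1_pure -!mulrA aZ.
- by rewrite !amul1D IHt IHu.
Qed.

Lemma amul_pure1 x y u : amul (apure x y) u = amul1 x y u.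
Proof. exact: (tens_lift_pure (amul_balanced u)). Qed.
Lemma amul_pure x y x' y' :
  amul (apure x y) (apure x' y') = apure (x * x') (y * y').
Proof. by rewrite amul_pure1 amul1_pure. Qed.
Lemma amulDl : left_distributive amul +%R.
Proof. by move=> s t u; exact: tens_liftD (amul_balanced u) _ _. Qed.
Lemma amul0 u : amul 0 u = 0.
Proof. exact: tens_lift0 (amul_balanced u). Qed.
Lemma amulDr s t u : amul s (t + u) = amul s t + amul s u.
Proof.
elim/atens_ind: s => [|x y|s s' IHs IHs']; first by rewrite !amul0 addr0.
  by rewrite !amul_pure1 amul1D.
by rewrite !amulDl IHs IHs' addrACA.
Qed.
Lemma amulr0 s : amul s 0 = 0.
Proof. by apply: (addrI (amul s 0)); rewrite -amulDr !addr0. Qed.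

Lemma amulC : commutative amul.
Proof.
elim/atens_ind=> [|x y|s s' IHs IHs'] u; first by rewrite amul0 amulr0.
  elim/atens_ind: u => [|x' y'|t t' IHt IHt']; first by rewrite amul0 amulr0.
    by rewrite !amul_pure mulrC (mulrC y).
  by rewrite amulDl amulDr IHt IHt'.
by rewrite amulDl amulDr IHs IHs'.
Qed.

Lemma amulA : associative amul.
Proof.
elim/atens_ind=> [|x y|s s' IHs IHs'] t u; first by rewrite !amul0.
  elim/atens_ind: t => [|x' y'|t t' IHt IHt'].
  - by rewrite !(amul0, amulr0).
  - elim/atens_ind: u => [|x2 y2|u u' IHu IHu'].
    + by rewrite !(amul0, amulr0).
    + by rewrite !amul_pure !mulrA.
    + by rewrite !amulDr IHu IHu'.
  - by rewrite !(amulDr, amulDl) IHt IHt'.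
by rewrite !amulDl IHs IHs'.
Qed.

Lemma amul1l : left_id (apure 1 1) amul.
Proof.
elim/atens_ind=> [|x y|s s' IHs IHs']; first by rewrite amulr0.
  by rewrite amul_pure !mul1r.
by rewrite amulDr IHs IHs'.
Qed.

HB.instance Definition _ := GRing.Zmodule_isComPzRing.Build atens
  amulA amulC amul1l amulDl.

Lemma apureM x y x' y' : apure x y * apure x' y' = apure (x * x') (y * y').
Proof. exact: amul_pure. Qed.

Definition ascal (k : R) : atens := apure (scal k) 1.

Lemma ascal_zmod : zmod_morphism ascal.
Proof.
move=> k l; rewrite /ascal rmorphB; apply: (addIr (apure (scal l) 1)).
by rewrite -aD !subrK.
Qed.
Lemma ascal_monoid : monoid_morphism ascal.
Proof.
by split=> [|k l]; rewrite /ascal ?rmorph1 // rmorphM apureM mulr1.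
Qed.

HB.instance Definition _ := GRing.isZmodMorphism.Build R atens ascal ascal_zmod.
HB.instance Definition _ :=
  GRing.isMonoidMorphism.Build R atens ascal ascal_monoid.
HB.instance Definition _ := isCAlg.Build R atens ascal.

End AlgTensor.

Section Smooth.
Variables (R : realType) (n : nat).
Implicit Types (U : set 'rV[R]_n) (f g : 'rV[R]_n -> R).

Definition evec (j : 'I_n) : 'rV[R]_n := delta_mx 0 j.

(* Class C^k on U, for U open: continuity and partial derivatives are taken in
   the whole space. *)
Fixpoint class_C (k : nat) U f : Prop :=
  (forall x, U x -> {for x, continuous f}) /\
  if k is k'.+1 then
    forall j, (forall x, U x -> derivable f x (evec j)) /\
              class_C k' U (fun x => 'D_(evec j) f x)
  else True.

Definition smooth_on U f : Prop := forall k, class_C k U f.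

Lemma class_CS k U f : class_C k.+1 U f -> class_C k U f.
Proof.
elim: k f => [|k IHk] f; first by move=> [].
by move=> [cf df]; split=> // j; have [dfj Cfj] := df j; split=> //; exact: IHk.
Qed.

Lemma class_C_cont k U f : class_C k U f -> forall x, U x -> {for x, continuous f}.
Proof. by case: k => [|k] []. Qed.

Lemma continuous_near_eq f g (x : 'rV[R]_n) : (\near x, f x = g x) ->
  {for x, continuous f} -> {for x, continuous g}.
Proof.
move=> fg cf; rewrite /prop_for /continuous_at -(nbhs_singleton fg).
exact: cvg_trans (@near_eq_cvg _ _ (nbhs x) _ f g fg) cf.
Qed.

Lemma class_C_ext k U f g : open U -> (forall x, U x -> f x = g x) ->
  class_C k U f -> class_C k U g.
Proof.
move=> oU; elim: k f g => [|k IHk] f g fg [cf df].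
all: have fgn x : U x -> \near x, f x = g x by
  move=> Ux; apply: (filterS fg); exact: open_nbhs_nbhs.
all: split=> [x Ux|//]; first exact: continuous_near_eq (fgn x Ux) (cf x Ux).
move=> j; have [dfj Cfj] := df j; split=> [x Ux|].
  exact: (near_eq_derivable (fgn x Ux)) (dfj x Ux).
apply: (IHk (fun x => 'D_(evec j) f x)) => // x Ux.
exact: near_eq_derive (fgn x Ux).
Qed.

Lemma smooth_on_ext U f g : open U -> (forall x, U x -> f x = g x) ->
  smooth_on U f -> smooth_on U g.
Proof. by move=> oU fg sf k; exact: class_C_ext (sf k). Qed.

Lemma smooth_on_cst U (c : R) : smooth_on U (cst c).
Proof.
move=> k; elim: k c => [|k IHk] c; first by split=> // x _; exact: cst_continuous.
split=> [x _|j]; first exact: cst_continuous.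
split=> [x _|]; first exact: derivable_cst.
have -> : (fun x => 'D_(evec j) (cst c) x) = cst 0.
  by apply/funext => x; exact: derive_cst.
exact: IHk.
Qed.

Lemma class_CD k U f g : open U ->
  class_C k U f -> class_C k U g -> class_C k U (f + g).
Proof.
move=> oU; elim: k f g => [|k IHk] f g Cf Cg; split.
- by move=> x Ux; apply: continuousD; [case: Cf => + _|case: Cg => + _]; exact.
- by [].
- by move=> x Ux; apply: continuousD; [case: Cf => + _|case: Cg => + _]; exact.
- move=> j; case: Cf Cg => _ /(_ j)[df Cf] [_ /(_ j)[dg Cg]].
  split=> [x Ux|]; first by apply: derivableD; [exact: df|exact: dg].
  apply: class_C_ext (IHk _ _ Cf Cg) => // x Ux.
  by rewrite [RHS]deriveD //; [exact: df|exact: dg].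
Qed.

Lemma class_CM k U f g : open U ->
  class_C k U f -> class_C k U g -> class_C k U (f * g).
Proof.
move=> oU; elim: k f g => [|k IHk] f g Cf Cg; split.
- by move=> x Ux; apply: continuousM; [case: Cf => + _|case: Cg => + _]; exact.
- by [].
- by move=> x Ux; apply: continuousM; [case: Cf => + _|case: Cg => + _]; exact.
- have [Cf' Cg'] := (class_CS Cf, class_CS Cg).
  move=> j; case: Cf Cg => _ /(_ j)[df Cf] [_ /(_ j)[dg Cg]].
  split=> [x Ux|]; first by apply: derivableM; [exact: df|exact: dg].
  apply: class_C_ext (class_CD oU (IHk _ _ Cf' Cg) (IHk _ _ Cg' Cf)) => // x Ux.
  by rewrite [RHS]deriveM //; [exact: df|exact: dg].
Qed.

Lemma smooth_onD U f g : open U ->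
  smooth_on U f -> smooth_on U g -> smooth_on U (f + g).
Proof. by move=> oU sf sg k; exact: class_CD. Qed.

Lemma smooth_onM U f g : open U ->
  smooth_on U f -> smooth_on U g -> smooth_on U (f * g).
Proof. by move=> oU sf sg k; exact: class_CM. Qed.

Lemma smooth_onB U f g : open U ->
  smooth_on U f -> smooth_on U g -> smooth_on U (f - g).
Proof.
move=> oU sf sg; apply: smooth_onD => //.
have -> : - g = cst (-1) * g by apply/funext => x; rewrite !fctE mulN1r.
by apply: smooth_onM => //; exact: smooth_on_cst.
Qed.

End Smooth.

Lemma smooth_comp_linear (R : realType) m n
    (L : {linear 'rV[R]_m -> 'rV[R]_n}) (f : 'rV[R]_n -> R) :
  continuous L ->
  (forall j, L (evec R j) = 0 \/ exists i, L (evec R j) = evec R i) ->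
  smooth_on setT f -> smooth_on setT (f \o L).
Proof.
move=> cL Le sf k; move/(_ k): sf; elim: k f => [|k IHk] f Cf.
  by split=> // x _; apply: continuous_comp; [exact: cL|case: Cf => + _; exact].
split.
  by move=> x _; apply: continuous_comp; [exact: cL|case: Cf => + _; exact].
move=> j; case: Cf => _ df.
have E x : (fun h : R => h^-1 *: (((f \o L) \o shift x) (h *: evec R j) - (f \o L) x))
         = (fun h : R => h^-1 *: ((f \o shift (L x)) (h *: L (evec R j)) - f (L x))).
  by apply/funext => h /=; rewrite linearP.
have Ed x : derivable (f \o L) x (evec R j) = derivable f (L x) (L (evec R j)).
  by rewrite /derivable E.
have ED : (fun x => 'D_(evec R j) (f \o L) x)
        = (fun y => 'D_(L (evec R j)) f y) \o L.
  by apply/funext => x; rewrite /derive E.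
rewrite ED; split=> [x _|].
  rewrite Ed; case: (Le j) => [->|[i ->]]; first exact: derivable0.
  by case: (df i) => + _; exact.
case: (Le j) => [->|[i ->]]; last by apply: IHk; case: (df i).
have -> : (fun y => 'D_0 f y) \o L = cst 0 by apply/funext => x; exact: derive0.
exact: smooth_on_cst.
Qed.

(* A chart is a homeomorphism from an open subset of M onto an open subset of
   R^n; [chart_map] and [chart_inv] are irrelevant outside these sets. *)
Record chart (R : realType) (n : nat) (M : topologicalType) := Chart {
  chart_dom : set M;
  chart_map :> M -> 'rV[R]_n;
  chart_inv : 'rV[R]_n -> M;
  chart_open : open chart_dom;
  chart_cod_open : open (chart_map @` chart_dom);
  chart_mapK : forall x, chart_dom x -> chart_inv (chart_map x) = x;
  chart_cont : forall x, chart_dom x -> {for x, continuous chart_map};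
  chart_inv_cont : forall u, (chart_map @` chart_dom) u ->
    {for u, continuous chart_inv} }.

Definition chart_compat (R : realType) n M (c c' : chart R n M) : Prop :=
  forall j, smooth_on (c @` (chart_dom c `&` chart_dom c'))
                      (fun u => c' (chart_inv c u) 0 j).

(* The atlas need not be maximal. *)
Record manifold (R : realType) := Manifold {
  carrier :> topologicalType;
  dim : nat;
  atlas : set (chart R dim carrier);
  manifold_hausdorff : hausdorff_space carrier;
  manifold_second_countable : @second_countable carrier;
  atlas_cover : forall x : carrier, exists2 c, atlas c & chart_dom c x;
  atlas_compat : forall c c', atlas c -> atlas c' -> chart_compat c c' }.

Definition smooth (R : realType) (M : manifold R) (f : M -> R) : Prop :=
  forall c, atlas c -> smooth_on (c @` chart_dom c) (f \o chart_inv c).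

Record spectrum (R : comPzRingType) (A : calgType R) := Spectrum {
  spec_hom :> {rmorphism A -> R};
  spec_scal : forall k, spec_hom (scal k) = k }.

HB.mixin Record isGeometric (R : comPzRingType) A of CAlg R A := {
  geometric : forall a : A, (forall h : spectrum A, h a = 0) -> a = 0 }.

#[short(type="geomAlgType")]
HB.structure Definition GeomAlg (R : comPzRingType) :=
  {A of isGeometric R A & CAlg R A}.

Section SmoothFunctions.
Variables (R : realType) (M : manifold R).

Definition smooth_pred : {pred M -> R} := fun f => `[< smooth f >].

Lemma smooth_subring : subring_closed smooth_pred.
Proof.
split=> [|f g /asboolP sf /asboolP sg|f g /asboolP sf /asboolP sg].
- by apply/asboolP => c _; exact: (smooth_on_cst _ 1).
- apply/asboolP => c Ac.
  apply: smooth_onB; [exact: chart_cod_open|exact: sf|exact: sg].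
- apply/asboolP => c Ac.
  apply: smooth_onM; [exact: chart_cod_open|exact: sf|exact: sg].
Qed.

Record Cinf := MkCinf { Cinf_fun :> M -> R; _ : Cinf_fun \in smooth_pred }.

HB.instance Definition _ := [isSub for Cinf_fun].
HB.instance Definition _ := [Choice of Cinf by <:].
HB.instance Definition _ := 
  GRing.SubChoice_isSubComPzRing.Build _ _ Cinf smooth_subring.

Lemma CinfP (f : Cinf) : smooth f. Proof. exact/asboolP/(valP f). Qed.

Lemma Cinf_cst_subproof (k : R) : cst k \in smooth_pred.
Proof. by apply/asboolP => c _; exact: smooth_on_cst. Qed.

Definition Cinf_cst (k : R) : Cinf := MkCinf (Cinf_cst_subproof k).

Lemma Cinf_cst_zmod : zmod_morphism Cinf_cst.
Proof. by move=> k l; apply: val_inj; rewrite raddfB. Qed.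
Lemma Cinf_cst_monoid : monoid_morphism Cinf_cst.
Proof. by split=> [|k l]; apply: val_inj; rewrite ?rmorph1 ?rmorphM. Qed.
HB.instance Definition _ := GRing.isZmodMorphism.Build R Cinf Cinf_cst Cinf_cst_zmod.
HB.instance Definition _ :=
  GRing.isMonoidMorphism.Build R Cinf Cinf_cst Cinf_cst_monoid.
HB.instance Definition _ := isCAlg.Build R Cinf Cinf_cst.

Definition ev (x : M) (f : Cinf) : R := f x.
Lemma ev_zmod x : zmod_morphism (ev x).
Proof. by move=> f g; rewrite /ev [LHS](congr1 (@^~ x) (raddfB val f g)). Qed.
Lemma ev_monoid x : monoid_morphism (ev x).
Proof.
split=> [|f g]; rewrite /ev; first by rewrite [LHS](congr1 (@^~ x) (rmorph1 val)).
by rewrite [LHS](congr1 (@^~ x) (rmorphM val f g)).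
Qed.
HB.instance Definition _ x := GRing.isZmodMorphism.Build Cinf R (ev x) (ev_zmod x).
HB.instance Definition _ x :=
  GRing.isMonoidMorphism.Build Cinf R (ev x) (ev_monoid x).

Lemma ev_scal x k : ev x (scal k) = k. Proof. by []. Qed.

Definition ev_spec (x : M) : spectrum Cinf := Spectrum (ev_scal x).

Lemma Cinf_geometric (f : Cinf) : (forall h : spectrum Cinf, h f = 0) -> f = 0.
Proof.
move=> hf; apply: val_inj; rewrite raddf0; apply/funext => x.
exact: (hf (ev_spec x)).
Qed.
HB.instance Definition _ := isGeometric.Build R Cinf Cinf_geometric.

End SmoothFunctions.

Section TensorGeometric.
Variables (F : fieldType) (X Y : geomAlgType F).

Section Spec.
Variables (h : spectrum X) (k : spectrum Y).

Definition spec2 (t : atens X Y) : F := tens_lift (fun x y => h x * k y) t.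

Let bal : balanced (fun (c : F) (x : X) => scal c * x)
                   (fun (c : F) (y : Y) => scal c * y) (fun x y => h x * k y).
Proof.
split=> *; rewrite ?rmorphD ?mulrDl ?mulrDr //.
by rewrite !rmorphM !spec_scal mulrCA mulrA.
Qed.

Lemma spec2_pure x y : spec2 (apure x y) = h x * k y.
Proof. exact: tens_lift_pure bal _ _. Qed.

Lemma spec2D t u : spec2 (t + u) = spec2 t + spec2 u.
Proof. exact: tens_liftD bal _ _. Qed.

Lemma spec20 : spec2 0 = 0.
Proof. exact: tens_lift0 bal. Qed.

Lemma spec2_zmod : zmod_morphism spec2.
Proof. by move=> t u; apply: (addIr (spec2 u)); rewrite -spec2D !subrK. Qed.

Lemma spec2_monoid : monoid_morphism spec2.
Proof.
split=> [|t u]; first by rewrite spec2_pure !rmorph1 mulr1.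
elim/atens_ind: t => [|x y|t t' IHt IHt'].
- by rewrite !(mul0r, spec20).
- elim/atens_ind: u => [|x' y'|u u' IHu IHu'].
  + by rewrite !(mulr0, spec20).
  + by rewrite apureM !spec2_pure !rmorphM mulrACA.
  + by rewrite mulrDr !spec2D mulrDr IHu IHu'.
- by rewrite mulrDl !spec2D mulrDl IHt IHt'.
Qed.

HB.instance Definition _ :=
  GRing.isZmodMorphism.Build (atens X Y) F spec2 spec2_zmod.
HB.instance Definition _ :=
  GRing.isMonoidMorphism.Build (atens X Y) F spec2 spec2_monoid.

Lemma spec2_scal c : spec2 (scal c) = c.
Proof. by rewrite spec2_pure spec_scal rmorph1 mulr1. Qed.

Definition atens_spec : spectrum (atens X Y) := Spectrum spec2_scal.

End Spec.

Lemma atens_geometric (t : atens X Y) :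
  (forall h : spectrum (atens X Y), h t = 0) -> t = 0.
Proof.
move=> ht; have {ht} : forall h k, spec2 h k t = 0.
  by move=> h k; exact: (ht (atens_spec h k)).
have bp := apure_balanced X Y.
have [s ->] : exists s : seq (X * Y), t = \sum_(p <- s) apure p.1 p.2.
  elim/atens_ind: t => [|x y|t u [s ->] [s' ->]].
  - by exists [::]; rewrite big_nil.
  - by exists [:: (x, y)]; rewrite big_seq1.
  - by exists (s ++ s'); rewrite big_cat.
have spec2_sum h k (s' : seq (X * Y)) :
    spec2 h k (\sum_(p <- s') apure p.1 p.2) = \sum_(p <- s') h p.1 * k p.2.
  by rewrite (big_morph _ (spec2D h k) (spec20 h k)); apply: eq_bigr => p _; rewrite spec2_pure.
elim: {s}(size s) {-2}s (leqnn (size s)) => [|n IHn] [|[x y] s] //=;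
  rewrite ?big_nil // big_cons /= => sn H.
have [[k ky]|ky] := pselect (exists k : spectrum Y, k y != 0); last first.
  have y0 : y = 0.
    apply: geometric => k; apply: contrapT => /eqP kn; apply: ky; by exists k.
  have p0 : apure x y = 0 by rewrite y0 (bal_0r bp).
  by move: H; rewrite p0 add0r; exact: IHn.
pose c (y' : Y) : F := k y' / k y.
have xE : x = - \sum_(p <- s) scal (c p.2) * p.1.
  apply/eqP; rewrite -addr_eq0; apply/eqP/geometric => h.
  have := H h k; rewrite spec2D spec2_pure spec2_sum => /(congr1 ( *%R^~ (k y)^-1)).
  rewrite mul0r mulrDl mulfK // mulr_suml rmorphD rmorph_sum => H0; rewrite -[RHS]H0.
  congr (_ + _); apply: eq_bigr => p _.
  by rewrite rmorphM spec_scal /c mulrC mulrA.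
have E : apure x y + \sum_(p <- s) apure p.1 p.2 =
    \sum_(p <- [seq (p.1, p.2 - scal (c p.2) * y) | p <- s]) apure p.1 p.2.
  rewrite big_map xE /= {xE H sn}.
  elim: s => [|p s IHs]; first by rewrite !big_nil oppr0 (bal_0l bp) addr0.
  rewrite !big_cons -IHs opprD (bal_addl bp) (bal_addr bp) (bal_oppr bp).
  by rewrite (bal_oppl bp) -(bal_mid bp) addrACA (addrC (- _)).
move: H; rewrite E; apply: IHn; by rewrite size_map.
Qed.

HB.instance Definition _ := isGeometric.Build F (atens X Y) atens_geometric.

End TensorGeometric.

Section Envelope.
Variables (R : realType) (A : calgType R).

Definition envelope_pred : {pred spectrum A -> R} := fun f =>
  `[< exists k (a : 'I_k -> A) (H : 'rV[R]_k -> R), smooth_on setT H /\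
      f = fun h : spectrum A => H (\row_i h (a i)) >].

Lemma envelope_pred2 (op : forall T : Type, (T -> R) -> (T -> R) -> T -> R) f g :
  (forall T S (u v : T -> R) (s : S -> T), op T u v \o s = op S (u \o s) (v \o s)) ->
  (forall n (u v : 'rV[R]_n -> R), smooth_on setT u -> smooth_on setT v ->
    smooth_on setT (op _ u v)) ->
  f \in envelope_pred -> g \in envelope_pred -> op _ f g \in envelope_pred.
Proof.
move=> opc sop /asboolP[k [a [H [sH ->]]]] /asboolP[l [b [G [sG ->]]]].
apply/asboolP; exists (k + l)%N.
exists (fun i => match fintype.split i with inl i => a i | inr i => b i end).
exists (op _ (H \o lsubmx) (G \o rsubmx)).
have cl : continuous (@lsubmx R 1 k l).
  by move=> x; apply: differentiable_continuous; exact: differentiable_lsubmx.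
have cr : continuous (@rsubmx R 1 k l).
  by move=> x; apply: differentiable_continuous; exact: differentiable_rsubmx.
split.
  apply: sop; apply: smooth_comp_linear => // j;
    rewrite -(splitK j); case: (fintype.split j) => i /=; [right; exists i|left|left|right; exists i];
    apply/rowP => i'; rewrite !mxE eqxx //= -?val_eqE /=.
  - by rewrite ltn_eqF // ltn_addr.
  - by rewrite gtn_eqF // ltn_addr.
  - by rewrite eqn_add2l.
pose s (h : spectrum A) : 'rV[R]_(k + l) :=
  \row_i h (match fintype.split i with inl i => a i | inr i => b i end).
rewrite -[RHS]/(op _ (H \o lsubmx) (G \o rsubmx) \o s) opc.
congr (op _ _ _); apply/funext => h /=; congr (_ _); apply/rowP => i;
  rewrite !mxE; first by rewrite -[lshift l i]/(unsplit (inl i)) unsplitK.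
by rewrite -[rshift k i]/(unsplit (inr i)) unsplitK.
Qed.

Lemma envelope_cst (c : R) : cst c \in envelope_pred.
Proof.
apply/asboolP; exists 0%N, (fun=> 0), (cst c); split=> //; exact: smooth_on_cst.
Qed.

Lemma envelope_subring : subring_closed envelope_pred.
Proof.
split=> [|f g|f g]; first exact: envelope_cst.
- apply: (@envelope_pred2 (fun T u v => u - v)) => // n u v; apply: smooth_onB.
  exact: openT.
- apply: (@envelope_pred2 (fun T u v => u * v)) => // n u v; apply: smooth_onM.
  exact: openT.
Qed.

Record envelope := MkEnvelope {
  envelope_fun :> spectrum A -> R; _ : envelope_fun \in envelope_pred }.

HB.instance Definition _ := [isSub for envelope_fun].
HB.instance Definition _ := [Choice of envelope by <:].
HB.instance Definition _ :=
  GRing.SubChoice_isSubComPzRing.Build _ _ envelope envelope_subring.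

Definition env_cst (k : R) : envelope := MkEnvelope (envelope_cst k).
Lemma env_cst_zmod : zmod_morphism env_cst.
Proof. by move=> k l; apply: val_inj; rewrite raddfB. Qed.
Lemma env_cst_monoid : monoid_morphism env_cst.
Proof. by split=> [|k l]; apply: val_inj; rewrite ?rmorph1 ?rmorphM. Qed.
HB.instance Definition _ :=
  GRing.isZmodMorphism.Build R envelope env_cst env_cst_zmod.
HB.instance Definition _ :=
  GRing.isMonoidMorphism.Build R envelope env_cst env_cst_monoid.
HB.instance Definition _ := isCAlg.Build R envelope env_cst.

Lemma env_in_subproof (a : A) : (fun h : spectrum A => h a) \in envelope_pred.
Proof.
apply/asboolP; exists 1%N, (fun=> a), (fun x => x 0 0); split; last first.
  by apply/funext => h; rewrite mxE.
pose p (x : 'rV[R]_1) : R := x 0 0.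
have D x v : is_derive x v p (v 0 0).
  suff E : h^-1 *: ((p \o shift x) (h *: v) - p x) @[h --> (0 : R)^'] --> v 0 0.
    by split; [apply/cvg_ex; exists (v 0 0)|exact: cvg_lim].
  apply: cvg_near_cst; near=> h.
  rewrite /p /= !mxE addrK [_ *: _]mulrA mulVf ?mul1r //.
  by near: h; exact: nbhs_dnbhs_neq.
case=> [|k]; first by split=> // x _; exact: coord_continuous.
split=> [x _|j]; first exact: coord_continuous.
split=> [x _|]; first exact: (@ex_derive _ _ _ _ _ _ _ (D x _)).
rewrite (_ : (fun x => _) = cst (evec R j 0 0)); first exact: smooth_on_cst.
by apply/funext => x; exact: (@derive_val _ _ _ _ _ _ _ (D x _)).
Unshelve. all: by end_near. Qed.

Definition env_in (a : A) : envelope := MkEnvelope (env_in_subproof a).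
Lemma env_in_zmod : zmod_morphism env_in.
Proof.
by move=> a b; apply: val_inj; apply/funext => h; rewrite raddfB /= rmorphB.
Qed.
Lemma env_in_monoid : monoid_morphism env_in.
Proof.
split=> [|a b]; apply: val_inj; apply/funext => h.
  by rewrite rmorph1 /= rmorph1.
by rewrite rmorphM /= rmorphM.
Qed.
HB.instance Definition _ := GRing.isZmodMorphism.Build A envelope env_in env_in_zmod.
HB.instance Definition _ :=
  GRing.isMonoidMorphism.Build A envelope env_in env_in_monoid.

Section EnvSpec.
Variable h : spectrum A.
Definition env_ev (f : envelope) : R := f h.
Lemma env_ev_zmod : zmod_morphism env_ev.
Proof. by move=> f g; rewrite /env_ev [LHS](congr1 (@^~ h) (raddfB val f g)). Qed.
Lemma env_ev_monoid : monoid_morphism env_ev.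
Proof.
split=> [|f g]; rewrite /env_ev; first by rewrite [LHS](congr1 (@^~ h) (rmorph1 val)).
by rewrite [LHS](congr1 (@^~ h) (rmorphM val f g)).
Qed.
HB.instance Definition _ := GRing.isZmodMorphism.Build envelope R env_ev env_ev_zmod.
HB.instance Definition _ :=
  GRing.isMonoidMorphism.Build envelope R env_ev env_ev_monoid.
Lemma env_ev_scal k : env_ev (scal k) = k. Proof. by []. Qed.
Definition env_ev_spec : spectrum envelope := Spectrum env_ev_scal.
End EnvSpec.

Lemma envelope_geometric (f : envelope) :
  (forall h : spectrum envelope, h f = 0) -> f = 0.
Proof.
move=> hf; apply: val_inj; rewrite raddf0; apply/funext => h.
exact: (hf (env_ev_spec h)).
Qed.
HB.instance Definition _ := isGeometric.Build R envelope envelope_geometric.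

End Envelope.

Lemma env_in_inj (R : realType) (A : geomAlgType R) : injective (@env_in R A).
Proof.
move=> a b ab; apply/eqP; rewrite -subr_eq0; apply/eqP/geometric => h.
by rewrite rmorphB; apply/eqP; rewrite subr_eq0; apply/eqP/(congr1 (@^~ h) (congr1 val ab)).
Qed.

(* B, with the S-module structure given by i *)
Definition restr (S B : pzRingType) (i : {rmorphism S -> B}) : Type := B.

Section RestrictScalars.
Variables (S B : pzRingType) (i : {rmorphism S -> B}).
Local Notation restr := (@restr S B i).

HB.instance Definition _ := GRing.Zmodule.on restr.

Definition restr_scale (s : S) (b : restr) : restr := i s * b.

Lemma restr_scaleA a b c : restr_scale a (restr_scale b c) = restr_scale (a * b) c.
Proof. by rewrite /restr_scale mulrA rmorphM. Qed.
Lemma restr_scale1 : left_id 1 restr_scale.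
Proof. by move=> b; rewrite /restr_scale rmorph1 mul1r. Qed.
Lemma restr_scaleDr : right_distributive restr_scale +%R.
Proof. by move=> s b c; exact: mulrDr. Qed.
Lemma restr_scaleDl b : {morph restr_scale^~ b : s t / s + t}.
Proof. by move=> s t; rewrite /restr_scale rmorphD [LHS]mulrDl. Qed.

HB.instance Definition _ := GRing.Zmodule_isLmodule.Build S restr
  restr_scaleA restr_scale1 restr_scaleDr restr_scaleDl.
End RestrictScalars.

Section Forms.
Variables (R : comPzRingType) (A : calgType R).

(* A ⊗_R A, in which a ⊗ b stands for a db *)
Definition prekahler : lmodType A :=
  basechange (@scal R A) (restr (@scal R A)).

Definition preform (a b : A) : prekahler := btens (@scal R A) a (b : restr (@scal R A)).

Definition leibniz_rel : set prekahler :=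
  [set w | exists a b, w = preform 1 (a * b) - preform a b - preform b a].

Definition kahler : lmodType A := modq (span leibniz_rel).

Definition kahler_d (a : A) : kahler := modq_pi _ (preform 1 a).

Definition mu (h : spectrum A) : set A := [set a | h a = 0].

Section Ghosts.
Variable P : lmodType A.

Definition ghosts : set P :=
  [set p | forall h : spectrum A, comb (mu h) setT p].

Lemma ghosts0 : ghosts 0. Proof. by move=> h; exact: comb0. Qed.
Lemma ghostsD p q : ghosts p -> ghosts q -> ghosts (p + q).
Proof. by move=> gp gq h; exact: combD. Qed.
Lemma ghostsZ a p : ghosts p -> ghosts (a *: p).
Proof.
move=> gp h; apply: combZ => // b c; rewrite /mu /= => hc.
by rewrite rmorphM hc mulr0.
Qed.

Definition ghost_submod : submodule P := Submodule ghosts0 ghostsD ghostsZ.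
End Ghosts.

End Forms.

(* Λ^1(A), the largest geometric quotient of the module of Kähler
   differentials. *)
Definition forms1 (R : comPzRingType) (A : geomAlgType R) : lmodType A :=
  modq (ghost_submod (kahler A)).

Definition form_d (R : comPzRingType) (A : geomAlgType R) (a : A) : forms1 A :=
  modq_pi _ (kahler_d a).

Section FormDerivation.
Variables (R : comPzRingType) (A : geomAlgType R).

Lemma preformD :
  (forall a a' b : A, preform (a + a') b = preform a b + preform a' b) /\
  (forall a b b' : A, preform a (b + b') = preform a b + preform a b').
Proof.
have H := btens_balanced (@scal R A) (restr (@scal R A)).
by split=> *; [exact: (bal_addl H)|exact: (bal_addr H)].
Qed.

Lemma preformZ (a b c : A) : a *: preform b c = preform (a * b) c.
Proof. exact: bscale_tens. Qed.

Lemma form_dD (a b : A) : form_d (a + b) = form_d a + form_d b.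
Proof. by rewrite /form_d /kahler_d (preformD.2 1) !raddfD. Qed.

Lemma form_dZ (k : R) (a : A) : form_d (scal k * a) = scal k *: form_d a.
Proof.
have H := btens_balanced (@scal R A) (restr (@scal R A)).
rewrite /form_d /kahler_d -!modq_piZ preformZ /preform.
by rewrite (bal_mid H k (1 : A) (a : restr (@scal R A))).
Qed.

Lemma form_dM (a b : A) : form_d (a * b) = a *: form_d b + b *: form_d a.
Proof.
rewrite /form_d /kahler_d -!modq_piZ -modq_piD; congr modq_pi.
rewrite -modq_piD; apply/modq_piP.
exists [:: (1, preform 1 (a * b) - preform a b - preform b a)].
  by move=> p; rewrite inE => /eqP ->; split=> //; exists a, b.
by rewrite big_seq1 scale1r !preformZ !mulr1 opprD addrA.
Qed.

End FormDerivation.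

Definition smoothening (R : realType) (A : geomAlgType R) (P : lmodType A) :
    lmodType (envelope A) :=
  basechange (@env_in R A) P.

Definition stens (R : realType) (A : geomAlgType R) (P : lmodType A)
    (f : envelope A) (p : P) : smoothening P :=
  btens (@env_in R A) f p.

(* Main.v *)
Require Import Defs.
From HB Require Import structures.
From mathcomp Require Import all_boot all_order all_algebra.
From mathcomp Require Import all_classical all_reals all_analysis ring lra.
(** The map is inverted explicitly, by means of finitely many elements g_i of the
    algebra A and operators D_i on A such that da = sum_i D_i(a) dg_i holds in the
    module of 1-forms of A.

    Say that D differentiates along curves if every point h of |A| is the origin
    of a curve c_t in |A| with d/dt a(c_t) = (D a)(h) at t = 0, for all a.  Such a
    D extends to the envelope: if f = H(a_1, .., a_k), the chain rule computes the
    derivative of f along c as the value at h of sum_s d_sH(a) D(a_s); the left-hand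
    side depends on the function f only, hence so does the right-hand side, and the
    Leibniz rule for the extension is that of the derivative.  When all the D_i
    differentiate along curves, their extensions are linear functionals X_i on the
    1-forms of the envelope, and w |-> sum_i X_i(w) (1 (x) dg_i) is the two-sided
    inverse ([smoothening_criterion]).  One composite is the identity because
    da = sum_i D_i(a) dg_i.  The other one needs d(H(a)) = sum_s d_sH(a) da_s in the
    1-forms of the envelope ([form_d_env_comp]): by Hadamard's lemma ([hadamard])
    the two sides agree modulo the ideal of each point of the envelope, and a
    geometric module has no nonzero element with this property.

    For a manifold M, the g_i are the components of an immersion of M into R^p,
    and D_i f is the i-th coordinate of J^T (J J^T)^-1 grad f, where J is the
    jacobian of the immersion in a chart; this vector does not depend on the chart
    ([jac_pinv_chart]), and each D_i is a tangent vector at every point of M.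
    The function f - f(x) - sum_i D_i f(x) (g_i - g_i(x)) vanishes to first order at
    x, so it is a sum of products of functions vanishing at x ([flat_mu2]), and
    df = sum_i D_i f dg_i modulo the ideal of x ([form_d_frame]).  On a product of
    manifolds one takes together the operators of the two factors.

    The finiteness of p, that is, the finite generation of the module of 1-forms, is
    what takes work when M is not compact.  On a compact set, the bumped coordinates
    of finitely many charts form an immersion into some R^L, and 2 dim M + 1
    combinations of them are still an immersion if their coefficients are well
    chosen; they exist by a count of integer matrices ([avoid_cells],
    [compact_immersion]).  An exhausting function rho ([proper_fun]) cuts M into the
    compact layers where rho is close to an integer.  The layers of even integers
    are disjoint, so that one family of functions serves them all, and the same
    holds for odd integers ([global_immersion]).

    The exhausting function also identifies the points of |C^oo(M)| with those of M
    ([spectrum_ev]), hence those of |A| with pairs of points. *)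

Set Implicit Arguments.
Unset Strict Implicit.
Unset Printing Implicit Defensive.
Import Order.TTheory GRing.Theory Num.Theory.
Import numFieldNormedType.Exports.
Local Open Scope classical_set_scope.
Local Open Scope ring_scope.

(** * Geometric modules and the universal property of 1-forms *)
Section Geometric.
Variables (R : comPzRingType) (A : geomAlgType R).

Definition geometric_module (P : lmodType A) : Prop := forall p : P, ghosts p -> p = 0.

Lemma comb_mem (P : lmodType A) (h : spectrum A) (a : A) (p : P) :
  h a = 0 -> comb (mu h) setT (a *: p).
Proof.
by move=> ha; exists [:: (a, p)] => [q|]; rewrite ?big_seq1 // inE => /eqP ->.
Qed.

(** An element of the quotient by the ghosts that lies in each mu_h-multiple of the
    quotient lifts, for each h, to an element of mu_h Omega up to a ghost; as ghosts
    lie in mu_h Omega as well, the lift is itself a ghost. *)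
Lemma forms1_geom : geometric_module (forms1 A).
Proof.
elim/modq_ind=> u gu; apply/modq_piP; rewrite subr0 => h.
have [s sP E] := gu h.
have [v gv E2] : exists2 v, ghosts (u - v) & comb (mu h) setT v.
  exists (\sum_(p <- s) p.1 *: repr p.2).
    apply/(modq_piP (ghost_submod (kahler A))); rewrite [LHS]E raddf_sum.
    apply: eq_bigr => p _.
    transitivity (p.1 *: modq_pi (ghost_submod (kahler A)) (repr p.2)).
      by rewrite modq_piK.
    by rewrite -modq_piZ.
  exists [seq (p.1, repr p.2) | p <- s]; last by rewrite big_map.
  by move=> _ /mapP[p /sP[mp _] ->].
by rewrite -(subrK v u); apply: combD => //; exact: gv.
Qed.

Lemma kahler_ind (C : kahler A -> Prop) : C 0 ->
  (forall a b, C (a *: kahler_d b)) -> (forall u v, C u -> C v -> C (u + v)) ->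
  forall u, C u.
Proof.
move=> C0 Cd CD; elim/modq_ind; elim/tens_ind => [|a b|u v Cu Cv].
- by rewrite raddf0.
- have := Cd a b; rewrite -modq_piZ preformZ mulr1; exact.
- by rewrite raddfD; exact: CD.
Qed.

Lemma forms1_ind (C : forms1 A -> Prop) : C 0 ->
  (forall a b, C (a *: form_d b)) -> (forall u v, C u -> C v -> C (u + v)) ->
  forall u, C u.
Proof.
move=> C0 Cd CD; elim/modq_ind; elim/kahler_ind => [|a b|u v Cu Cv].
- by rewrite raddf0.
- by rewrite modq_piZ; exact: Cd.
- by rewrite raddfD; exact: CD.
Qed.

End Geometric.

(** The universal property is stated relatively to a morphism i from A to B, for
    derivations of A in geometric B-modules.  The case i = id gives the functionals
    attached to derivations of the envelope, and the case of the inclusion of A in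
    its envelope gives the map from the forms of A to those of the envelope. *)
Section Universal.
Variables (R : comPzRingType) (A B : geomAlgType R) (i : {rmorphism A -> B}).
Hypothesis iS : forall k, i (scal k) = scal k.
Variables (P : lmodType B) (D : A -> P).
Hypothesis gP : geometric_module P.
Hypothesis DD : forall a b, D (a + b) = D a + D b.
Hypothesis DS : forall k a, D (scal k * a) = scal k *: D a.
Hypothesis DM : forall a b, D (a * b) = i a *: D b + i b *: D a.

Definition preform_ext (u : prekahler A) : P :=
  tens_lift (fun (a : A) (b : restr (@scal R A)) => i a *: D b) u.

Let bal : balanced (fun (k : R) (a : A) => scal k * a)
  (fun (k : R) (p : restr (@scal R A)) => k *: p)
  (fun (a : A) (b : restr (@scal R A)) => i a *: D b).
Proof.
split=> [a a' b|a b b'|k a b].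
- by rewrite rmorphD scalerDl.
- by rewrite [D _]DD scalerDr.
- by rewrite [D (k *: b)]DS scalerA mulrC rmorphM iS.
Qed.

Lemma preform_ext_pre a b : preform_ext (preform a b) = i a *: D b.
Proof. exact: (tens_lift_pure bal). Qed.
Lemma preform_extD u v : preform_ext (u + v) = preform_ext u + preform_ext v.
Proof. exact: (tens_liftD bal). Qed.
Lemma preform_ext0 : preform_ext 0 = 0.
Proof. exact: (tens_lift0 bal). Qed.
Lemma preform_extZ a u : preform_ext (a *: u) = i a *: preform_ext u.
Proof.
elim/tens_ind: u => [|b c|u v Hu Hv].
- by rewrite scaler0 preform_ext0 scaler0.
- rewrite -[pure _ _ b c]/(preform b c) preformZ !preform_ext_pre.
  by rewrite rmorphM scalerA.
- by rewrite scalerDr !preform_extD scalerDr Hu Hv.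
Qed.
Lemma preform_extB u v : preform_ext (u - v) = preform_ext u - preform_ext v.
Proof. by apply: (addIr (preform_ext v)); rewrite -preform_extD !subrK. Qed.

Definition kahler_ext (u : kahler A) : P := preform_ext (repr u).

Lemma kahler_ext_pi u : kahler_ext (modq_pi _ u) = preform_ext u.
Proof.
have [s sP E] := modq_repr (Defs.span (@leibniz_rel R A)) u.
apply/eqP; rewrite -subr_eq0 -preform_extB E; apply/eqP.
rewrite (big_morph _ preform_extD preform_ext0) big_seq big1 // => p /sP[_ [a [b ->]]].
rewrite preform_extZ !preform_extB !preform_ext_pre DM rmorph1 scale1r.
by rewrite addrAC addrK subrr scaler0.
Qed.
Lemma kahler_extD u v : kahler_ext (u + v) = kahler_ext u + kahler_ext v.
Proof.
elim/modq_ind: u => u; elim/modq_ind: v => v.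
by rewrite -raddfD !kahler_ext_pi preform_extD.
Qed.
Lemma kahler_extZ a u : kahler_ext (a *: u) = i a *: kahler_ext u.
Proof.
by elim/modq_ind: u => u; rewrite -modq_piZ !kahler_ext_pi preform_extZ.
Qed.
Lemma kahler_ext0 : kahler_ext 0 = 0.
Proof. by rewrite -[0](raddf0 (modq_pi _)) kahler_ext_pi preform_ext0. Qed.

Definition spec_comp (h : spectrum B) : spectrum A :=
  @Spectrum _ _ (spec_hom h \o i : {rmorphism A -> R})
    (fun k => etrans (congr1 h (iS k)) (spec_scal h k)).

(** A point h of B restricts to a point of A, so that ghosts over A are sent to
    ghosts over B. *)
Lemma kahler_ext_ghost u : ghosts u -> kahler_ext u = 0.
Proof.
move=> gu; apply: gP => h; have [s sP ->] := gu (spec_comp h).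
rewrite (big_morph _ kahler_extD kahler_ext0) big_seq.
apply: (big_ind (comb (mu h) setT)) => [|p q|p /sP[ha _]].
- exact: comb0.
- exact: combD.
- by rewrite kahler_extZ; exact: comb_mem.
Qed.

Definition forms1_ext (u : forms1 A) : P := kahler_ext (repr u).
Lemma forms1_ext_pi u : forms1_ext (modq_pi _ u) = kahler_ext u.
Proof.
have /kahler_ext_ghost := modq_repr (ghost_submod (kahler A)) u.
rewrite /forms1_ext -scaleN1r kahler_extD kahler_extZ rmorphN1 scaleN1r => /eqP.
by rewrite subr_eq0 => /eqP.
Qed.

Lemma forms1_extD u v : forms1_ext (u + v) = forms1_ext u + forms1_ext v.
Proof.
elim/modq_ind: u => u; elim/modq_ind: v => v.
by rewrite -raddfD !forms1_ext_pi kahler_extD.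
Qed.
Lemma forms1_extZ a u : forms1_ext (a *: u) = i a *: forms1_ext u.
Proof.
by elim/modq_ind: u => u; rewrite -modq_piZ !forms1_ext_pi kahler_extZ.
Qed.
Lemma forms1_ext_d a : forms1_ext (form_d a) = D a.
Proof. by rewrite forms1_ext_pi kahler_ext_pi preform_ext_pre rmorph1 scale1r. Qed.

End Universal.

(** * Calculus of C^1 functions *)
Section Line.
Variables (R : realType) (V : normedModType R).
Implicit Types (f : V -> R) (a v : V).

Lemma is_derive_line f a v (s : R) : derivable f (a + s *: v) v ->
  is_derive s 1 (fun t => f (a + t *: v)) ('D_v f (a + s *: v)).
Proof.
move=> df.
have E : (fun h : R => h^-1 *: (((fun t => f (a + t *: v)) \o shift s) (h *: 1) -
            f (a + s *: v))) =
         (fun h : R => h^-1 *: ((f \o shift (a + s *: v)) (h *: v) - f (a + s *: v))).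
  apply/funext => h /=; congr (_ *: (f _ - _)).
  by rewrite [_%:A]mulr1 scalerDl addrCA.
by split; rewrite /derivable /derive E.
Qed.

End Line.

Section Mvt.
Variable R : realType.

Definition btw (a b x : R) : bool := (Num.min a b <= x) && (x <= Num.max a b).

Lemma mvt_btw (f df : R -> R) (a b : R) :
  (forall x, btw a b x -> is_derive x 1 f (df x)) ->
  exists2 c, btw a b c & f b - f a = df c * (b - a).
Proof.
wlog ab : a b / a <= b => [W H|].
  have [/W|/ltW ba] := leP a b; first exact.
  have [|c cab E] := W b a ba; first by move=> x; rewrite /btw minC maxC; exact: H.
  exists c; first by rewrite /btw minC maxC.
  by rewrite -opprB E -mulrN opprB.
rewrite /btw (min_idPl ab) (max_idPr ab) => H.
have [||c] := @MVT_segment R f df a b ab.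
- move=> x; rewrite in_itv /= => /andP[ax xb]; apply: H; by rewrite !ltW.
- apply: derivable_within_continuous => y; rewrite in_itv /= => /H.
  by case.
- by rewrite in_itv /= => cab E; exists c.
Qed.

Variable n : nat.
Implicit Types (f : 'rV[R]_n -> R) (x y z : 'rV[R]_n).

Definition box x y z : Prop := forall i, btw (x 0 i) (y 0 i) (z 0 i).

Lemma btw_l (a b : R) : btw a b a.
Proof. by rewrite /btw ge_min le_max !lexx. Qed.
Lemma btw_r (a b : R) : btw a b b.
Proof. by rewrite /btw ge_min le_max !lexx !orbT. Qed.

(** The coordinates of x are replaced by those of y one at a time, and the
    one-variable mean value theorem is applied to each replacement. *)
Lemma box_mvt f x y :
  (forall z, box x y z -> forall j, derivable f z (evec R j)) ->
  exists xi : 'I_n -> 'rV[R]_n, (forall j, box x y (xi j)) /\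
    f y - f x = \sum_j (y 0 j - x 0 j) * 'D_(evec R j) f (xi j).
Proof.
move=> df.
pose z (k : nat) : 'rV[R]_n := \row_i (if (i < k)%N then y 0 i else x 0 i).
have z0 : z 0%N = x by apply/rowP => i; rewrite mxE.
have zn : z n = y by apply/rowP => i; rewrite mxE ltn_ord.
have zS (j : 'I_n) : z j.+1 = z j + (y 0 j - x 0 j) *: evec R j.
  apply/rowP => i; rewrite !mxE eqxx /= ltnS leq_eqVlt.
  have [->|ij] := eqVneq i j; first by rewrite ltnn eqxx mulr1 addrC subrK.
  by rewrite mulr0 addr0 val_eqE (negbTE ij).
have step (j : 'I_n) : exists2 w, box x y w &
    f (z j.+1) - f (z j) = (y 0 j - x 0 j) * 'D_(evec R j) f w.
  pose d := y 0 j - x 0 j.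
  have bz t : btw 0 d t -> box x y (z j + t *: evec R j).
    move=> bt i; rewrite !mxE eqxx /=; have [->|ij] := eqVneq i j.
      rewrite ltnn mulr1; move: bt; rewrite /btw /d.
      case: (leP (x 0 j) (y 0 j)) => xy.
        by rewrite (min_idPl _) ?(max_idPr _) ?subr_ge0 // lerBrDl lerDl.
      rewrite (min_idPr _) ?(max_idPl _) ?subr_le0 ?(ltW xy) //.
      by rewrite lerBlDl gerDl.
    rewrite mulr0 addr0; case: ifP => _; [exact: btw_r|exact: btw_l].
  have [t /bz bt|t bt E] := @mvt_btw (fun t => f (z j + t *: evec R j))
      (fun t => 'D_(evec R j) f (z j + t *: evec R j)) 0 d.
    exact/is_derive_line/df.
  exists (z j + t *: evec R j); first exact: bz.
  by rewrite zS -/d mulrC -[X in _ = _ * X]subr0 -E scale0r addr0.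
have [xi xiP] : {xi : 'I_n -> 'rV[R]_n & forall j, box x y (xi j) /\
    f (z j.+1) - f (z j) = (y 0 j - x 0 j) * 'D_(evec R j) f (xi j)}.
  apply: (@choice _ _ (fun (j : 'I_n) w => box x y w /\
    f (z j.+1) - f (z j) = (y 0 j - x 0 j) * 'D_(evec R j) f w)) => j.
  by have [w] := step j; exists w.
exists xi; split=> [j|]; first by case: (xiP j).
rewrite -[in LHS]zn -[in LHS]z0 -(telescope_sumr (fun k => f (z k))) //.
by rewrite big_mkord; apply: eq_bigr => j _; case: (xiP j).
Qed.

End Mvt.

Section Cvg.
Variables (R : realType) (T : Type) (F : set_system T).
Context {FF : Filter F}.

Lemma cvg_sumr (I : Type) (r : seq I) (f : I -> T -> R) (l : I -> R) :
  (forall i, f i x @[x --> F] --> l i) ->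
  \sum_(i <- r) f i x @[x --> F] --> \sum_(i <- r) l i.
Proof.
move=> fl; elim: r => [|i r IHr].
  rewrite big_nil (_ : (fun x => _) = cst 0); first exact: cvg_cst.
  by apply/funext => x; rewrite big_nil.
rewrite big_cons (_ : (fun x => _) = (fun x => f i x + \sum_(j <- r) f j x)).
  exact: cvgD.
by apply/funext => x; rewrite big_cons.
Qed.

Lemma cvg_row n (g : T -> 'rV[R]_n) (l : 'rV[R]_n) :
  (forall j, g x 0 j @[x --> F] --> l 0 j) -> g x @[x --> F] --> l.
Proof.
move=> gl; apply/cvg_ballP => e e0.
have H : \forall x \near F, forall j, ball (l 0 j) e (g x 0 j).
  by apply: filter_forall => j; have /cvg_ballP := gl j; exact.
by near=> x; split=> // i j; rewrite ord1; move: j; near: x.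
Unshelve. all: by end_near. Qed.
End Cvg.

Section Chain.
Variables (R : realType) (n : nat).
Implicit Types (f : 'rV[R]_n -> R) (x y z p : 'rV[R]_n).

Lemma box_ball p y z (e : R) : ball p e y -> box p y z -> ball p e z.
Proof.
move=> [e0 by_] bz; split=> // i j; rewrite ord1; have := by_ 0 j; have := bz j.
rewrite /ball /= /btw !ltr_distlC => /andP[h1 h2] /andP[h3 h4].
apply/andP; split.
  by apply: lt_le_trans h1; rewrite lt_min h3 andbT gtrBl.
by apply: (le_lt_trans h2); rewrite gt_max h4 andbT ltrDl.
Qed.

Definition C1_at f p := forall j, (\forall z \near p, derivable f z (evec R j)) /\
  {for p, continuous (fun z => 'D_(evec R j) f z)}.

(** Differentiability in the form of Caratheodory: the coefficients are the partial
    derivatives at the intermediate points of [box_mvt], which tend to p with y. *)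
Lemma caratheodory f p : C1_at f p ->
  exists G : 'I_n -> 'rV[R]_n -> R,
    (forall j, G j y @[y --> p] --> 'D_(evec R j) f p) /\
    \forall y \near p, f y - f p = \sum_j (y 0 j - p 0 j) * G j y.
Proof.
move=> Cf.
have /choice[xi xiP] : forall y, exists xi : 'I_n -> 'rV[R]_n,
    (forall j, box p y (xi j)) /\
    ((forall z, box p y z -> forall j, derivable f z (evec R j)) ->
     f y - f p = \sum_j (y 0 j - p 0 j) * 'D_(evec R j) f (xi j)).
  move=> y; have [/box_mvt[xi [bxi E]]|nH] :=
    pselect (forall z, box p y z -> forall j, derivable f z (evec R j)).
    by exists xi.
  by exists (fun=> p); split=> // j i; exact: btw_l.
have dnear : \forall z \near p, forall j, derivable f z (evec R j).
  exact: (@filter_forall _ _ _ _ (nbhs_filter p) (fun j => (Cf j).1)).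
exists (fun j y => 'D_(evec R j) f (xi y j)); split=> [j|].
  apply/(@cvgrPdist_lt _ _ _ _ (nbhs_filter p)) => e e0.
  have /cvgrPdist_lt/(_ e e0)/nbhs_ballP[d d0 dP] := (Cf j).2.
  apply/nbhs_ballP; exists d => // y yd; apply: dP.
  exact: box_ball yd ((xiP y).1 j).
have /nbhs_ballP[d d0 dP] := dnear.
apply/nbhs_ballP; exists d => // y yd; apply: (xiP y).2 => z bz j.
by apply: dP; exact: box_ball yd bz.
Qed.

Variable V : normedModType R.

(** The decomposition of [caratheodory] at g(a), taken along the line of direction v,
    turns the difference quotient of f o g into a sum of products of limits. *)
Lemma is_derive_comp_row f (g : V -> 'rV[R]_n) (dg : 'rV[R]_n) (a v : V) :
  C1_at f (g a) -> (forall j, is_derive a v (fun t => g t 0 j) (dg 0 j)) ->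
  is_derive a v (f \o g) (\sum_j dg 0 j * 'D_(evec R j) f (g a)).
Proof.
move=> Cf Dg; have [G [Gc GE]] := caratheodory Cf.
have gj j : (fun h : R => h^-1 * (g (h *: v + a) 0 j - g a 0 j)) @ 0^' --> dg 0 j.
  by have [/derivableP[_ _] <-] := Dg j; have [+ _] := Dg j.
have g0 : g (h *: v + a) @[h --> (0 : R)^'] --> g a.
  apply: cvg_row => j.
  have : (fun h : R => g a 0 j + h * (h^-1 * (g (h *: v + a) 0 j - g a 0 j))) @ 0^'
      --> g a 0 j.
    rewrite -[X in _ --> X]addr0; apply: cvgD; first exact: cvg_cst.
    rewrite -[X in _ --> X](mul0r (dg 0 j)); apply: cvgM => //.
    exact: nbhs_dnbhs.
  apply: cvg_trans; apply: near_eq_cvg.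
  apply: filterS (nbhs_dnbhs_neq (0 : R)) => h h0 /=.
  by rewrite mulVKf // addrC subrK.
have : (fun h : R => h^-1 *: ((f \o g \o shift a) (h *: v) - (f \o g) a)) @ 0^'
   --> \sum_j dg 0 j * 'D_(evec R j) f (g a).
  have : (fun h : R => \sum_j (h^-1 * (g (h *: v + a) 0 j - g a 0 j)) *
      G j (g (h *: v + a))) @ 0^' --> \sum_j dg 0 j * 'D_(evec R j) f (g a).
    apply: cvg_sumr => j; apply: cvgM; first exact: gj.
    exact: cvg_comp g0 (Gc j).
  have GE' : \forall h \near (0 : R)^', f (g (h *: v + a)) - f (g a) =
      \sum_j (g (h *: v + a) 0 j - g a 0 j) * G j (g (h *: v + a)) := g0 _ GE.
  apply: cvg_trans; apply: near_eq_cvg; apply: filterS GE' => h /= ->.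
  by rewrite [RHS]mulr_sumr; apply: eq_bigr => j _; rewrite mulrA.
by move=> H; split; [apply/cvg_ex; exists (\sum_j dg 0 j * 'D_(evec R j) f (g a))|exact: cvg_lim].
Qed.

End Chain.

(** * Smooth functions on open subsets of R^n *)
Section SmoothOn.
Variables (R : realType) (n : nat).
Implicit Types (U V : set 'rV[R]_n) (f g : 'rV[R]_n -> R) (x : 'rV[R]_n).

Lemma class_C_sub k U V f : U `<=` V -> class_C k V f -> class_C k U f.
Proof.
move=> UV; elim: k f => [|k IHk] f [cf df]; split=> //.
- by move=> x /UV; exact: cf.
- by move=> x /UV; exact: cf.
- by move=> j; have [df' /IHk] := df j; split=> // x /UV; exact: df'.
Qed.

Lemma smooth_on_sub U V f : U `<=` V -> smooth_on V f -> smooth_on U f.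
Proof. by move=> UV sf k; exact: class_C_sub (sf k). Qed.

(** The partial derivatives in the definition of C^k are those of the whole space,
    so that being C^k on U is a condition at each point of U. *)
Lemma class_C_pt k U f : (forall x, U x -> class_C k [set x] f) -> class_C k U f.
Proof.
elim: k f => [|k IHk] f H; split=> //.
- by move=> x /H[cf _]; exact: cf.
- by move=> x /H[cf _]; exact: cf.
- move=> j; split=> [x /H[_ /(_ j)[df _]]|]; first exact: df.
  by apply: IHk => x /H[_ /(_ j)[]].
Qed.

Lemma smooth_on_loc U f : (forall x, U x -> exists V g, [/\ open V, V x,
   smooth_on V g & forall y, V y -> g y = f y]) -> smooth_on U f.
Proof.
move=> H k; apply: class_C_pt => x /H[V [g [oV Vx sg gf]]].
apply: (@class_C_sub _ _ V) => [_ ->//|]; exact: smooth_on_ext gf sg k.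
Qed.

Lemma smooth_on_derive U f j : smooth_on U f -> smooth_on U (fun x => 'D_(evec R j) f x).
Proof. by move=> sf k; have [_ /(_ j)[]] := sf k.+1. Qed.

Lemma smooth_on_derivable U f j x : smooth_on U f -> U x -> derivable f x (evec R j).
Proof. by move=> sf Ux; have [_ /(_ j)[+ _]] := sf 1%N; exact. Qed.

Lemma smooth_on_continuous U f x : smooth_on U f -> U x -> {for x, continuous f}.
Proof. by move=> sf Ux; have [+ _] := sf 0%N; exact. Qed.

Lemma smooth_on_C1 U f x : open U -> smooth_on U f -> U x -> C1_at f x.
Proof.
move=> oU sf Ux j; split; last exact: smooth_on_continuous (smooth_on_derive j sf) Ux.
have : nbhs x U by exact: open_nbhs_nbhs.
by apply: (@filterS _ _ (nbhs_filter x)) => y; exact: smooth_on_derivable.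
Qed.

Lemma smooth_on_big (op : R -> R -> R) (idx : R) (I : Type) (r : seq I) (P : pred I)
   (f : I -> 'rV[R]_n -> R) U :
  (forall g h, smooth_on U g -> smooth_on U h -> smooth_on U (fun x => op (g x) (h x))) ->
  (forall i, P i -> smooth_on U (f i)) ->
  smooth_on U (fun x => \big[op/idx]_(i <- r | P i) f i x).
Proof.
move=> sop sf; elim: r => [|i r IHr].
  rewrite (_ : (fun x => _) = cst idx); first exact: smooth_on_cst.
  by apply/funext => x; rewrite big_nil.
have [Pi|Pi] := boolP (P i).
  rewrite (_ : (fun x => _) = (fun x => op (f i x) (\big[op/idx]_(j <- r | P j) f j x))).
    exact: sop (sf i Pi) IHr.
  by apply/funext => x; rewrite big_cons Pi.
by congr (smooth_on _ _): IHr; apply/funext => x; rewrite big_cons (negbTE Pi).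
Qed.

Lemma smooth_on_sum (I : Type) (r : seq I) (P : pred I) (f : I -> 'rV[R]_n -> R) U :
  open U -> (forall i, P i -> smooth_on U (f i)) ->
  smooth_on U (fun x => \sum_(i <- r | P i) f i x).
Proof. by move=> oU; apply: smooth_on_big => g h; exact: smooth_onD. Qed.

Lemma smooth_on_prod (I : Type) (r : seq I) (P : pred I) (f : I -> 'rV[R]_n -> R) U :
  open U -> (forall i, P i -> smooth_on U (f i)) ->
  smooth_on U (fun x => \prod_(i <- r | P i) f i x).
Proof. by move=> oU; apply: smooth_on_big => g h; exact: smooth_onM. Qed.

Lemma is_derive_coord x v (j : 'I_n) :
  is_derive x v (fun y : 'rV[R]_n => y 0 j) (v 0 j).
Proof.
suff E : h^-1 *: (((fun y : 'rV[R]_n => y 0 j) \o shift x) (h *: v) - x 0 j)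
    @[h --> (0 : R)^'] --> v 0 j.
  by split; [apply/cvg_ex; exists (v 0 j)|exact: cvg_lim].
apply: cvg_near_cst; apply: filterS (nbhs_dnbhs_neq (0 : R)) => h h0.
by rewrite /= !mxE addrK [_ *: _]mulrA mulVf ?mul1r.
Qed.

Lemma smooth_on_coord U (j : 'I_n) : smooth_on U (fun y => y 0 j).
Proof.
case=> [|k]; first by split=> // x _; exact: coord_continuous.
split=> [x _|i]; first exact: coord_continuous.
split=> [x _|]; first exact: (@ex_derive _ _ _ _ _ _ _ (is_derive_coord x _ j)).
rewrite (_ : (fun x => _) = cst (evec R i 0 j)); first exact: smooth_on_cst.
by apply/funext => x; exact: (@derive_val _ _ _ _ _ _ _ (is_derive_coord x _ j)).
Qed.

(** Induction on the order: the partial derivatives of 1/f are products of 1/f, 1/f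
    and a partial derivative of f. *)
Lemma smooth_onV U f : open U -> smooth_on U f -> (forall x, U x -> f x != 0) ->
  smooth_on U (fun x => (f x)^-1).
Proof.
move=> oU sf f0.
have ci x : U x -> {for x, continuous (fun x => (f x)^-1)}.
  by move=> Ux; apply: continuousV; [exact: f0|exact: smooth_on_continuous Ux].
elim=> [|k IHk]; split=> // j; split=> [x Ux|].
  by apply: derivableV; [exact: f0|exact: smooth_on_derivable Ux].
apply: (@class_C_ext _ _ _ _ ((fun x => (f x)^-1) * (fun x => (f x)^-1) *
    (cst (-1) * (fun x => 'D_(evec R j) f x)))) => // [x Ux|].
  rewrite deriveV ?f0 //; last exact: smooth_on_derivable Ux.
  by rewrite /= !fctE /= mulN1r mulrN [RHS]mulNr expr2 invfM.
apply: class_CM => //; first exact: class_CM.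
by apply: smooth_onM => //; [exact: smooth_on_cst|exact: smooth_on_derive].
Qed.

End SmoothOn.

(** Induction on the order, the chain rule expressing the partial derivatives of
    f o g by those of g and by the compositions with g of those of f. *)
Lemma smooth_on_comp (R : realType) m n (U : set 'rV[R]_m) (V : set 'rV[R]_n)
    (f : 'rV[R]_n -> R) (g : 'rV[R]_m -> 'rV[R]_n) :
  open U -> open V -> (forall j, smooth_on U (fun x => g x 0 j)) ->
  (forall x, U x -> V (g x)) -> smooth_on V f -> smooth_on U (f \o g).
Proof.
move=> oU oV sg gUV sf k; elim: k f sf => [|k IHk] f sf.
all: have cfg x : U x -> {for x, continuous (f \o g)}.
all: try (move=> Ux; apply: continuous_comp;
  [by apply: (@cvg_row _ _ _ (nbhs_filter x)) => j; exact: smooth_on_continuous (sg j) Ux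
  |by apply: smooth_on_continuous sf _; exact: gUV]).
  by [].
split=> // j.
have D x : U x -> is_derive x (evec R j) (f \o g)
    (\sum_i 'D_(evec R j) (fun y => g y 0 i) x * 'D_(evec R i) f (g x)).
  move=> Ux; set d := \row_i 'D_(evec R j) (fun y => g y 0 i) x.
  rewrite (eq_bigr (fun i => d 0 i * 'D_(evec R i) f (g x))); last by move=> i _; rewrite mxE.
  apply: is_derive_comp_row; first by apply: smooth_on_C1 sf _ => //; exact: gUV.
  by move=> i; rewrite mxE; apply: derivableP; exact: smooth_on_derivable (sg i) Ux.
split=> [x Ux|]; first by have [] := D x Ux.
apply: (@class_C_ext _ _ _ _
  (\sum_i ((fun x => 'D_(evec R j) (fun y => g y 0 i) x) *
     ((fun y => 'D_(evec R i) f y) \o g)))) => // [x Ux|].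
  by have [_ ->] := D x Ux; rewrite fct_sumE.
apply: (big_ind (fun h => class_C k U h)) => [|a b Ca Cb|i _].
- exact: smooth_on_cst.
- exact: class_CD.
- apply: class_CM => //; first exact: smooth_on_derive (sg i) k.
  by apply: IHk; exact: smooth_on_derive.
Qed.
(** * Bump functions *)
Lemma is_derive_lineP (R : realType) (V : normedModType R) (g : V -> R) a v (l : R) :
  is_derive (0 : R) 1 (fun h => g (h *: v + a)) l -> is_derive a v g l.
Proof.
have E : (fun h : R => h^-1 *: ((g \o shift a) (h *: v) - g a)) =
  (fun h : R => h^-1 *: (((fun h => g (h *: v + a)) \o shift 0) (h *: 1) -
     (fun h => g (h *: v + a)) 0)).
  by apply/funext => h /=; rewrite addr0 [h%:A]mulr1 scale0r add0r.
by move=> [d1 d2]; split; rewrite /derivable /derive E.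
Qed.

Section Flat.
Variable R : realType.

(** The power t^-m makes a family closed under derivation, so that all its members are
    proved smooth by a single induction. *)
Definition flat (m : nat) (t : R) : R :=
  if t <= 0 then 0 else (t^-1) ^+ m * expR (- t^-1).

Lemma flat_ge0 m t : 0 <= flat m t.
Proof.
rewrite /flat; case: (leP t 0) => // t0.
by rewrite mulr_ge0 ?expR_ge0 // exprn_ge0 // invr_ge0 ltW.
Qed.

Lemma flat_gt0 m t : 0 < t -> 0 < flat m t.
Proof.
by move=> t0; rewrite /flat leNgt t0 /= mulr_gt0 ?expR_gt0 // exprn_gt0 // invr_gt0.
Qed.

(** With s = 1/t and k = m + 1, the inequality exp(s) = exp(s/k)^k > (s/k)^k bounds
    s^m exp(-s) by k^k / s. *)
Lemma flat_le m t : flat m t <= m.+1%:R ^+ m.+1 * `|t|.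
Proof.
rewrite /flat; case: (leP t 0) => t0; first by rewrite mulr_ge0 ?exprn_ge0.
set k := m.+1%:R : R; have k0 : 0 < k by rewrite ltr0n.
rewrite gtr0_norm // expRN -[t in leRHS]invrK; set s := t^-1.
have s0 : 0 < s by rewrite invr_gt0.
rewrite ler_pdivlMr // mulrAC -exprSr ler_pdivrMr ?expR_gt0 //.
have -> : expR s = expR (s / k) ^+ m.+1.
  by rewrite -expRM_natl mulrC divfK ?gt_eqF.
rewrite -exprMn lerXn2r ?nnegrE ?mulr_ge0 ?expR_ge0 ?ltW //.
rewrite -ltr_pdivrMl // mulrC; apply: lt_le_trans (expR_ge1Dx _).
by rewrite ltrDr.
Qed.

Lemma is_derive_flat m (t : R) :
  is_derive t 1 (flat m) (flat m.+2 t - m%:R * flat m.+1 t).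
Proof.
have [t0|t0|->] := ltgtP t 0.
- have E : \forall z \near t, cst 0 z = flat m z.
    near=> z; rewrite /flat ifT //; apply/ltW; near: z; exact: lt_nbhsl.
  rewrite [X in is_derive _ _ _ X](_ : _ = 0); last first.
    by rewrite /flat (ltW t0) mulr0 subr0.
  exact: near_eq_is_derive E _.
- have E : \forall z \near t, z^-1 ^+ m * expR (- z^-1) = flat m z.
    near=> z; rewrite /flat ifF //; apply/negbTE; rewrite -ltNge.
    near: z; exact: lt_nbhsr.
  apply: near_eq_is_derive E _.
  have t1 : t != 0 by rewrite gt_eqF.
  have d1 : is_derive t 1 (fun z : R => z^-1) (- t ^- 2).
    apply: is_derive_eq; first exact: is_deriveV.
    by rewrite [_ *: _]mulr1.
  have dN : is_derive t 1 (- (fun z : R => z^-1)) (- (- t ^- 2)).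
    exact: is_deriveN.
  have dE : is_derive t 1 (expR \o (- (fun z : R => z^-1))) (expR (- t^-1) * t ^- 2).
    by rewrite -[t ^- 2]opprK; apply: is_derive1_comp.
  have dX : is_derive t 1 ((fun z : R => z^-1) ^+ m) ((m%:R * t^-1 ^+ m.-1) *: - t ^- 2).
    exact: is_deriveX.
  have dM := is_deriveM dX dE.
  rewrite (_ : (fun z => _) = (fun z : R => z^-1) ^+ m * (expR \o - (fun z : R => z^-1)));
    last by apply/funext => z; rewrite !fctE.
  apply: is_derive_eq.
  rewrite /flat (leNgt t 0) t0 /=.
  rewrite !fctE -exprVn [_ *: _ + _]/(_ * _ + _ * (_ * _)).
  set E := expR _; set s := t^-1.
  have -> : m%:R * s ^+ m.-1 * - s ^+ 2 = - (m%:R * s ^+ m.+1).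
    by case: (m) => [|k]; rewrite ?mul0r ?oppr0 // mulrN -mulrA -exprD addn2.
  have -> : s ^+ m.+2 = s ^+ m * s ^+ 2 by rewrite -exprD addn2.
  by rewrite mulrN; congr (_ - _); [rewrite mulrCA mulrC|rewrite mulrC -mulrA].
- (* At 0 the difference quotient is the next member of the family, which tends to 0
     by [flat_le]. *)
  have f0 p : flat p 0 = 0 by rewrite /flat lexx.
  rewrite !f0 mulr0 subr0.
  have H : (fun h : R => h^-1 *: ((flat m \o shift 0) (h *: 1) - flat m 0)) @ 0^' --> 0.
    apply/cvgr0Pnorm_lt => e e0; pose C : R := m.+2%:R ^+ m.+2.
    have C0 : 0 < C by rewrite exprn_gt0 // ltr0n.
    have : \forall h \near (0 : R)^', `|h| < e / C.
      by apply: dnbhs0_lt; rewrite divr_gt0.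
    apply: filterS => h hC; rewrite /= addr0 [h *: 1]mulr1 f0 subr0.
    rewrite (@le_lt_trans _ _ (flat m.+1 h)) //.
      rewrite /flat; case: (leP h 0) => h0; first by rewrite scaler0 normr0.
      rewrite [_ *: _]mulrA -exprS ger0_norm // mulr_ge0 ?expR_ge0 //.
      by rewrite exprn_ge0 // invr_ge0 ltW.
    by apply: le_lt_trans (flat_le _ _) _; rewrite mulrC -ltr_pdivlMr.
  by split; [apply/cvg_ex; exists 0|exact: cvg_lim].
Unshelve. all: by end_near. Qed.

Definition smooth1 (h : R -> R) := smooth_on setT (fun x : 'rV[R]_1 => h (x 0 0)).

Lemma smooth1_comp n (U : set 'rV[R]_n) (f : 'rV[R]_n -> R) h :
  open U -> smooth1 h -> smooth_on U f -> smooth_on U (h \o f).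
Proof.
move=> oU sh sf.
have := @smooth_on_comp R n 1 U setT _ (fun x => \row_(_ < 1) f x) oU openT _ _ sh.
rewrite (_ : _ \o _ = h \o f); last by apply/funext => x /=; rewrite mxE.
apply=> // j; rewrite (_ : (fun x => _) = f) //.
by apply/funext => x; rewrite mxE.
Qed.

Lemma smooth1_flat m : smooth1 (flat m).
Proof.
have D p (x : 'rV[R]_1) v : is_derive x v (fun y : 'rV[R]_1 => flat p (y 0 0))
    ((flat p.+2 (x 0 0) - p%:R * flat p.+1 (x 0 0)) * v 0 0).
  apply: is_derive_lineP.
  have d : is_derive (0 : R) 1 (fun h : R => h * v 0 0 + x 0 0) (v 0 0).
    have := is_deriveD (is_deriveM (is_derive_id (0 : R) 1)
      (is_derive_cst (v 0 0) (0 : R) 1)) (is_derive_cst (x 0 0) (0 : R) 1).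
    by rewrite addr0 scaler0 add0r [_ *: _]mulr1.
  rewrite (_ : (fun h => _) = flat p \o (fun h : R => h * v 0 0 + x 0 0)); last first.
    by apply/funext => h; rewrite /= !mxE.
  by apply: is_derive1_comp; rewrite mul0r add0r; exact: is_derive_flat.
have C p (x : 'rV[R]_1) : {for x, continuous (fun y : 'rV[R]_1 => flat p (y 0 0))}.
  apply: continuous_comp; first exact: coord_continuous.
  apply: differentiable_continuous; apply/derivable1_diffP.
  by have [] := is_derive_flat p (x 0 0).
move=> k; elim: k m => [|k IHk] m; first by split=> // x _; exact: C.
split=> [x _|j]; first exact: C.
split=> [x _|]; first by have [] := D m x (evec R j).
rewrite (_ : (fun x => _) = (fun x : 'rV[R]_1 => flat m.+2 (x 0 0)) * cst (evec R j 0 0) +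
    cst (- m%:R * evec R j 0 0) * (fun x : 'rV[R]_1 => flat m.+1 (x 0 0))).
  by apply: class_CD; [exact: openT| |];
    (apply: class_CM; [exact: openT| |]) => //; exact: smooth_on_cst.
apply/funext => x; have [_ ->] := D m x (evec R j).
by rewrite !fctE mulrBl mulNr mulNr mulrAC.
Qed.

Definition sstep (t : R) : R := flat 0 t / (flat 0 t + flat 0 (1 - t)).

Lemma sstep_den t : 0 < flat 0 t + flat 0 (1 - t).
Proof.
have [t0|t0] := leP t 0.
  by rewrite ltr_wpDl ?flat_ge0 // flat_gt0 // subr_gt0 (le_lt_trans t0).
by rewrite ltr_wpDr ?flat_ge0 // flat_gt0.
Qed.

Lemma sstep0 t : t <= 0 -> sstep t = 0.
Proof. by move=> t0; rewrite /sstep {1}/flat t0 mul0r. Qed.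

Lemma sstep1 t : 1 <= t -> sstep t = 1.
Proof.
move=> t1; rewrite /sstep [flat 0 (1 - t)]/flat subr_le0 t1 addr0 divff //.
by rewrite gt_eqF // flat_gt0 // (lt_le_trans _ t1).
Qed.

Lemma sstep_ge0 t : 0 <= sstep t.
Proof. by rewrite divr_ge0 ?flat_ge0 // ltW // sstep_den. Qed.

Lemma sstep_le1 t : sstep t <= 1.
Proof. by rewrite ler_pdivrMr ?sstep_den // mul1r lerDl flat_ge0. Qed.

Lemma smooth1_sstep : smooth1 sstep.
Proof.
have s1 := smooth1_flat 0.
have s2 : smooth_on setT (fun x : 'rV[R]_1 => flat 0 (1 - x 0 0)).
  apply: (smooth1_comp openT s1); apply: smooth_onB; first exact: openT.
    exact: (smooth_on_cst _ 1).
  exact: smooth_on_coord.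
apply: smooth_onM => //; first exact: openT.
apply: smooth_onV; [exact: openT|exact: smooth_onD openT s1 s2|].
by move=> x _; rewrite gt_eqF // sstep_den.
Qed.

End Flat.

Section CubeBump.
Variables (R : realType) (n : nat).
Implicit Types (p u : 'rV[R]_n) (r : R).

(** The arguments of the steps are chosen so that they reach 1 at distance r and
    0 at distance 2r. *)
Definition cbump p r u : R :=
  \prod_j sstep ((4 * r ^+ 2 - (u 0 j - p 0 j) ^+ 2) / (3 * r ^+ 2)).

Lemma cbump_smooth U p r : open U -> smooth_on U (cbump p r).
Proof.
move=> oU; apply: smooth_on_prod => // j _.
apply: (smooth1_comp oU (smooth1_sstep R)).
apply: smooth_onM => //; last exact: smooth_on_cst.
apply: smooth_onB => //; first exact: smooth_on_cst.
by apply: smooth_onM => //; apply: smooth_onB => //;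
  [exact: smooth_on_coord|exact: smooth_on_cst|exact: smooth_on_coord|exact: smooth_on_cst].
Qed.

Lemma cbump_ge0 p r u : 0 <= cbump p r u.
Proof. by apply: prodr_ge0 => j _; exact: sstep_ge0. Qed.

Lemma cbump_le1 p r u : cbump p r u <= 1.
Proof. by apply: prodr_ile1 => j _; rewrite sstep_ge0 sstep_le1. Qed.

Lemma cbump1 p r u : 0 < r -> (forall j, `|u 0 j - p 0 j| <= r) -> cbump p r u = 1.
Proof.
move=> r0 H; apply: big1 => j _; apply: sstep1.
rewrite ler_pdivlMr ?mulr_gt0 ?exprn_gt0 // mul1r lerBrDl.
have : (u 0 j - p 0 j) ^+ 2 <= r ^+ 2 by rewrite -real_normK ?num_real // lerXn2r ?nnegrE // ltW.
by lra.
Qed.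

Lemma cbump_supp p r u : 0 < r -> cbump p r u != 0 -> forall j, `|u 0 j - p 0 j| < 2 * r.
Proof.
move=> r0 /prodf_neq0 H j; rewrite ltNge; apply/negP => /= rj.
have /eqP := H j isT; apply; apply: sstep0.
rewrite pmulr_lle0 ?invr_gt0 ?mulr_gt0 ?exprn_gt0 // subr_le0.
rewrite -[leRHS]real_normK ?num_real // (_ : 4 * _ = (2 * r) ^+ 2); last by ring.
by rewrite lerXn2r ?nnegrE // mulr_ge0 // ltW.
Qed.

End CubeBump.
(** * Hadamard's lemma *)
Section Compact.
Variables (R : realType) (n : nat).

Lemma coord_le_norm (x : 'rV[R]_n) j : `|x 0 j| <= `|x|.
Proof.
rewrite [leRHS]/Num.Def.normr /= mx_normrE.
exact: (le_bigmax _ (fun ij => `|x ij.1 ij.2|) (0, j)).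
Qed.

Definition cbox (p : 'rV[R]_n) (r : R) : set 'rV[R]_n :=
  [set u | forall j, `|u 0 j - p 0 j| <= r].

Lemma cbox_compact p r : compact (cbox p r).
Proof.
have := @rV_compact R n (fun j => `[p 0 j - r, p 0 j + r]%classic)
  (fun j => @segment_compact _ _ _).
congr compact; apply/seteqP; split=> u H j; have := H j.
  by rewrite /= in_itv /= ler_distl.
by rewrite /= in_itv /= ler_distl.
Qed.

Lemma compact_bounded_fun (T : topologicalType) (A : set T) (f : T -> R) :
  compact A -> (forall x, A x -> {for x, continuous f}) ->
  exists2 C, 0 <= C & forall x, A x -> `|f x| <= C.
Proof.
move=> cA cf; have /compact_bounded[M [Mr HM]] : compact (f @` A).
  apply: continuous_compact cA; apply: continuous_in_subspaceT => x /set_mem.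
  exact: cf.
exists (`|M| + 1) => [|x Ax]; first by rewrite addr_ge0.
by apply: HM; [rewrite (le_lt_trans (ler_norm M)) // ltrDl|exists x].
Qed.

End Compact.

Lemma is_derive_dir (R : realType) n (f : 'rV[R]_n -> R) a v : C1_at f a ->
  is_derive a v f (\sum_j v 0 j * 'D_(evec R j) f a).
Proof.
move=> Cf; apply: (@is_derive_comp_row R n _ f id) => // j; exact: is_derive_coord.
Qed.

Section Hadamard.
Variables (R : realType) (n : nat) (p : 'rV[R]_n).
Implicit Types (F : 'rV[R]_n -> R) (x : 'rV[R]_n).

Let mu := @lebesgue_measure R.
Let I01 : set R := `[0, 1]%classic.

Definition ray x (t : R) := p + t *: (x - p).

(** The weights t^m make this family closed under partial derivation in x:
    d_j (ray_avg m F) = ray_avg (m + 1) (d_j F), see [is_derive_ray_avg]. *)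
Definition ray_avg (m : nat) F x : R :=
  \int[mu]_(t in I01) (t ^+ m * F (ray x t)).

Lemma ray_cbox x (t r : R) : I01 t -> cbox p r x -> cbox p r (ray x t).
Proof.
rewrite /I01 /= in_itv /= => /andP[t0 t1] H j; rewrite /ray !mxE addrAC subrr add0r normrM.
rewrite ger0_norm //; apply: le_trans (H j).
by rewrite ler_piMl.
Qed.

Lemma is_derive_rayj x (t : R) j : is_derive t 1 (fun s => ray x s 0 j) ((x - p) 0 j).
Proof.
rewrite (_ : (fun s => _) = cst (p 0 j) + (id * cst ((x - p) 0 j))); last first.
  by apply/funext => s; rewrite /ray [in LHS]mxE [X in _ + X]mxE.
have := is_deriveD (is_derive_cst (p 0 j) t 1) (is_deriveM (is_derive_id (t : R) 1)
      (is_derive_cst ((x - p) 0 j) (t : R) 1)).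
by rewrite add0r scaler0 add0r [_ *: _]mulr1.
Qed.

Lemma ray_continuous x : continuous (ray x).
Proof.
move=> t; apply: cvg_row => j.
apply: differentiable_continuous; apply/derivable1_diffP.
by have [] := is_derive_rayj x t j.
Qed.

Lemma ray_avg_integrable m F x : continuous F ->
  mu.-integrable I01 (EFin \o (fun t => t ^+ m * F (ray x t))).
Proof.
move=> cF; apply: continuous_compact_integrable; first exact: segment_compact.
apply: continuous_subspaceT => t; apply: cvgM; first exact: exprn_continuous.
by apply: continuous_comp; [exact: ray_continuous|exact: cF].
Qed.

Lemma mu01 : mu I01 = 1%:E.
Proof. by rewrite /mu /I01 lebesgue_measure_itv /= lte01 oppr0 adde0. Qed.

Lemma ray_avg_bound m F x (C : R) : continuous F ->
  (forall t, I01 t -> `|F (ray x t)| <= C) -> `|ray_avg m F x| <= C.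
Proof.
move=> cF HC.
have mI : @measurable _ (measurableTypeR R) I01 by exact: measurable_itv.
have iF := ray_avg_integrable m x cF.
rewrite /ray_avg; apply: (le_trans (le_normr_Rintegral mI iF)).
have -> : C = \int[mu]_(t in I01) C.
  by rewrite Rintegral_cst // [X in fine X](_ : _ = 1%:E) ?mulr1 //; exact: mu01.
apply: le_Rintegral => //.
- exact: integrable_norm iF.
- apply: continuous_compact_integrable; first exact: segment_compact.
  by apply: continuous_subspaceT => t; exact: cst_continuous.
- move=> t It; rewrite normrM; apply: le_trans (HC t It).
  rewrite ler_piMl // ger0_norm ?exprn_ge0 ?exprn_ile1 //;
  by move: It; rewrite /I01 /= in_itv /= => /andP[].
Qed.

Lemma smoothT_continuous F : smooth_on setT F -> continuous F.
Proof. by move=> sF x; exact: smooth_on_continuous sF _. Qed.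

(** Differentiation under the integral sign: the derivative of the integrand is
    bounded because the rays ending near x stay in a compact cube. *)
Lemma is_derive_ray_avg m F x j : smooth_on setT F ->
  is_derive x (evec R j) (ray_avg m F) (ray_avg m.+1 (fun y => 'D_(evec R j) F y) x).
Proof.
move=> sF; set dF := fun y => _; set e := evec R j.
have cF := smoothT_continuous sF.
have sdF : smooth_on setT dF by exact: smooth_on_derive.
have cdF := smoothT_continuous sdF.
apply: is_derive_lineP.
pose f (h t : R) := t ^+ m * F (ray (h *: e + x) t).
have rE (h t : R) : ray (h *: e + x) t = ray x t + h *: (t *: e).
  rewrite /ray -[RHS]addrA; congr (_ + _); rewrite [h *: (t *: e)]scalerA [h * t]mulrC.
  by rewrite -scalerA -scalerDr [_ + h *: e]addrC addrA.
have Df (h t : R) : is_derive h 1 (f ^~ t) (t ^+ m.+1 * dF (ray (h *: e + x) t)).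
  have E : f^~ t = cst (t ^+ m) * (fun s : R => F ((ray x t + s *: (t *: e)))).
    by apply/funext => s; rewrite /f rE.
  have D := @is_derive_dir R n F (ray x t + h *: (t *: e)) (t *: e)
     (smooth_on_C1 openT sF I).
  have := is_deriveM (is_derive_cst (t ^+ m) h 1) (is_derive_line (@ex_derive _ _ _ _ _ _ _ D)).
  rewrite -E scaler0 addr0 (@derive_val _ _ _ _ _ _ _ D) rE.
  rewrite (bigD1 j) //= big1 ?addr0 => [|i ij]; last first.
    by rewrite !mxE eqxx /= (negbTE ij) mulr0 mul0r.
  by rewrite !mxE !eqxx mulr1 [_ *: _]mulrA -exprSr.
(* The radius leaves room for a displacement of x by at most 1. *)
have [C C0 HC] : exists2 C : R, 0 <= C & forall h t : R, `]-1, 1[%classic h -> I01 t ->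
    `|dF (ray (h *: e + x) t)| <= C.
  pose r := `|x - p| + 1.
  have [|C C0 HC] := @compact_bounded_fun R _ (cbox p r) dF (@cbox_compact R n p r).
    by move=> y _; exact: cdF.
  exists C => // h t Ih It; apply: HC; apply: ray_cbox => // i.
  rewrite !mxE -addrA (le_trans (ler_normD _ _)) // [leRHS]addrC lerD //; last first.
    by apply: le_trans (coord_le_norm (x - p) i); rewrite !mxE.
  rewrite normrM; move: Ih; rewrite /= in_itv /= => /andP[h1 h2].
  rewrite mulr_ile1 //; first by rewrite ler_norml !ltW.
  by rewrite normr_nat lern1 leq_b1.
have -> : (fun h => ray_avg m F (h *: e + x)) = (fun h => \int[mu]_(y in I01) f h y) by [].
have Ic (g : R -> R) : continuous g -> mu.-integrable I01 (EFin \o g).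
  move=> cg; apply: continuous_compact_integrable; first exact: segment_compact.
  exact: continuous_subspaceT.
have mI : @measurable _ (measurableTypeR R) I01 by exact: measurable_itv.
have i0 : `]-1, 1[%classic (0 : R) by rewrite /= in_itv /= ltrN10 ltr01.
have intf (h : R) : `]-1, 1[%classic h -> mu.-integrable I01 (EFin \o f h).
  by move=> _; exact: ray_avg_integrable.
have dPf (h t : R) : `]-1, 1[%classic h -> I01 t -> derivable (f ^~ t) h 1.
  by move=> _ _; have [] := Df h t.
have iG : mu.-integrable I01 (EFin \o (fun _ : R => C)).
  by apply: Ic => t; exact: cst_continuous.
have Gb (h t : R) : `]-1, 1[%classic h -> I01 t -> `|partial1of2 f h t| <= C.
  move=> Ih It; rewrite partial1of2E (@derive_val _ _ _ _ _ _ _ (Df h t)).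
  rewrite normrM; apply: le_trans (HC h t Ih It).
  rewrite ler_piMl // ger0_norm ?exprn_ge0 ?exprn_ile1 //;
  by move: It; rewrite /I01 /= in_itv /= => /andP[].
have d := @derivable_under_integral R _ _ mu f I01 mI 0 (-1) 1 i0 intf dPf _ (fun=> C0) iG Gb.
have v := @differentiation_under_integral R _ _ mu f I01 mI 0 (-1) 1 i0 intf dPf _ (fun=> C0) iG Gb.
split=> //; rewrite -derive1E v /ray_avg; apply: eq_Rintegral => t _ /=.
by rewrite partial1of2E (@derive_val _ _ _ _ _ _ _ (Df 0 t)) scale0r add0r.
Qed.

(** Only continuity remains to be seen: the partial derivatives are bounded near each
    point, hence the function is locally Lipschitz by [box_mvt]. *)
Lemma ray_avg_smooth m F : smooth_on setT F -> smooth_on setT (ray_avg m F).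
Proof.
have cont q G : smooth_on setT G -> continuous (ray_avg q G).
  move=> sG x; have /choice[C HC] : forall j, exists C : R, forall y,
      cbox p (`|x - p| + 1) y -> `|ray_avg q.+1 (fun z => 'D_(evec R j) G z) y| <= C.
    move=> j; have sd := smooth_on_derive j sG; have cd := smoothT_continuous sd.
    have [|C C0 HC] := @compact_bounded_fun R _ (cbox p (`|x - p| + 1))
      (fun z => 'D_(evec R j) G z) (@cbox_compact R n p _).
      by move=> y _; exact: cd.
    exists C => y xy; apply: ray_avg_bound => // t It; apply: HC.
    exact: ray_cbox.
  apply/(@cvgrPdist_lt _ _ _ _ (nbhs_filter x)) => e e0; have FF := nbhs_filter x.
  have c0 : (fun y : 'rV[R]_n => \sum_j `|y 0 j - x 0 j| * C j) @ x --> 0.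
    rewrite -[X in _ --> X](@big1_eq R 0 +%R 'I_n (index_enum 'I_n) predT).
    apply: cvg_sumr => j; rewrite -[X in _ --> X](mul0r (C j)).
    apply: cvgM; last exact: cvg_cst.
    rewrite (_ : 0 = `|x 0 j - x 0 j|); last by rewrite subrr normr0.
    apply: cvg_norm; apply: cvgB; [exact: coord_continuous|exact: cvg_cst].
  have /(@cvgrPdist_lt _ _ _ _ (nbhs_filter x))/(_ e e0) := c0.
  have : \forall y \near x, ball x 1 y by exact: nbhsx_ballx.
  apply: filterS2 => y y1; apply: le_lt_trans; rewrite sub0r normrN.
  have [|xi [bxi E]] := @box_mvt R n (ray_avg q G) x y.
    by move=> z _ j; have [] := is_derive_ray_avg q z j sG.
  rewrite distrC E; apply: le_trans (ler_norm_sum _ _ _) _.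
  rewrite [leRHS]ger0_norm; last first.
    apply: sumr_ge0 => j _; rewrite mulr_ge0 //.
    apply: (le_trans (normr_ge0 _) (HC j x _)) => i.
    by apply: (@le_trans _ _ `|x - p|); [have := coord_le_norm (x - p) i; rewrite !mxE|rewrite lerDl].
  apply: ler_sum => j _; rewrite normrM ler_wpM2l //.
  have [_ ->] := is_derive_ray_avg q (xi j) j sG; apply: HC => i.
  have [_ /(_ 0 i)] := box_ball y1 (bxi j).
  rewrite /ball /= => xx; rewrite -(subrK (x 0 i) (xi j 0 i)) -addrA addrC.
  apply: le_trans (ler_normD _ _) _; rewrite lerD //; last by rewrite distrC ltW.
  by apply: le_trans (coord_le_norm (x - p) i); rewrite !mxE.
move=> sF k; elim: k m F sF => [|k IHk] m F sF; first by split=> // x _; exact: cont.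
split=> [x _|j]; first exact: cont.
split=> [x _|]; first by have [] := is_derive_ray_avg m x j sF.
rewrite (_ : (fun x => _) = ray_avg m.+1 (fun y => 'D_(evec R j) F y)).
  by apply: IHk; exact: smooth_on_derive.
by apply/funext => x; have [_ ->] := is_derive_ray_avg m x j sF.
Qed.

Lemma Rintegral_lincomb (I : Type) (r : seq I) (c : I -> R) (h : I -> R -> R) :
  (forall i, continuous (h i)) ->
  \int[mu]_(t in I01) (\sum_(i <- r) c i * h i t) =
  \sum_(i <- r) c i * \int[mu]_(t in I01) h i t.
Proof.
move=> ch; have mI : @measurable _ (measurableTypeR R) I01 by exact: measurable_itv.
have Ic (g : R -> R) : continuous g -> mu.-integrable I01 (EFin \o g).
  move=> cg; apply: continuous_compact_integrable; first exact: segment_compact.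
  exact: continuous_subspaceT.
elim: r => [|i r IHr].
  rewrite big_nil; transitivity (\int[mu]_(t in I01) (0 : R)).
    by apply: eq_Rintegral => t _; rewrite big_nil.
  by rewrite Rintegral_cst // mul0r.
rewrite big_cons -IHr -RintegralZl //; last exact: Ic.
rewrite -RintegralD //.
- by apply: eq_Rintegral => t _; rewrite big_cons.
- by apply: Ic => t; apply: cvgM; [exact: cvg_cst|exact: ch].
- apply: Ic => t; have FF := nbhs_filter t; apply: cvg_sumr => j; apply: cvgM; [exact: cvg_cst|exact: ch].
Qed.

(** Fundamental theorem of calculus for t |-> F (p + t (x - p)) on [0, 1]. *)
Lemma hadamard F : smooth_on setT F -> forall x,
  F x - F p = \sum_j (x 0 j - p 0 j) * ray_avg 0 (fun y => 'D_(evec R j) F y) x.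
Proof.
move=> sF x.
pose dg (t : R) := \sum_j (x 0 j - p 0 j) * 'D_(evec R j) F (ray x t).
have cd j : continuous (fun t => 'D_(evec R j) F (ray x t)).
  move=> t; apply: (@continuous_comp _ _ _ (ray x) (fun y => 'D_(evec R j) F y)).
    exact: ray_continuous.
  exact: smoothT_continuous (smooth_on_derive j sF) _.
have D (t : R) : is_derive t 1 (F \o ray x) (dg t).
  rewrite /dg (eq_bigr (fun j => (x - p) 0 j * 'D_(evec R j) F (ray x t))); last first.
    by move=> j _; rewrite !mxE.
  apply: is_derive_comp_row; first exact: smooth_on_C1 openT sF I.
  by move=> j; exact: is_derive_rayj.
have cg : continuous dg.
  move=> t; rewrite /dg; have FF := nbhs_filter t; apply: cvg_sumr => j.
  by apply: cvgM; [exact: cvg_cst|exact: cd].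
have Dg : derivable_oo_LRcontinuous (F \o ray x) 0 1.
  have cF (t : R) : (F \o ray x) @ t --> (F \o ray x) t.
    apply: differentiable_continuous; apply/derivable1_diffP; by have [] := D t.
  split=> [t _||]; first by have [] := D t.
    exact: cvg_at_right_filter.
  exact: cvg_at_left_filter.
have := @continuous_FTC2 R dg (F \o ray x) 0 1 ltr01
  (continuous_subspaceT cg) Dg.
move=> /(_ _)/(congr1 fine); rewrite -/mu => E.
rewrite (eq_bigr (fun j => (x 0 j - p 0 j) *
  \int[mu]_(t in I01) 'D_(evec R j) F (ray x t))); last first.
  move=> j _; congr (_ * _); apply: eq_Rintegral => t _; exact: mul1r.
rewrite -(Rintegral_lincomb _ _ cd) -/(dg _) [RHS]E.
  by rewrite /= /ray scale1r scale0r addr0 [p + _]addrC subrK.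
by move=> t _; rewrite derive1E; have [_ ->] := D t.
Qed.

Lemma ray_avg0 F : ray_avg 0 F p = F p.
Proof.
transitivity (\int[mu]_(t in I01) F p).
  by apply: eq_Rintegral => t _; rewrite /ray subrr scaler0 addr0 mul1r.
have mI : @measurable _ (measurableTypeR R) I01 by exact: measurable_itv.
by rewrite Rintegral_cst // [X in fine X](_ : _ = 1%:E) ?mulr1 //; exact: mu01.
Qed.

End Hadamard.

(** * Smooth envelopes and differentiation along curves *)
Section EnvH.
Variables (R : realType) (A : geomAlgType R).
Local Notation E := (envelope A).

Definition env_comp k (H : 'rV[R]_k -> R) (sH : smooth_on setT H) (a : 'I_k -> A) : E :=
  MkEnvelope (introT (asboolP _) (ex_intro _ k (ex_intro _ a (ex_intro _ H
    (conj sH (erefl (fun h : spectrum A => H (\row_i h (a i)))))))) :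
    (fun h : spectrum A => H (\row_i h (a i))) \in @envelope_pred R A).

Lemma env_ext (f g : E) : (forall h, env_ev h f = env_ev h g) -> f = g.
Proof. by move=> fg; apply: val_inj; apply/funext => h; exact: fg. Qed.

Lemma envP (f : E) : exists k (H : 'rV[R]_k -> R) (sH : smooth_on setT H) a,
  f = env_comp sH a.
Proof.
case: f => f fP; have /asboolP[k [a [H [sH fE]]]] := fP.
by exists k, H, sH, a; apply: val_inj.
Qed.

Lemma env_ev_in h (a : A) : env_ev h (env_in a) = h a. Proof. by []. Qed.
Lemma env_evS h (c : R) : env_ev h (scal c : E) = c. Proof. by []. Qed.
Lemma env_ev_comp h k (H : 'rV[R]_k -> R) (sH : smooth_on setT H) a :
  env_ev h (env_comp sH a) = H (\row_i h (a i)). Proof. by []. Qed.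

Lemma env_evD h (f g : E) : env_ev h (f + g) = env_ev h f + env_ev h g.
Proof. exact: rmorphD. Qed.
Lemma env_evM h (f g : E) : env_ev h (f * g) = env_ev h f * env_ev h g.
Proof. exact: rmorphM. Qed.
Lemma env_evB h (f g : E) : env_ev h (f - g) = env_ev h f - env_ev h g.
Proof. exact: rmorphB. Qed.
Lemma env_ev_sum h I (r : seq I) (F : I -> E) :
  env_ev h (\sum_(i <- r) F i) = \sum_(i <- r) env_ev h (F i).
Proof. exact: rmorph_sum. Qed.

Lemma env_ev_pt (h h' : spectrum A) f : (forall a, h a = h' a) ->
  env_ev h f = env_ev h' f.
Proof.
move=> hh; have [k [H [sH [a ->]]]] := envP f; rewrite !env_ev_comp.
by congr H; apply/rowP => i; rewrite !mxE hh.
Qed.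

Lemma env_in_scal k : env_in (scal k : A) = scal k :> E.
Proof. by apply: env_ext => h; rewrite env_ev_in spec_scal. Qed.

Section Taylor.
Variables (k : nat) (H : 'rV[R]_k -> R) (sH : smooth_on setT H) (a : 'I_k -> A).

Definition env_partial j : E := env_comp (smooth_on_derive j sH) a.

Definition env_quotient (p : 'rV[R]_k) j : E :=
  env_comp (ray_avg_smooth p 0 (smooth_on_derive j sH)) a.

Lemma env_taylor (p : 'rV[R]_k) : env_comp sH a =
  scal (H p) + \sum_j (env_in (a j) - scal (p 0 j)) * env_quotient p j.
Proof.
apply: env_ext => h; rewrite env_evD env_ev_sum env_evS env_ev_comp.
apply/eqP; rewrite addrC -subr_eq (hadamard p sH); apply/eqP.
apply: eq_bigr => j _; rewrite env_evM env_evB env_ev_in env_evS env_ev_comp.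
by rewrite mxE.
Qed.

(** Evaluating the Hadamard decomposition at the point of coordinates h(a_i)
    kills every term but the constant one. *)
Lemma spec_env_comp (h : spectrum E) : h (env_comp sH a) = H (\row_i h (env_in (a i))).
Proof.
rewrite (env_taylor (\row_i h (env_in (a i)))) rmorphD rmorph_sum spec_scal.
rewrite big1 ?addr0 // => j _.
by rewrite rmorphM rmorphB spec_scal mxE subrr mul0r.
Qed.
End Taylor.

Lemma form_d1 (B : geomAlgType R) : form_d (1 : B) = 0.
Proof.
apply: (addrI (form_d (1 : B))).
by rewrite addr0 -[in RHS](mulr1 (1 : B)) form_dM !scale1r.
Qed.

Lemma form_d_scal (B : geomAlgType R) k : form_d (scal k : B) = 0.
Proof. by rewrite -[scal k]mulr1 form_dZ form_d1 scaler0. Qed.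

Lemma form_dB (B : geomAlgType R) (a b : B) : form_d (a - b) = form_d a - form_d b.
Proof. by apply: (addIr (form_d b)); rewrite -form_dD !subrK. Qed.

Lemma form_d_sum (B : geomAlgType R) I (r : seq I) (F : I -> B) :
  form_d (\sum_(i <- r) F i) = \sum_(i <- r) form_d (F i).
Proof.
apply: (big_morph _ (@form_dD _ _)); by rewrite -(rmorph0 (@scal R B)) form_d_scal.
Qed.

(** In [env_taylor] at the coordinates p of a point h, the terms with d of a quotient
    carry the factor a_j - p_j, which h kills, and the quotients take at h the values
    of the partial derivatives of H. *)
Lemma form_d_env_comp k (H : 'rV[R]_k -> R) (sH : smooth_on setT H) (a : 'I_k -> A) :
  form_d (env_comp sH a) = \sum_j env_partial sH a j *: form_d (env_in (a j)).
Proof.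
apply/eqP; rewrite -subr_eq0; apply/eqP/forms1_geom => h.
pose p := \row_i h (env_in (a i)).
rewrite {1}(env_taylor sH a p) form_dD form_d_scal add0r form_d_sum -sumrB.
apply: (big_ind (comb (mu h) setT)) => [|u v|j _]; [exact: comb0|exact: combD|].
rewrite form_dM form_dB form_d_scal subr0 -addrA -scalerBl; apply: combD.
  by apply: comb_mem; rewrite rmorphB spec_scal mxE subrr.
apply: comb_mem; rewrite rmorphB !spec_env_comp -/p ray_avg0 subrr //.
Qed.

(** The curve is asked to start at h only in terms of values, because points of the
    spectrum are records that carry proofs. *)
Definition has_curve (D : A -> A) (h : spectrum A) (c : R -> spectrum A) : Prop :=
  (forall a, c 0 a = h a) /\
  forall a, is_derive (0 : R) 1 (fun t => c t a) (h (D a)).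

Definition along_curves (D : A -> A) := forall h, exists c, has_curve D h c.

Lemma is_derive_env_comp (D : A -> A) k (H : 'rV[R]_k -> R) (sH : smooth_on setT H)
    (a : 'I_k -> A) h c : has_curve D h c ->
  is_derive (0 : R) 1 (fun t => env_ev (c t) (env_comp sH a))
    (env_ev h (\sum_j env_partial sH a j * env_in (D (a j)))).
Proof.
move=> [c0 dc].
rewrite env_ev_sum; under eq_bigr do rewrite env_evM mulrC env_ev_in env_ev_comp.
have -> : (fun t => env_ev (c t) (env_comp sH a)) = H \o (fun t => \row_i c t (a i)) by [].
have <- : \row_i c 0 (a i) = \row_i h (a i) by apply/rowP => i; rewrite !mxE c0.
rewrite (eq_bigr (fun j => (\row_i h (D (a i))) 0 j *
   'D_(evec R j) H (\row_i c 0 (a i)))); last by move=> j _; rewrite mxE.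
apply: is_derive_comp_row; first exact: smooth_on_C1 openT sH I.
move=> j; rewrite mxE (_ : (fun t => _) = (fun t => c t (a j))) //.
by apply/funext => t; rewrite mxE.
Qed.

(** The representation of f as H(a) is chosen, but the result does not depend on it:
    it is the derivative of f along any curve that D differentiates. *)
Lemma env_derive (D : A -> A) : exists Db : E -> E,
  forall f h c, has_curve D h c ->
    is_derive (0 : R) 1 (fun t => env_ev (c t) f) (env_ev h (Db f)).
Proof.
suff /choice[Db DbP] : forall f : E, exists Df : E, forall h c, has_curve D h c ->
    is_derive (0 : R) 1 (fun t => env_ev (c t) f) (env_ev h Df) by exists Db.
move=> f; have [k [H [sH [a ->]]]] := envP f.
by exists (\sum_j env_partial sH a j * env_in (D (a j))) => h c; exact: is_derive_env_comp.
Qed.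

(** An element of the envelope is determined by its values, and derivatives along a
    curve are unique, so that each identity reduces to a rule for derivatives of
    real functions. *)
Lemma env_derive_props (D : A -> A) (Db : E -> E) : along_curves D ->
  (forall f h c, has_curve D h c ->
    is_derive (0 : R) 1 (fun t => env_ev (c t) f) (env_ev h (Db f))) ->
  [/\ forall f g, Db (f + g) = Db f + Db g,
      forall k f, Db (scal k * f) = scal k * Db f,
      forall f g, Db (f * g) = f * Db g + g * Db f &
      forall k (H : 'rV[R]_k -> R) (sH : smooth_on setT H) a,
        Db (env_comp sH a) = \sum_j env_partial sH a j * env_in (D (a j))].
Proof.
move=> cD dD.
have uniq f l : (forall h c, has_curve D h c ->
    is_derive (0 : R) 1 (fun t => env_ev (c t) f) (env_ev h l)) -> Db f = l.
  move=> H; apply: env_ext => h; have [c hc] := cD h.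
  by have [_ <-] := dD f h c hc; have [_ ->] := H h c hc.
have LM f g : Db (f * g) = f * Db g + g * Db f.
  apply: uniq => h c hc; rewrite env_evD !env_evM.
  have := is_deriveM (dD f h c hc) (dD g h c hc).
  by rewrite -!(env_ev_pt _ hc.1).
have L0 k : Db (scal k) = 0.
  apply: uniq => h c hc; exact: is_derive_cst.
split=> //.
- move=> f g; apply: uniq => h c hc; rewrite env_evD.
  exact: is_deriveD (dD f h c hc) (dD g h c hc).
- by move=> k f; rewrite LM L0 mulr0 addr0.
- by move=> k H sH a; apply: uniq => h c; exact: is_derive_env_comp.
Qed.

Lemma env_in_d (a : A) (D : A -> A) (Db : E -> E) : along_curves D ->
  (forall f h c, has_curve D h c ->
    is_derive (0 : R) 1 (fun t => env_ev (c t) f) (env_ev h (Db f))) ->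
  Db (env_in a) = env_in (D a).
Proof.
move=> cD dD; apply: env_ext => h; have [c hc] := cD h.
have [_ <-] := dD (env_in a) h c hc.
by have [_ E] := hc.2 a; exact: E.
Qed.

End EnvH.

(** * A criterion for the smoothening of 1-forms *)
Section Criterion.
Variables (R : realType) (A : geomAlgType R).
Local Notation E := (envelope A).

Definition forms1_env (w : forms1 A) : forms1 E :=
  forms1_ext (@env_in R A) (fun a => form_d (env_in a)) w.

Lemma env_in_dM (a b : A) : form_d (env_in (a * b)) =
  env_in a *: form_d (env_in b) + env_in b *: form_d (env_in a) :> forms1 E.
Proof. by rewrite rmorphM form_dM. Qed.
Lemma env_in_dD (a b : A) : form_d (env_in (a + b)) =
  form_d (env_in a) + form_d (env_in b) :> forms1 E.
Proof. by rewrite rmorphD form_dD. Qed.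
Lemma env_in_dS (k : R) (a : A) : form_d (env_in (scal k * a)) =
  scal k *: form_d (env_in a) :> forms1 E.
Proof.
rewrite (_ : env_in (scal k * a) = scal k * env_in a) ?form_dZ //.
by rewrite -env_in_scal; exact: rmorphM.
Qed.

Definition smoothening_map (t : smoothening (forms1 A)) : forms1 E :=
  tens_lift (fun (f : E) (w : forms1 A) => f *: forms1_env w) t.

Lemma forms1_envD u v : forms1_env (u + v) = forms1_env u + forms1_env v.
Proof.
exact: (forms1_extD (@env_in_scal R A) (@forms1_geom R E) env_in_dD env_in_dS env_in_dM).
Qed.
Lemma forms1_envZ a u : forms1_env (a *: u) = env_in a *: forms1_env u.
Proof.
exact: (forms1_extZ (@env_in_scal R A) (@forms1_geom R E) env_in_dD env_in_dS env_in_dM).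
Qed.
Lemma forms1_env_d a : forms1_env (form_d a) = form_d (env_in a).
Proof.
exact: (forms1_ext_d (@env_in_scal R A) (@forms1_geom R E) env_in_dD env_in_dS env_in_dM).
Qed.

Let bal : balanced (fun (a : A) (f : E) => env_in a * f)
  (fun (a : A) (w : forms1 A) => a *: w) (fun f w => f *: forms1_env w).
Proof.
split=> *; rewrite ?scalerDl ?forms1_envD ?scalerDr //.
by rewrite forms1_envZ scalerA mulrC.
Qed.

Lemma smoothening_map_tens f w : smoothening_map (stens f w) = f *: forms1_env w.
Proof. exact: (tens_lift_pure bal). Qed.
Lemma smoothening_mapD t u : smoothening_map (t + u) = smoothening_map t + smoothening_map u.
Proof. exact: (tens_liftD bal). Qed.
Lemma smoothening_map0 : smoothening_map 0 = 0.
Proof. exact: (tens_lift0 bal). Qed.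

Lemma stens_ind (C : smoothening (forms1 A) -> Prop) : C 0 ->
  (forall f w, C (stens f w)) -> (forall u v, C u -> C v -> C (u + v)) ->
  forall u, C u.
Proof. exact: tens_ind. Qed.

Lemma smoothening_mapZ f t : smoothening_map (f *: t) = f *: smoothening_map t.
Proof.
elim/stens_ind: t => [|g w|t u Ht Hu]; first by rewrite scaler0 smoothening_map0 scaler0.
  rewrite (_ : f *: stens g w = stens (f * g) w); last exact: bscale_tens.
  by rewrite !smoothening_map_tens scalerA.
by rewrite scalerDr !smoothening_mapD scalerDr Ht Hu.
Qed.

Lemma smoothening_map_linear : linear smoothening_map.
Proof. by move=> f t u; rewrite smoothening_mapD smoothening_mapZ. Qed.
HB.instance Definition _ := GRing.isLinear.Build E (smoothening (forms1 A))
  (forms1 E) _ smoothening_map smoothening_map_linear.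

Variables (p : nat) (g : 'I_p -> A) (D : 'I_p -> A -> A).
Hypothesis cD : forall i, along_curves (D i).
Hypothesis dE : forall a : A, form_d a = \sum_i D i a *: form_d (g i).

Lemma regular_geom : geometric_module (E^o : lmodType E).
Proof.
move=> f gf; suff : (f : E) = 0 by [].
apply: envelope_geometric => h; have [s sP ->] := gf h.
rewrite (_ : \sum_(q <- s) q.1 *: q.2 = \sum_(q <- s) (q.1 : E) * q.2 :> E) //.
rewrite rmorph_sum big_seq big1 // => q /sP[hq _].
by rewrite rmorphM hq mul0r.
Qed.

(** The inverse is w |-> sum_i X_i(w) (1 (x) dg_i), where X_i is the functional of the
    extension of D_i to the envelope. *)
Lemma smoothening_criterion :
  exists phi : {linear smoothening (forms1 A) -> forms1 E},
    (forall (f : E) (a : A), phi (stens f (form_d a)) = f *: form_d (env_in a)) /\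
    bijective phi.
Proof.
exists smoothening_map; split=> [f a|].
  exact: etrans (smoothening_map_tens _ _) (congr1 _ (forms1_env_d _)).
have /choice[Db DbP] := fun i => env_derive (D i).
have iS (k : R) : (idfun : {rmorphism E -> E}) (scal k) = scal k by [].
pose X i (w : forms1 E) : E^o := forms1_ext (idfun : {rmorphism E -> E}) (Db i : E -> E^o) w.
have XP i : [/\ forall u v, X i (u + v) = X i u + X i v,
    forall f u, X i (f *: u) = f * X i u & forall f, X i (form_d f) = Db i f].
  have [DD DS DM _] := env_derive_props (cD i) (DbP i).
  split; [exact: (forms1_extD iS regular_geom DD DS DM)
   |exact: (forms1_extZ iS regular_geom DD DS DM)
   |exact: (forms1_ext_d iS regular_geom DD DS DM)].
have st := btens_balanced (@env_in R A) (forms1 A).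
have X0 i : X i 0 = 0.
  by have [XD _ _] := XP i; apply: (addrI (X i 0)); rewrite -XD !addr0.
pose psi w : smoothening (forms1 A) := \sum_i stens (X i w) (form_d (g i)).
have psiD u v : psi (u + v) = psi u + psi v.
  rewrite /psi -big_split; apply: eq_bigr => i _; have [-> _ _] := XP i.
  exact: (bal_addl st).
have psi0 : psi 0 = 0.
  rewrite /psi big1 // => i _; rewrite X0; exact: (bal_0l st).
have psiZ f u : psi (f *: u) = f *: psi u.
  rewrite /psi scaler_sumr; apply: eq_bigr => i _; have [_ -> _] := XP i.
  symmetry; exact: bscale_tens.
have phi_sum I (r : seq I) F : smoothening_map (\sum_(i <- r) F i) = \sum_(i <- r) smoothening_map (F i).
  exact: (big_morph _ smoothening_mapD smoothening_map0).
have stZ (f f' : E) w : f *: stens f' w = stens (f * f') w by exact: bscale_tens.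
have st_sum I (r : seq I) (f : E) (F : I -> forms1 A) :
    stens f (\sum_(i <- r) F i) = \sum_(i <- r) stens f (F i).
  exact: (big_morph _ (bal_addr st f) (bal_0r st f)).
(* The coefficients D_i(a) lie in A, hence pass through the tensor product. *)
have psi_d (a : A) : psi (form_d (env_in a)) = stens 1 (form_d a).
  rewrite dE st_sum; apply: eq_bigr => i _; have [_ _ ->] := XP i.
  rewrite (env_in_d _ (cD i) (DbP i)) -[env_in _]mulr1; exact: (bal_mid st).
have phiK : cancel smoothening_map psi.
  move=> t; elim/stens_ind: t => [|f w|t u Ht Hu].
  + by rewrite (_ : smoothening_map _ = 0) ?psi0 //; exact: smoothening_map0.
  + rewrite (_ : smoothening_map _ = f *: forms1_env w); last exact: smoothening_map_tens.
    rewrite psiZ; elim/forms1_ind: w => [|a b|u v Hu Hv].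
    * rewrite (_ : forms1_env 0 = 0); last first.
        by apply: (addrI (forms1_env 0)); rewrite -forms1_envD !addr0.
      rewrite psi0 scaler0; symmetry; exact: (bal_0r st).
    * rewrite forms1_envZ forms1_env_d psiZ psi_d !stZ mulr1 mulrC; exact: (bal_mid st).
    * rewrite forms1_envD psiD scalerDr Hu Hv; symmetry; exact: (bal_addr st).
  + by rewrite (_ : smoothening_map _ = smoothening_map t + smoothening_map u) ?psiD ?Ht ?Hu //; exact: smoothening_mapD.
have psiK : cancel psi smoothening_map.
  move=> w; elim/forms1_ind: w => [|f b|u v Hu Hv].
  + by rewrite psi0; exact: smoothening_map0.
  + rewrite psiZ (_ : smoothening_map _ = f *: smoothening_map (psi (form_d b))); last exact: smoothening_mapZ.
    congr (_ *: _); have [k [H [sH [a ->]]]] := envP b.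
    rewrite phi_sum [RHS]form_d_env_comp.
    rewrite (eq_bigr (fun i => \sum_j env_partial sH a j *:
       (env_in (D i (a j)) *: form_d (env_in (g i))))); last first.
      move=> i _; rewrite smoothening_map_tens forms1_env_d; have [_ _ ->] := XP i.
      have [_ _ _ ->] := env_derive_props (cD i) (DbP i).
      by rewrite scaler_suml; apply: eq_bigr => j _; rewrite scalerA.
    rewrite exchange_big; apply: eq_bigr => j _ /=; rewrite -scaler_sumr; congr (_ *: _).
    rewrite -forms1_env_d dE (big_morph _ forms1_envD (_ : forms1_env 0 = 0)).
      by apply: eq_bigr => i _; rewrite forms1_envZ forms1_env_d.
    by apply: (addrI (forms1_env 0)); rewrite -forms1_envD !addr0.
  + rewrite psiD (_ : smoothening_map _ = smoothening_map (psi u) + smoothening_map (psi v)); last exact: smoothening_mapD.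
    congr (_ + _); [exact: Hu|exact: Hv].
by exists psi; [exact: phiK|exact: psiK].
Qed.
End Criterion.

(** * Charts and gradients *)
Section Charts.
Variables (R : realType) (M : manifold R).
Local Notation n := (Defs.dim M).
Implicit Types (c : chart R n M) (f g : M -> R) (x y : M).

Definition chart_im c : set 'rV[R]_n := c @` chart_dom c.

Lemma chart_im_open c : open (chart_im c). Proof. exact: chart_cod_open. Qed.

Lemma chart_im_map c x : chart_dom c x -> chart_im c (c x).
Proof. by move=> cx; exists x. Qed.

Lemma chart_inv_dom c u : chart_im c u -> chart_dom c (chart_inv c u).
Proof. by move=> [x cx <-]; rewrite chart_mapK. Qed.

Lemma chart_invK c u : chart_im c u -> c (chart_inv c u) = u.
Proof. by move=> [x cx <-]; rewrite chart_mapK. Qed.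

Lemma chart_inv_preim_open c (V : set M) :
  open V -> open [set u | chart_im c u /\ V (chart_inv c u)].
Proof.
move=> oV; rewrite openE => u [cu Vu].
have H1 : nbhs u (chart_im c) by apply: open_nbhs_nbhs; split=> //; exact: chart_im_open.
have H2 : nbhs u [set v | V (chart_inv c v)].
  by apply: (chart_inv_cont cu); apply: open_nbhs_nbhs.
have FF := nbhs_filter u; exact: filterI H1 H2.
Qed.

Lemma chart_preim_open c (V : set 'rV[R]_n) : open V ->
  open [set x | chart_dom c x /\ V (c x)].
Proof.
move=> oV; rewrite openE => x [cx Vx].
have H1 : nbhs x (chart_dom c) by apply: open_nbhs_nbhs; split=> //; exact: chart_open.
have H2 : nbhs x [set y | V (c y)].
  by apply: (chart_cont cx); apply: open_nbhs_nbhs.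
exact: filterI H1 H2.
Qed.

Lemma smooth_near f : (forall x, exists g, smooth g /\ \near x, g x = f x) ->
  smooth f.
Proof.
move=> H c Ac; apply: smooth_on_loc => u cu.
have [g [sg gf]] := H (chart_inv c u).
have : nbhs (chart_inv c u) [set y | g y = f y] := gf.
rewrite nbhsE => -[V [oV Vx] VE].
exists [set u | chart_im c u /\ V (chart_inv c u)], (g \o chart_inv c); split=> //.
- exact: chart_inv_preim_open.
- by apply: smooth_on_sub (sg c Ac) => v [].
- by move=> v [_ /VE].
Qed.

(** The open set where both charts make sense, read in the chart c. *)
Lemma transition c c' x : atlas c -> atlas c' -> chart_dom c x -> chart_dom c' x ->
  exists W, [/\ open W, W (c x), W `<=` chart_im c,
    (forall u, W u -> chart_dom c' (chart_inv c u)) &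
    forall j, smooth_on W (fun u => c' (chart_inv c u) 0 j)].
Proof.
move=> Ac Ac' cx cx'.
exists [set u | chart_im c u /\ chart_dom c' (chart_inv c u)]; split.
- exact/chart_inv_preim_open/chart_open.
- by split; [exact: chart_im_map|rewrite chart_mapK].
- by move=> u [].
- by move=> u [].
- move=> j; apply: smooth_on_sub (atlas_compat Ac Ac' j) => u [cu c'u].
  by exists (chart_inv c u); [split=> //; exact: chart_inv_dom|exact: chart_invK].
Qed.

(** Smoothness may be tested in one chart around each point: in another chart f is
    composed with a transition map. *)
Lemma smooth_local f : (forall x, exists c V, [/\ atlas c, chart_dom c x, open V, V (c x) &
   smooth_on V (f \o chart_inv c)]) -> smooth f.
Proof.
move=> H c' Ac'; apply: smooth_on_loc => u cu; set x := chart_inv c' u.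
have [c [V [Ac cx oV Vx sV]]] := H x.
have [W [oW Wx Wc Wd sW]] := transition Ac' Ac (chart_inv_dom cu) cx.
rewrite chart_invK // in Wx.
pose W' := [set v | W v /\ V (c (chart_inv c' v))].
have oW' : open W'.
  rewrite (_ : W' = W `&` [set v | chart_im c' v /\
      [set y | chart_dom c y /\ V (c y)] (chart_inv c' v)]).
    by apply: openI => //; apply: chart_inv_preim_open; exact: chart_preim_open.
  apply/seteqP; split=> v [] Wv; first by move=> Vv; split=> //; split; [exact: Wc|split=> //; exact: Wd].
  by move=> [_ []].
exists W', ((f \o chart_inv c) \o (fun v => c (chart_inv c' v))); split=> //.
  apply: (smooth_on_comp oW' oV) sV; first by move=> j; apply: smooth_on_sub (sW j) => v [].
  by move=> v [].
by move=> v [Wv _]; rewrite /= chart_mapK //; exact: Wd.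
Qed.

(** The passage from functions of the coordinates to functions on the manifold; it
    gives the bumps (G = 1), the bumped coordinates, and the factors of [flat_mu2]. *)
Definition bump_ext c p r (G : 'rV[R]_n -> R) (x : M) : R :=
  if asbool (chart_dom c x) then cbump p r (c x) * G (c x) else 0.

Lemma bump_extE c p r G x : chart_dom c x -> bump_ext c p r G x = cbump p r (c x) * G (c x).
Proof. by move=> cx; rewrite /bump_ext asboolT. Qed.

Lemma bump_ext_out c p r G x : ~ chart_dom c x -> bump_ext c p r G x = 0.
Proof. by move=> cx; rewrite /bump_ext asboolF. Qed.

Section Ext.
Variables (c : chart R n M) (p : 'rV[R]_n) (r : R).
Hypotheses (Ac : atlas c) (r0 : 0 < r) (pr : cbox p (2 * r) `<=` chart_im c).

Definition bump_core : set M := chart_inv c @` cbox p (2 * r).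

Lemma bump_core_compact : compact bump_core.
Proof.
apply: continuous_compact; last exact: cbox_compact.
by apply: continuous_in_subspaceT => u /set_mem /pr; exact: chart_inv_cont.
Qed.

(** This is where the Hausdorff property enters: a compact subset of a chart is closed
    in the whole manifold, so that extensions by 0 are smooth. *)
Lemma bump_core_closed : closed bump_core.
Proof. exact: compact_closed (@manifold_hausdorff _ M) bump_core_compact. Qed.

Lemma bump_ext_core G x : bump_ext c p r G x != 0 -> bump_core x.
Proof.
have [cx|cx] := pselect (chart_dom c x); last by rewrite bump_ext_out ?eqxx.
rewrite bump_extE // mulf_eq0 negb_or => /andP[/(cbump_supp r0) H _].
by exists (c x); [move=> j; apply/ltW/H|rewrite chart_mapK].
Qed.

Lemma bump_ext_smooth G : smooth_on (chart_im c) G -> smooth (bump_ext c p r G).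
Proof.
move=> sG; have sE : smooth_on (chart_im c) (bump_ext c p r G \o chart_inv c).
  apply: (@smooth_on_ext _ _ _ (cbump p r * G)); first exact: chart_im_open.
    by move=> u cu; rewrite /= bump_extE ?chart_invK //; exact: chart_inv_dom.
  by apply: smooth_onM => //; [exact: chart_im_open|apply: cbump_smooth; exact: chart_im_open].
apply: smooth_local => x; have [cx|cx] := pselect (chart_dom c x).
  by exists c, (chart_im c); split=> //; [exact: chart_im_open|exact: chart_im_map].
have [c' Ac' c'x] := atlas_cover x.
have nx : ~ bump_core x by move=> [u /pr cu ux]; apply: cx; rewrite -ux; exact: chart_inv_dom.
have oV : open [set u | chart_im c' u /\ (~` bump_core) (chart_inv c' u)].
  apply: chart_inv_preim_open; exact: closed_openC bump_core_closed.
exists c', [set u | chart_im c' u /\ (~` bump_core) (chart_inv c' u)]; split=> //.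
  by split; [exact: chart_im_map|rewrite chart_mapK].
apply: (@smooth_on_ext _ _ _ (cst 0)) => //; last exact: smooth_on_cst.
by move=> u [_ nu]; apply/esym/eqP/negP => /negP /bump_ext_core.
Qed.

End Ext.

Definition grad c f x : 'cV[R]_n := \col_j 'D_(evec R j) (f \o chart_inv c) (c x).

Lemma near_grad c f g x : chart_dom c x -> (\near x, f x = g x) -> grad c f x = grad c g x.
Proof.
move=> cx fg; apply/matrixP => j i; rewrite !mxE; apply: near_eq_derive.
have := chart_inv_cont (chart_im_map cx); rewrite /prop_for /continuous_at chart_mapK //.
by move=> /(_ _ fg).
Qed.

Lemma smooth_C1 c f x : atlas c -> smooth f -> chart_dom c x ->
  C1_at (f \o chart_inv c) (c x).
Proof.
move=> Ac sf cx; apply: (@smooth_on_C1 _ _ (chart_im c)); [exact: chart_im_open|exact: sf|].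
exact: chart_im_map.
Qed.

(** T is the jacobian of the transition map. *)
Lemma grad_change c c' x : atlas c -> atlas c' -> chart_dom c x -> chart_dom c' x ->
  exists T : 'M[R]_n, forall f, smooth f -> grad c' f x = T *m grad c f x.
Proof.
move=> Ac Ac' cx c'x; have [W [oW Wx Wc Wd sW]] := transition Ac' Ac c'x cx.
exists (\matrix_(j, i) 'D_(evec R j) (fun u => c (chart_inv c' u) 0 i) (c' x)) => f sf.
apply/matrixP => j i; rewrite !mxE.
under eq_bigr do rewrite !mxE.
have E : \forall u \near c' x, ((f \o chart_inv c) \o (fun v => c (chart_inv c' v))) u =
    (f \o chart_inv c') u.
  have : nbhs (c' x) W by exact: open_nbhs_nbhs.
  apply: (@filterS _ _ (nbhs_filter _)) => u Wu /=; rewrite chart_mapK //; exact: Wd.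
rewrite -(near_eq_derive _ E).
set d := \row_i 'D_(evec R j) (fun u => c (chart_inv c' u) 0 i) (c' x).
rewrite (eq_bigr (fun i => d 0 i * 'D_(evec R i) (f \o chart_inv c) (c (chart_inv c' (c' x))))).
  apply: derive_val; apply: is_derive_comp_row.
    by rewrite chart_mapK //; exact: smooth_C1.
  by move=> k; rewrite mxE; apply: derivableP; exact: smooth_on_derivable (sW k) Wx.
by move=> k _; rewrite mxE chart_mapK.
Qed.

Lemma cbox_chart_im c x : chart_dom c x ->
  exists2 r, 0 < r & cbox (c x) (2 * r) `<=` chart_im c.
Proof.
move=> cx; have /nbhs_ballP[e e0 eE] : nbhs (c x) (chart_im c).
  by apply: open_nbhs_nbhs; split; [exact: chart_im_open|exact: chart_im_map].
exists (e / 4); first by rewrite divr_gt0.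
move=> u ux; apply: eE; split=> // i j; rewrite ord1 /ball /= distrC.
apply: le_lt_trans (ux j) _; have e0' : 0 < e := e0; lra.
Qed.

Lemma bump_ext_near c p r G x : 0 < r -> chart_dom c x -> ball p r (c x) ->
  \near x, bump_ext c p r G x = G (c x).
Proof.
move=> r0 cx px; have : nbhs x [set y | chart_dom c y /\ ball p r (c y)].
  by apply: open_nbhs_nbhs; split=> //; apply: chart_preim_open; exact: ball_open.
apply: filterS => y [cy [_ py]]; rewrite bump_extE // cbump1 ?mul1r // => j.
by have := py 0 j; rewrite /ball /= distrC => /ltW.
Qed.

(** The coordinates of c, cut off away from x. *)
Lemma grad_coord c x : atlas c -> chart_dom c x -> exists f : 'I_n -> M -> R,
  forall i, smooth (f i) /\ grad c (f i) x = delta_mx i 0.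
Proof.
move=> Ac cx.
have [r r0 rc] : exists2 r, 0 < r & cbox (c x) (2 * r) `<=` chart_im c.
  exact: cbox_chart_im.
exists (fun i => bump_ext c (c x) r (fun u => u 0 i)) => i.
have sf : smooth (bump_ext c (c x) r (fun u => u 0 i)).
  by apply: bump_ext_smooth => //; exact: smooth_on_coord.
split=> //; have E := @bump_ext_near c (c x) r (fun u => u 0 i) x r0 cx (ballxx _ r0).
rewrite (near_grad cx E); apply/matrixP => j k; rewrite !mxE ord1 eqxx andbT.
have E' : \forall u \near c x, (fun v : 'rV[R]_n => v 0 i) u =
    ((fun y => c y 0 i) \o chart_inv c) u.
  have : nbhs (c x) (chart_im c).
    by apply: open_nbhs_nbhs; split; [exact: chart_im_open|exact: chart_im_map].
  by apply: (@filterS _ _ (nbhs_filter _)) => u cu; rewrite /= chart_invK.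
rewrite -(near_eq_derive _ E').
by have [_ ->] := is_derive_coord (c x) (evec R j) i; rewrite mxE eqxx eq_sym.
Qed.

(** Changing charts twice fixes the coordinate vectors. *)
Lemma grad_change_unit c c' x : atlas c -> atlas c' -> chart_dom c x -> chart_dom c' x ->
  exists2 T : 'M[R]_n, T \in unitmx & forall f, smooth f -> grad c' f x = T *m grad c f x.
Proof.
move=> Ac Ac' cx c'x; have [T TP] := grad_change Ac Ac' cx c'x.
have [T' TP'] := grad_change Ac' Ac c'x cx.
exists T => //; have [f fP] := grad_coord Ac cx.
have : T' *m T = 1%:M; last by case/mulmx1_unit.
apply/matrixP => i j; have [sf gf] := fP j.
have := congr1 (fun A : 'cV[R]_n => A i 0) (TP' _ sf).
rewrite (TP _ sf) gf mulmxA -colE !mxE => <-.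
by rewrite eqxx andbT.
Qed.

End Charts.

Arguments chart_im_open {R M} c.
(** * Exhausting functions and the points of C^oo(M) *)
Section SmoothAlg.
Variables (R : realType) (M : manifold R).
Implicit Types (f g : M -> R).

Lemma smooth_cst (k : R) : smooth (fun _ : M => k).
Proof. by move=> c _; exact: smooth_on_cst. Qed.

Lemma smoothM f g : smooth f -> smooth g -> smooth (fun x => f x * g x).
Proof. by move=> sf sg c Ac; apply: smooth_onM; [exact: chart_im_open|exact: sf|exact: sg]. Qed.

Lemma smoothB f g : smooth f -> smooth g -> smooth (fun x => f x - g x).
Proof. by move=> sf sg c Ac; apply: smooth_onB; [exact: chart_im_open|exact: sf|exact: sg]. Qed.

Lemma smooth_sum I (r : seq I) (P : pred I) (F : I -> M -> R) :
  (forall i, P i -> smooth (F i)) -> smooth (fun x => \sum_(i <- r | P i) F i x).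
Proof.
move=> sF c Ac.
have := @smooth_on_sum R _ I r P (fun i => F i \o chart_inv c) _ (chart_im_open c).
by apply=> i Pi; exact: sF.
Qed.

Lemma smooth_prod I (r : seq I) (P : pred I) (F : I -> M -> R) :
  (forall i, P i -> smooth (F i)) -> smooth (fun x => \prod_(i <- r | P i) F i x).
Proof.
move=> sF c Ac.
have := @smooth_on_prod R _ I r P (fun i => F i \o chart_inv c) _ (chart_im_open c).
by apply=> i Pi; exact: sF.
Qed.

Lemma smoothV f : smooth f -> (forall x, f x != 0) -> smooth (fun x => (f x)^-1).
Proof.
move=> sf f0 c Ac.
have := @smooth_onV R _ _ (f \o chart_inv c) (chart_im_open c) (sf c Ac).
by apply=> u _; exact: f0.
Qed.

Lemma smooth_comp1 f (h : R -> R) : smooth1 h -> smooth f -> smooth (fun x => h (f x)).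
Proof.
move=> sh sf c Ac.
exact: (@smooth1_comp R _ _ (f \o chart_inv c) h (chart_im_open c) sh (sf c Ac)).
Qed.

Lemma smooth_continuous f : smooth f -> continuous f.
Proof.
move=> sf x; have [c Ac cx] := atlas_cover x.
have H : {for x, continuous ((f \o chart_inv c) \o c)}.
  apply: continuous_comp; first exact: chart_cont.
  by apply: smooth_on_continuous (sf c Ac) _; exact: chart_im_map.
have E : \forall y \near x, ((f \o chart_inv c) \o c) y = f y.
  have : nbhs x (chart_dom c) by apply: open_nbhs_nbhs; split=> //; exact: chart_open.
  by apply: filterS => y cy; rewrite /= chart_mapK.
move: H; rewrite /prop_for /continuous_at /= chart_mapK //.
by apply: cvg_trans; apply: near_eq_cvg; apply: filterS E => y ->.
Qed.

End SmoothAlg.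

(** To each basic open set contained in some O x, one such x is attached; basic open
    sets are numbered by an injection e into nat. *)
Lemma lindelof_seq (T : topologicalType) (O : T -> set T) (t0 : T) :
  @second_countable T -> (forall x, nbhs x (O x)) ->
  exists s : nat -> T, forall y, exists k, O (s k) y.
Proof.
move=> [B /countable_injP[e eB] [Bo Bb]] HO.
have /choice[s sP] : forall k, exists z, forall U x, B U -> e U = k -> U `<=` O x -> U `<=` O z.
  move=> k; have [[U [x [BU eU UO]]]|H] := pselect (exists U x, [/\ B U, e U = k & U `<=` O x]).
    exists x => V y BV eV VO; suff -> : V = U by [].
    by apply: eB; rewrite ?inE // eV.
  by exists t0 => U x BU eU UO; case: H; exists U, x.
exists s => y.
have [U [BU Uy] UO] := Bb y _ (HO y).
by exists (e U); apply: (sP (e U) U y BU).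
Qed.

(** The finite subsets of T, ordered by inclusion, are the parameters of the
    formulation of compactness by near coverings. *)
Lemma compact_subcover (T : topologicalType) (A : set T) (O : T -> set T) :
  compact A -> (forall x, open (O x)) -> (forall x, O x x) ->
  exists s : seq T, forall y, A y -> exists2 x, x \in s & O x y.
Proof.
move=> cA oO Ox.
pose F : set_system (seq T) := filter_from setT (fun s0 : seq T => [set s : seq T | {subset s0 <= s}]).
have FF : Filter F.
  apply: filter_from_filter; first by exists [::].
  move=> s1 s2 _ _; exists (s1 ++ s2) => // s H.
  by split=> x xs; apply: H; rewrite mem_cat xs ?orbT.
have [|s0 _ H] := (compact_near_coveringP A).1 cA _ F
  (fun s y => exists2 x, x \in s & O x y) FF.
  move=> y _; exists (O y, [set s : seq T | {subset [:: y] <= s}]).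
    split; last by exists [:: y].
    by apply: open_nbhs_nbhs; split; [exact: oO|exact: Ox].
  by move=> [z s] /= [Oz ys]; exists y => //; apply: ys; rewrite inE.
by exists s0; exact: H.
Qed.

Section Proper.
Variables (R : realType) (M : manifold R).

Definition bump_at (b : M -> R) (x : M) : Prop :=
  [/\ smooth b, (forall y, 0 <= b y <= 1), (\near x, b x = 1) &
   exists2 C : set M, compact C & forall y, b y != 0 -> C y].

Lemma bump_exists (x : M) : exists b, bump_at b x.
Proof.
have [c Ac cx] := atlas_cover x; have [r r0 rc] := cbox_chart_im cx.
exists (bump_ext c (c x) r (fun=> 1)); split.
- by apply: bump_ext_smooth => //; exact: smooth_on_cst.
- move=> y; have [cy|cy] := pselect (chart_dom c y); last by rewrite bump_ext_out ?lexx ?ler01.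
  by rewrite bump_extE // mulr1 cbump_ge0 cbump_le1.
- exact: (@bump_ext_near _ _ c (c x) r (fun=> 1) x r0 cx (ballxx _ r0)).
- by exists (bump_core c (c x) r); [exact: bump_core_compact|exact: bump_ext_core].
Qed.

(** Let b_k be a sequence of bumps whose sets where b_k = 1 near the point cover M, and
    let q_j = (1 - b_0) .. (1 - b_j).  Near a point where b_k = 1, only q_0, .., q_(k-1)
    are nonzero, so that rho = sum_j q_j is smooth; where b_0, .., b_(m-1) vanish, the
    first m terms are 1, so that rho < m only on the union of their supports. *)
Lemma proper_fun : exists rho : M -> R, [/\ smooth rho, forall x, 0 <= rho x &
  forall K : R, exists2 C : set M, compact C & forall x, rho x <= K -> C x].
Proof.
have [[x0 _]|M0] := pselect (exists x : M, True); last first.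
  exists (fun=> 0); split=> [|x|K]; first exact: smooth_cst.
    by [].
  by exists set0; [exact: compact0|move=> x; case: M0; exists x].
have /choice[b bP] := bump_exists.
pose one x := [set y | b x y = 1].
have [s sP] : exists s : nat -> M, forall y, exists k, (one (s k))^° y.
  apply: (@lindelof_seq M (fun x => (one x)^°) x0 (@manifold_second_countable R M)) => x.
  by apply: nbhs_interior; have [_ _] := bP x.
pose q j (x : M) := \prod_(i < j.+1) (1 - b (s i) x).
have sq j : smooth (q j).
  by apply: smooth_prod => i _; apply: smoothB; [exact: smooth_cst|have [] := bP (s i)].
have q0 j x : 0 <= q j x.
  by apply: prodr_ge0 => i _; rewrite subr_ge0; have [_ /(_ x)/andP[]] := bP (s i).
have q_vanish j k x : b (s k) x = 1 -> (k <= j)%N -> q j x = 0.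
  move=> bk kj; have kj' : (k < j.+1)%N by rewrite ltnS.
  by rewrite /q (bigD1 (Ordinal kj')) //= bk subrr mul0r.
have sum_eq k m x : b (s k) x = 1 -> (k <= m)%N ->
    \sum_(j < m) q j x = \sum_(j < k) q j x.
  move=> bk km; rewrite -!(big_mkord predT (fun j => q j x)) (big_cat_nat (n := k)) //=.
  rewrite [X in _ + X]big_nat_cond [X in _ + X]big1 ?addr0 // => j /andP[/andP[kj _] _].
  exact: q_vanish bk kj.
have /choice[N NP] := sP.
have N1 x : b (s (N x)) x = 1 by exact: (nbhs_singleton (NP x)).
exists (fun x => \sum_(j < N x) q j x); split.
- apply: smooth_near => x; exists (fun y => \sum_(j < N x) q j y); split.
    by apply: smooth_sum => j _; exact: sq.
  have := NP x; apply: filterS => y by1.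
  have := sum_eq _ (maxn (N x) (N y)) _ by1 (leq_maxl _ _).
  by rewrite (sum_eq _ _ _ (N1 y) (leq_maxr _ _)).
- by move=> x; apply: sumr_ge0 => j _.
- move=> K; pose m := Num.bound `|K|.
  have Km : K < m%:R by apply: le_lt_trans (ler_norm K) _; exact: archi_boundP.
  have /choice[C CP] : forall x, exists C : set M, compact C /\ forall y, b x y != 0 -> C y.
    by move=> x; have [_ _ _ [C cC bC]] := bP x; exists C.
  exists (\big[setU/set0]_(i < m) C (s i)).
    by apply: bigsetU_compact => i _; case: (CP (s i)).
  move=> x xK; apply: contrapT => nx.
  have b0 i : (i < m)%N -> b (s i) x = 0.
    move=> im; apply/eqP/negP => /negP bi; apply: nx.
    rewrite -(bigcup_mkord m (fun i => C (s i))).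
    by exists i => //; exact: (CP (s i)).2.
  have mN : (m <= N x)%N.
    rewrite leqNgt; apply/negP => /b0; rewrite N1 => /eqP; by rewrite oner_eq0.
  move: xK; apply/negP; rewrite -ltNge; apply: lt_le_trans Km _.
  rewrite -(big_mkord predT (fun j => q j x)) (big_cat_nat (n := m)) //=.
  rewrite -[leLHS]addr0 lerD //; last by apply: sumr_ge0.
  rewrite big_mkord (eq_bigr (fun=> 1)) ?sumr_const ?card_ord // => j _.
  by rewrite /q big1 // => i _; rewrite b0 ?subr0 // (leq_trans (ltn_ord i)).
Qed.

(** If h is no evaluation, each x has a function F_x with F_x(x) <> h(F_x); finitely
    many of them separate h from the points of the compact set rho <= h(rho).  Then
    (rho - h(rho))^2 + sum (F_x - h(F_x))^2 has no zero, hence is invertible, whereas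
    h sends it to 0. *)
Lemma spectrum_ev (h : spectrum (Cinf M)) : exists x : M, forall f : Cinf M, h f = f x.
Proof.
have [rho [srho rho0 rhoP]] := proper_fun.
have mk f (sf : smooth f) : f \in @smooth_pred R M by apply/asboolP.
pose rhoC := MkCinf (mk _ srho); have [C cC CP] := rhoP (h rhoC).
apply: contrapT => nh.
have /choice[F FP] : forall x : M, exists f : Cinf M, h f != f x.
  move=> x; apply: contrapT => H; apply: nh; exists x => f.
  by apply/eqP/negP => /negP hf; apply: H; exists f.
have Fc (f : Cinf M) : continuous f by exact: smooth_continuous (CinfP f).
have oF x : open [set y | F x y != h (F x)].
  apply: (@open_comp _ _ (F x) [set z | z != h (F x)]) => [y _|]; [exact: Fc|exact: open_neq].
have [|t tP] := compact_subcover cC oF; first by move=> x; rewrite /= eq_sym; exact: FP.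
pose Phi : Cinf M := (rhoC - scal (h rhoC)) ^+ 2 +
  \sum_(x <- t) (F x - scal (h (F x))) ^+ 2.
have h0 : h Phi = 0.
  rewrite rmorphD rmorph_sum rmorphXn rmorphB spec_scal subrr expr0n add0r.
  by rewrite big1 // => x _; rewrite rmorphXn rmorphB spec_scal subrr expr0n.
have PhiE y : Phi y = (rho y - h rhoC) ^+ 2 + \sum_(x <- t) (F x y - h (F x)) ^+ 2.
  rewrite -[LHS]/(ev y Phi) rmorphD rmorph_sum rmorphXn rmorphB.
  by congr (_ + _); apply: eq_bigr => x _; rewrite rmorphXn rmorphB.
have Phi0 y : Phi y != 0.
  rewrite PhiE paddr_eq0 ?sqr_ge0 ?sumr_ge0 // => [|x _]; last exact: sqr_ge0.
  rewrite sqrf_eq0 subr_eq0 negb_and; apply/orP.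
  have [/eqP ryh|] := eqVneq (rho y) (h rhoC); last by left.
  right; have [x xt Fxy] : exists2 x, x \in t & F x y != h (F x).
    by apply: tP; apply: CP; rewrite (eqP ryh).
  rewrite psumr_eq0; last by move=> z _; exact: sqr_ge0.
  by apply/allPn; exists x => //=; rewrite sqrf_eq0 subr_eq0.
pose Psi := MkCinf (mk _ (smoothV (CinfP Phi) Phi0)).
have : h (Psi * Phi) = 1.
  rewrite (_ : Psi * Phi = 1) ?rmorph1 //; apply: val_inj; apply/funext => y.
  by rewrite -[LHS]/(ev y (Psi * Phi)) rmorphM; exact: mulVf.
by rewrite rmorphM h0 mulr0 => /eqP; rewrite eq_sym oner_eq0.
Qed.
End Proper.

(** * Matrices avoiding a family of kernels *)
Lemma leq_card_bigcup (T I : finType) (F : I -> {set T}) :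
  (#|(\bigcup_i F i)%SET| <= \sum_i #|F i|)%N.
Proof.
elim/big_rec2: _ => [|i m A _ IH]; first by rewrite finset.cards0.
by apply: leq_trans (leq_card_setU _ _) _; rewrite leq_add2l.
Qed.

Lemma natr_close (R : realType) (m n : nat) : `|m%:R - n%:R : R| < 1 -> m = n.
Proof.
wlog mn : m n / (m <= n)%N => [W|].
  by have [/W|/ltnW nm] := leqP m n; [exact|rewrite distrC => /(W _ _ nm)].
rewrite distrC -natrB // normr_nat ltrn1 ltnS leqn0 subn_eq0 => nm.
by apply/eqP; rewrite eqn_leq mn.
Qed.

(** The vectors to be avoided are distributed among the cells t in T; those of a cell
    are delta-close to each other and have a coordinate l0 t equal to 1.  In an
    r-rowed matrix with entries in {0, .., s - 1} that kills a vector of the cell, the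
    column l0 t is determined by the other columns, so that there are at most
    s^(r #|L|) / s^r of them, and some matrix escapes all cells if #|T| < s^r. *)
Section Counting.
Variables (R : realType) (r s : nat) (L T : finType).
Variables (S : T -> (L -> R) -> Prop) (l0 : T -> L) (delta : R).
Hypothesis s0 : (0 < s)%N.
Hypothesis S1 : forall t z, S t z -> z (l0 t) = 1.
Hypothesis Sd : forall t z z' l, S t z -> S t z' -> `|z l - z' l| <= delta.
Hypothesis sd : (s * #|L|)%:R * delta < 1.
Hypothesis Ts : (#|T| < s ^ r)%N.

Let mat := {ffun 'I_r * L -> 'I_s}.

Let bad (t : T) : {set mat} := [set A : mat |
  `[< exists2 z, S t z & forall a, \sum_l (A (a, l))%:R * z l = 0 >]].

(** Two bad matrices for the same cell that agree outside the column l0 t have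
    columns l0 t at distance less than 1, hence equal, the entries being integers. *)
Let bad_column (t : T) (A B : mat) : A \in bad t -> B \in bad t ->
  (forall a l, l != l0 t -> A (a, l) = B (a, l)) -> A = B.
Proof.
rewrite !finset.in_set => /asboolP[z Sz Az] /asboolP[z' Sz' Bz] AB.
apply/ffunP => -[a l]; have [->|/AB//] := eqVneq l (l0 t).
have E : (A (a, l0 t))%:R - (B (a, l0 t))%:R =
    - \sum_l (B (a, l))%:R * (z l - z' l) :> R.
  have : \sum_l ((A (a, l))%:R * z l - (B (a, l))%:R * z l) =
     - \sum_l (B (a, l))%:R * (z l - z' l).
    under [in RHS]eq_bigr do rewrite mulrBr.
    by rewrite !sumrB Az Bz subr0 sub0r.
  rewrite (bigD1 (l0 t)) //= (S1 Sz) !mulr1 big1 ?addr0 // => i il.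
  by rewrite AB // subrr.
apply/ord_inj/(@natr_close R).
rewrite E normrN; apply: le_lt_trans (ler_norm_sum _ _ _) _.
apply: le_lt_trans sd; rewrite natrM [s%:R * _]mulrC -mulrA.
rewrite [leRHS]mulr_natl -sumr_const; apply: ler_sum => i _.
rewrite normrM ler_pM // ?normr_ge0 ?normr_nat ?ler_nat ?(ltnW (ltn_ord _)) //.
exact: Sd Sz Sz'.
Qed.

(** The map sending (A, v) to A with its column l0 t replaced by v is injective for
    bad A. *)
Let bad_card (t : T) : (#|bad t| * s ^ r <= s ^ (r * #|L|))%N.
Proof.
have -> : (s ^ (r * #|L|))%N = #|[set: mat]%SET|.
  by rewrite cardsT card_ffun card_prod !card_ord.
have -> : (s ^ r)%N = #|[set: {ffun 'I_r -> 'I_s}]%SET| by rewrite cardsT card_ffun !card_ord.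
rewrite -finset.cardsX.
pose f (Av : mat * {ffun 'I_r -> 'I_s}) : mat :=
  [ffun al => if al.2 == l0 t then Av.2 al.1 else Av.1 al].
have fI : {in finset.setX (bad t) [set: {ffun 'I_r -> 'I_s}]%SET &, injective f}.
  move=> [A v] [B u]; rewrite !finset.in_setX !finset.in_setT !andbT /= => bA bB /ffunP E.
  have -> : v = u by apply/ffunP => a; have := E (a, l0 t); rewrite !ffunE /= eqxx.
  congr (_, _); apply: (@bad_column t) => // a l ll0.
  by have := E (a, l); rewrite !ffunE /= (negbTE ll0).
by rewrite -(card_in_imset fI); exact: subset_leq_card (finset.subsetT _).
Qed.

Lemma avoid_cells : exists A : 'I_r -> L -> R,
  forall t z, S t z -> exists a, \sum_l A a l * z l != 0.
Proof.
have [[A AP]|H] := pselect (exists A : mat, forall t, A \notin bad t).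
  exists (fun a l => (A (a, l))%:R) => t z Sz; apply: contrapT => nA.
  have /negP := AP t; apply; rewrite finset.in_set; apply/asboolP; exists z => // a.
  by apply/eqP/negP => /negP Az; apply: nA; exists a.
have cov : [set: mat]%SET \subset (\bigcup_t bad t)%SET.
  apply/fintype.subsetP => A _; apply: contrapT => nA; apply: H; exists A => t.
  by apply/negP => At; apply: nA; apply/finset.bigcupP; exists t.
have := leq_trans (fintype.subset_leq_card cov) (leq_card_bigcup _).
rewrite cardsT card_ffun card_prod !card_ord => le1.
have : (s ^ (r * #|L|) * s ^ r <= #|T| * s ^ (r * #|L|))%N.
  apply: leq_trans (leq_mul le1 (leqnn _)) _.
  rewrite big_distrl /= -sum_nat_const; apply: leq_sum => t _; exact: bad_card.
by rewrite mulnC leq_pmul2r ?expn_gt0 ?s0 // leqNgt Ts.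
Qed.
End Counting.

(** * Immersions into R^p *)
Section Cells.
Variable R : realType.

(** The right end point of the interval belongs to the last cell. *)
Lemma interval_cells (a b : R) (m : nat) : a < b -> exists cell : R -> 'I_m.+1,
  forall x y, a <= x <= b -> a <= y <= b -> cell x = cell y ->
    `|x - y| <= (b - a) / m.+1%:R.
Proof.
move=> ab; pose t (x : R) := (x - a) / (b - a) * m.+1%:R.
exists (fun x => inord (minn (Num.truncn (t x)) m)) => x y.
have ba : 0 < b - a by rewrite subr_gt0.
have m0 : 0 < m.+1%:R :> R by rewrite ltr0n.
have tP z : a <= z <= b -> exists2 k : nat, k = minn (Num.truncn (t z)) m &
    k%:R <= t z <= k%:R + 1.
  move=> /andP[az zb]; have t0 : 0 <= t z.
    by rewrite mulr_ge0 ?ler0n // divr_ge0 ?subr_ge0 // ltW.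
  have t1 : t z <= m.+1%:R.
    by rewrite ler_piMl ?ler0n // ler_pdivrMr // mul1r lerB.
  exists (minn (Num.truncn (t z)) m) => //; have /andP[l1 l2] := truncn_itv t0.
  rewrite /minn; case: ltnP => tm; first by rewrite l1 natr1 ltW.
  by rewrite natr1 t1 andbT; apply: le_trans l1; rewrite ler_nat.
move=> /tP[k kE kx] /tP[k' k'E ky]; rewrite -kE -k'E => /(congr1 val) /=.
rewrite !inordK ?ltnS ?kE ?k'E ?geq_minr // -kE -k'E => kk; rewrite -kk in ky.
have : `|t x - t y| <= 1 by rewrite ler_norml; move: kx ky; lra.
rewrite /t -mulrBl -mulrBl opprB addrA subrK normrM (ger0_norm (ltW m0)).
rewrite normrM (@ger0_norm _ (b - a)^-1) ?invr_ge0 ?(ltW ba) //.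
by rewrite -ler_pdivlMr // ler_pdivrMr // mul1r mulrC.
Qed.

Lemma cbox_cells n (p : 'rV[R]_n) (rad : R) (m : nat) : 0 < rad ->
  exists cell : 'rV[R]_n -> {ffun 'I_n -> 'I_m.+1},
  forall x y, cbox p rad x -> cbox p rad y -> cell x = cell y ->
    forall j, `|x 0 j - y 0 j| <= 2 * rad / m.+1%:R.
Proof.
move=> rad0; have /choice[cell cellP] := fun j : 'I_n => @interval_cells (p 0 j - rad) (p 0 j + rad) m
  (ltac:(lra)).
exists (fun x => [ffun j => cell j (x 0 j)]) => x y px py /ffunP E j.
have := cellP j (x 0 j) (y 0 j); rewrite -!ler_distl => /(_ (px j) (py j)).
have := E j; rewrite !ffunE => -> /(_ erefl).
by rewrite opprD addrACA subrr add0r opprK mulr_natl.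
Qed.

Lemma smooth_on_lip n (U : set 'rV[R]_n) F p (rad : R) : smooth_on U F ->
  cbox p rad `<=` U -> exists2 C : R, 0 <= C &
  (forall x, cbox p rad x -> `|F x| <= C) /\
  (forall x y (e : R), 0 <= e -> cbox p rad x -> cbox p rad y ->
     (forall j, `|x 0 j - y 0 j| <= e) -> `|F x - F y| <= C * e).
Proof.
move=> sF pU.
have bd G : smooth_on U G -> exists2 C : R, 0 <= C & forall x, cbox p rad x -> `|G x| <= C.
  move=> sG; apply: compact_bounded_fun; first exact: cbox_compact.
  by move=> x /pU; exact: smooth_on_continuous.
have [C0 C00 C0P] := bd F sF.
have /choice[C CP] : forall j, exists C : R, 0 <= C /\
    forall x, cbox p rad x -> `|'D_(evec R j) F x| <= C.
  by move=> j; have [C c0 CP] := bd _ (smooth_on_derive j sF); exists C.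
exists (C0 + \sum_j C j); first by rewrite addr_ge0 // sumr_ge0 // => j _; case: (CP j).
split=> [x px|x y e e0 px py xy].
  by apply: le_trans (C0P x px) _; rewrite lerDl sumr_ge0 // => j _; case: (CP j).
have bp z : box y x z -> cbox p rad z.
  move=> bz j; have := bz j; have := px j; have := py j.
  rewrite !ler_distl /btw => /andP[y1 y2] /andP[x1 x2] /andP[z1 z2]; apply/andP; split.
    by apply: le_trans z1; rewrite le_min y1.
  by apply: (le_trans z2); rewrite ge_max y2.
have [z /bp /pU Uz j|xi [bxi ->]] := @box_mvt R n F y x.
  exact: smooth_on_derivable Uz.
rewrite mulrDl; apply: ler_wpDl; first by rewrite mulr_ge0.
rewrite mulr_suml; apply: le_trans (ler_norm_sum _ _ _) _; apply: ler_sum => j _.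
rewrite normrM mulrC; apply: ler_pM => //; exact: (CP j).2 (bp _ (bxi j)).
Qed.
End Cells.

Section Immersive.
Variables (R : realType) (M : manifold R).
Local Notation n := (Defs.dim M).

(** The differentials of the h_a at x span the cotangent space, expressed dually:
    no nonzero tangent vector w is killed by all of them. *)
Definition immersive_at r (h : 'I_r -> M -> R) (x : M) : Prop :=
  forall c, atlas c -> chart_dom c x -> forall w : 'rV[R]_n, w != 0 ->
    exists a, w *m grad c (h a) x != 0.

(** A change of chart acts on tangent vectors by an invertible matrix. *)
Lemma immersive_chart r (h : 'I_r -> M -> R) c x :
  (forall a, smooth (h a)) -> atlas c -> chart_dom c x ->
  (forall w : 'rV[R]_n, w != 0 -> exists a, w *m grad c (h a) x != 0) ->
  immersive_at h x.
Proof.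
move=> sh Ac cx H c' Ac' c'x w w0.
have [T Tu TP] := grad_change_unit Ac Ac' cx c'x.
have [|a ha] := H (w *m T).
  apply: contraNneq w0 => wT0; by rewrite -(mulmxK Tu w) wT0 mul0mx.
by exists a; rewrite TP // mulmxA.
Qed.

Lemma mul_grad c f x (w : 'rV[R]_n) :
  (w *m grad c f x) 0 0 = \sum_j w 0 j * 'D_(evec R j) (f \o chart_inv c) (c x).
Proof. by rewrite mxE; apply: eq_bigr => j _; rewrite mxE. Qed.

Lemma grad_sum c x (I : finType) (F : I -> M -> R) (a : I -> R) :
  (forall i, C1_at (F i \o chart_inv c) (c x)) ->
  grad c (fun y => \sum_i a i * F i y) x = \sum_i a i *: grad c (F i) x.
Proof.
move=> CF; apply/matrixP => j k; rewrite mxE summxE.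
have dF i : derivable (F i \o chart_inv c) (c x) (evec R j).
  exact: nbhs_singleton (CF i j).1.
rewrite (_ : (fun y => _) \o _ = \sum_i (a i \*: (F i \o chart_inv c))); last first.
  by apply/funext => u; rewrite fct_sumE.
have D (r : seq I) : is_derive (c x) (evec R j) (\sum_(i <- r) (a i \*: (F i \o chart_inv c)))
   (\sum_(i <- r) a i *: 'D_(evec R j) (F i \o chart_inv c) (c x)).
  elim: r => [|i r IHr]; first by rewrite !big_nil; exact: is_derive_cst.
  rewrite !big_cons; apply: is_deriveD => //.
  by apply: is_deriveZ; exact: derivableP.
rewrite (@derive_val _ _ _ _ _ _ _ (D _)); apply: eq_bigr => i _.
by rewrite !mxE.
Qed.

(** Cover K by cubes of finitely many charts, and let Phi be the family of all their
    bumped coordinates.  In the chart k, the derivative of Phi along w contains w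
    among its coordinates, so that after scaling w one of them, of index (k, j), is 1.
    These derivatives are Lipschitz in the point and in w; dividing the cube of the
    points and that of the w into m^n cells each makes about m^(2n) cells of diameter
    O(1/m).  Take r = 2n + 1 rows and m a fixed multiple of the bound s of the entries:
    for large s the cells number less than s^r, and [avoid_cells] applies. *)
Lemma compact_immersion (K : set M) : compact K ->
  exists h : 'I_(2 * n).+1 -> M -> R, (forall a, smooth (h a)) /\
    forall x, K x -> immersive_at h x.
Proof.
move=> cK.
have /choice[cr crP] : forall x : M, exists cr : chart R n M * R,
    [/\ atlas cr.1, chart_dom cr.1 x, 0 < cr.2 & cbox (cr.1 x) (2 * cr.2) `<=` chart_im cr.1].
  move=> x; have [c Ac cx] := atlas_cover x; have [r r0 rc] := cbox_chart_im cx.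
  by exists (c, r).
pose O x := [set y | chart_dom (cr x).1 y /\ ball ((cr x).1 x) (cr x).2 ((cr x).1 y)].
have [||t tP] := @compact_subcover M K O cK.
- by move=> x; apply: chart_preim_open; exact: ball_open.
- by move=> x; have [_ cx r0 _] := crP x; split=> //; exact: ballxx.
pose q := size t.
have [x0|/negP] := pselect (0 < q)%N; last first.
  rewrite -leqNgt leqn0 size_eq0 => /eqP t0.
  exists (fun _ _ => 0); split=> [a|x Kx]; first exact: smooth_cst.
  by have [y] := tP x Kx; rewrite t0.
have x0' : M by move: x0; rewrite /q; case: (t) => [|y s] //= _; exact: y.
pose pt (k : 'I_q) := nth x0' t k; pose ch k := (cr (pt k)).1; pose rd k := (cr (pt k)).2.
pose ce k := ch k (pt k).
have chP k : [/\ atlas (ch k), chart_dom (ch k) (pt k), 0 < rd k &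
   cbox (ce k) (2 * rd k) `<=` chart_im (ch k)] := crP (pt k).
have cb k : cbox (ce k) (rd k) `<=` chart_im (ch k).
  have [_ _ r0 rc] := chP k; apply: subset_trans rc => u H j.
  by apply: le_trans (H j) _; have r0' : 0 < rd k := r0; lra.
pose L : finType := ('I_q * 'I_n)%type.
pose Phi (l : L) : M -> R := bump_ext (ch l.1) (ce l.1) (rd l.1) (fun u => u 0 l.2).
have sPhi l : smooth (Phi l).
  by have [Ac cx r0 rc] := chP l.1; apply: bump_ext_smooth => //; exact: smooth_on_coord.
pose dPhi k (u w : 'rV[R]_n) (l : L) : R :=
  \sum_j w 0 j * 'D_(evec R j) (Phi l \o chart_inv (ch k)) u.
pose one : set 'rV[R]_n := cbox 0 1.
have lip k l : exists Lam : R, 0 <= Lam /\ forall u u' w w' (e : R), 0 <= e ->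
    cbox (ce k) (rd k) u -> cbox (ce k) (rd k) u' -> one w -> one w' ->
    (forall j, `|u 0 j - u' 0 j| <= e) -> (forall j, `|w 0 j - w' 0 j| <= e) ->
    `|dPhi k u w l - dPhi k u' w' l| <= Lam * e.
  have [Ac cx r0 rc] := chP k.
  pose F j (v : 'rV[R]_n) : R := 'D_(evec R j) (Phi l \o chart_inv (ch k)) v.
  have /choice[C CP] : forall j, exists C : R, [/\ 0 <= C,
      (forall x, cbox (ce k) (rd k) x -> `|F j x| <= C) &
      forall x y (e : R), 0 <= e -> cbox (ce k) (rd k) x -> cbox (ce k) (rd k) y ->
        (forall i, `|x 0 i - y 0 i| <= e) -> `|F j x - F j y| <= C * e].
    move=> j; have sF := smooth_on_derive j (sPhi l (ch k) Ac).
    by have [C C0 [Cb Cl]] := @smooth_on_lip R n _ (F j) (ce k) (rd k) sF (@cb k); exists C.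
  exists (\sum_j 2 * C j); split.
    by apply: sumr_ge0 => j _; rewrite mulr_ge0 //; case: (CP j).
  move=> u u' w w' e e0 cu cu' ow ow' uu ww; rewrite /dPhi -sumrB mulr_suml.
  apply: le_trans (ler_norm_sum _ _ _) _; apply: ler_sum => j _.
  have [C0 Cb Cl] := CP j; rewrite -/(F j u) -/(F j u').
  have -> : w 0 j * F j u - w' 0 j * F j u' =
      (w 0 j - w' 0 j) * F j u + w' 0 j * (F j u - F j u').
    by rewrite mulrBl mulrBr addrA subrK.
  apply: le_trans (ler_normD _ _) _; rewrite !normrM.
  have -> : 2 * C j * e = e * C j + 1 * (C j * e) by ring.
  apply: lerD; first by apply: ler_pM => //; exact: Cb.
  apply: ler_pM => //; last exact: Cl.
  by have := ow' j; rewrite mxE subr0.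
have /choice[Lam LamP] : forall kl : 'I_q * L, exists Lam : R, 0 <= Lam /\
    forall u u' w w' (e : R), 0 <= e ->
    cbox (ce kl.1) (rd kl.1) u -> cbox (ce kl.1) (rd kl.1) u' -> one w -> one w' ->
    (forall j, `|u 0 j - u' 0 j| <= e) -> (forall j, `|w 0 j - w' 0 j| <= e) ->
    `|dPhi kl.1 u w kl.2 - dPhi kl.1 u' w' kl.2| <= Lam * e by move=> [k l]; exact: lip.
pose LAM := \sum_kl Lam kl; pose rho0 : R := 1 + \sum_k rd k.
have LAM0 : 0 <= LAM by apply: sumr_ge0 => kl _; case: (LamP kl).
have rd0 k : 0 < rd k by case: (chP k).
have rho1 : 1 <= rho0 by rewrite lerDl sumr_ge0 // => k _; exact: ltW.
have rdrho k : rd k <= rho0.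
  rewrite /rho0 (bigD1 k) //= addrCA lerDl addr_ge0 ?sumr_ge0 // => i _; exact: ltW.
(* The number m = s N of subdivisions makes the cells small with respect to 1/s; then
   the number of cells is q n N^(2n) s^(2n), and s is the first value exceeding
   the constant. *)
pose N := (Num.bound (#|L|%:R * LAM * (2 * rho0))).+1.
have NP : #|L|%:R * LAM * (2 * rho0) < N%:R.
  apply: lt_trans (archi_boundP _) _; last by rewrite ltr_nat.
  by rewrite !mulr_ge0 // (le_trans ler01).
pose s := (q * n * N ^ n * N ^ n).+1.
pose m := (s * N).-1.
have mE : m.+1 = (s * N)%N by [].
have /choice[cx cxP] := fun k => @cbox_cells R n (ce k) (rd k) m (rd0 k).
have [cw cwP] := @cbox_cells R n 0 1 m ltr01.
pose T : finType := (('I_q * 'I_n) * ({ffun 'I_n -> 'I_m.+1} * {ffun 'I_n -> 'I_m.+1}))%type.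
pose S (t : T) (z : L -> R) := exists u w, [/\ ball (ce t.1.1) (rd t.1.1) u, one w,
  w 0 t.1.2 = 1, (cx t.1.1 u, cw w) = t.2 & z = dPhi t.1.1 u w].
pose e : R := 2 * rho0 / m.+1%:R.
have e0 : 0 <= e by rewrite divr_ge0 // mulr_ge0 // (le_trans ler01).
have cball k u : ball (ce k) (rd k) u -> cbox (ce k) (rd k) u.
  by move=> [_ H] j; have := H 0 j; rewrite /ball /= distrC => /ltW.
have S1 tau z : S tau z -> z tau.1 = 1.
  case: tau => -[k j] ? [u [w [/= bu ow wj _ ->]]]; rewrite /dPhi /=.
  have E : \forall v \near u, (fun v' : 'rV[R]_n => v' 0 j) v =
      (Phi (k, j) \o chart_inv (ch k)) v.
    have : nbhs u (chart_im (ch k) `&` ball (ce k) (rd k)).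
      apply: open_nbhs_nbhs; split; first by apply: openI; [exact: chart_im_open|exact: ball_open].
      by split=> //; exact: cb (cball _ _ bu).
    apply: (@filterS _ _ (nbhs_filter _)) => v [cv bv] /=.
    rewrite /Phi /= bump_extE; last exact: chart_inv_dom.
    rewrite chart_invK // cbump1 ?mul1r //; exact: cball _ _ bv.
  rewrite (bigD1 j) //= big1 ?addr0 => [|i ij]; rewrite -(near_eq_derive _ E).
    by have [_ ->] := is_derive_coord u (evec R j) j; rewrite mxE !eqxx wj mulr1.
  have [_ ->] := is_derive_coord u (evec R i) j.
  by rewrite mxE eqxx /= eq_sym (negbTE ij) mulr0.
have Sd tau z z' l : S tau z -> S tau z' -> `|z l - z' l| <= LAM * e.
  case: tau => -[k j] xw [u [w [/= bu ow wj cE ->]]] [u' [w' [/= bu' ow' wj' cE' ->]]].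
  have [L0 /(_ u u' w w' e e0)] := LamP (k, l).
  move=> /(_ (cball _ _ bu) (cball _ _ bu') ow ow') H.
  have [cE1 cE2] : cx k u = cx k u' /\ cw w = cw w'.
    by move: cE cE' => <- [-> ->].
  apply: le_trans (H _ _) _ => [j'|j'|].
  - apply: le_trans (cxP k u u' (cball _ _ bu) (cball _ _ bu') cE1 j') _.
    by rewrite ler_pM2r ?invr_gt0 ?ltr0n // ler_pM2l.
  - apply: le_trans (cwP w w' ow ow' cE2 j') _.
    by rewrite ler_pM2r ?invr_gt0 ?ltr0n // ler_pM2l.
  - rewrite ler_wpM2r // /LAM (bigD1 (k, l)) //= lerDl sumr_ge0 // => i _.
    by case: (LamP i).
have sd : (s * #|L|)%:R * (LAM * e) < 1.
  rewrite /e mE !natrM.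
  have s0 : 0 < s%:R :> R by rewrite ltr0n.
  have N0 : 0 < N%:R :> R by rewrite ltr0n.
  have -> : s%:R * #|L|%:R * (LAM * (2 * rho0 / (s%:R * N%:R))) =
     (#|L|%:R * LAM * (2 * rho0)) / N%:R.
    by field; rewrite !gt_eqF.
  by rewrite ltr_pdivrMr // mul1r.
have Ts : (#|{: T}| < s ^ (2 * n).+1)%N.
  rewrite !card_prod !card_ffun !card_ord mE !expnMn expnS mul2n -addnn expnD.
  have -> : (q * n * (s ^ n * N ^ n * (s ^ n * N ^ n)) =
     (q * n * N ^ n * N ^ n) * (s ^ n * s ^ n))%N.
    by move: (s ^ n)%N (N ^ n)%N => a b; ring.
  by rewrite ltn_pmul2r // muln_gt0 expn_gt0.
have [A AP] := @avoid_cells R (2 * n).+1 s _ _ S (fun t => t.1) _ (ltn0Sn _) S1 Sd sd Ts.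
pose h a x := \sum_l A a l * Phi l x.
exists h; split=> [a|x Kx].
  by apply: smooth_sum => l _; apply: smoothM => //; exact: smooth_cst.
have [y yt [cy bx]] := tP x Kx.
have yk : (index y t < q)%N by rewrite index_mem.
pose k : 'I_q := Ordinal yk; have yE : pt k = y by rewrite /pt nth_index.
have [Ack _ _ _] := chP k.
have chx : chart_dom (ch k) x by rewrite /ch yE.
have bkx : ball (ce k) (rd k) (ch k x) by rewrite /ce /rd /ch yE.
have sh a : smooth (h a).
  by apply: smooth_sum => l _; apply: smoothM => //; exact: smooth_cst.
apply: (immersive_chart sh Ack chx) => w w0.
have [i0 wi0] : exists i, w 0 i != 0.
  apply: contrapT => nw; move/eqP: w0; apply; apply/rowP => i; rewrite mxE.
  by apply/eqP/negP => /negP wi; apply: nw; exists i.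
(* A largest coordinate, by which w is divided to reach the unit cube. *)
have [j wj wmax] : exists2 j, w 0 j != 0 & forall i, `|w 0 i| <= `|w 0 j|.
  case: (@arg_maxP _ _ _ i0 predT (fun i => `|w 0 i|) isT) => j _ jmax.
  exists j; last by move=> i; exact: jmax.
  by rewrite -normr_gt0; apply: lt_le_trans (jmax i0 isT); rewrite normr_gt0.
pose w' := (w 0 j)^-1 *: w.
have w'j : w' 0 j = 1 by rewrite mxE mulVf.
have ow' : one w'.
  move=> i; rewrite !mxE subr0 normrM normfV mulrC ler_pdivrMr ?normr_gt0 //.
  by rewrite mul1r.
have Sx : S ((k, j), (cx k (ch k x), cw w')) (dPhi k (ch k x) w').
  by exists (ch k x), w'.
have [a ha] := AP _ _ Sx; exists a; apply: contraNneq ha => ha0.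
have := congr1 (fun B : 'M[R]_1 => B 0 0) ha0; rewrite /h grad_sum; last first.
  by move=> l; exact: smooth_C1.
rewrite mulmx_sumr summxE mxE => E.
have : w 0 j * (\sum_l A a l * dPhi k (ch k x) w' l) = 0.
  rewrite mulr_sumr -[RHS]E; apply: eq_bigr => l _.
  rewrite -scalemxAr mxE mulrCA; congr (_ * _).
  rewrite mul_grad /dPhi mulr_sumr; apply: eq_bigr => i _.
  by rewrite mxE mulrA mulVKf.
by move/eqP; rewrite mulf_eq0 (negbTE wj) => /eqP ->.
Qed.
End Immersive.

Section GlobalImmersion.
Variables (R : realType) (M : manifold R).

(** The constants leave a margin on both sides: 3/5 < 13/20 makes the window equal to 1
    near a layer, and 9/10 < 1 keeps the windows of a parity class apart. *)
Definition window (t : R) : R := sstep ((81 / 100 - t ^+ 2) / (36 / 100)).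

Lemma window1 t : `|t| <= 13 / 20 -> window t = 1.
Proof.
move=> t1; apply: sstep1; rewrite ler_pdivlMr // mul1r.
have : `|t| ^+ 2 <= (13 / 20) ^+ 2 by rewrite lerXn2r ?nnegrE.
rewrite real_normK ?num_real //; lra.
Qed.

Lemma window0 t : 9 / 10 <= `|t| -> window t = 0.
Proof.
move=> t1; apply: sstep0; rewrite pmulr_lle0 // subr_le0.
have : (9 / 10) ^+ 2 <= `|t| ^+ 2 by rewrite lerXn2r ?nnegrE.
rewrite real_normK ?num_real //; lra.
Qed.

Lemma smooth1_window : smooth1 window.
Proof.
apply: (smooth1_comp openT (smooth1_sstep R)).
apply: smooth_onM; [exact: openT| |exact: smooth_on_cst].
apply: smooth_onB; [exact: openT|exact: smooth_on_cst|].
by apply: smooth_onM; [exact: openT|exact: smooth_on_coord|exact: smooth_on_coord].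
Qed.

(** The layer k is |rho - k| <= 3/5, with an immersion h k.  For each parity e, a point
    is at distance less than 1 from at most one integer of parity e, and G e is there
    the corresponding h k, multiplied by a window in rho. *)
Lemma global_immersion : exists p (g : 'I_p -> M -> R),
  (forall i, smooth (g i)) /\ forall x, immersive_at g x.
Proof.
have [rho [srho rho0 rhoP]] := proper_fun M.
have crho := smooth_continuous srho.
pose r := (2 * Defs.dim M).+1.
pose lay (k : nat) : set M := [set x | `|rho x - k%:R| <= 3 / 5].
have clay k : compact (lay k).
  have [C cC CP] := rhoP (k%:R + 1).
  apply: (@subclosed_compact _ _ C) => //.
    rewrite (_ : lay k = (fun x => `|rho x - k%:R|) @^-1` [set t | t <= 3 / 5]) //.
    apply: closed_comp; last exact: closed_le.
    move=> x _; apply: cvg_norm; apply: cvgB; [exact: crho|exact: cvg_cst].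
  by move=> x; rewrite /lay /= ler_norml => /andP[_ H]; apply: CP; lra.
have /choice[h hP] := fun k => compact_immersion (clay k).
have sh k a : smooth (h k a) by case: (hP k).
pose cen (e : bool) (m : nat) : nat := (e + m.*2)%N.
have cen_uniq e m m' (t : R) : `|t - (cen e m)%:R| < 1 -> `|t - (cen e m')%:R| < 1 -> m = m'.
  move=> t1 t2; apply: (@natr_close R).
  have E k : (cen e k)%:R = e%:R + 2 * k%:R :> R by rewrite natrD -mul2n natrM.
  by move: t1 t2; rewrite !E !ltr_norml; lra.
(* The default value 0 is harmless: far from all integers of the parity e, every
   window vanishes. *)
pose kap e x : nat := xget 0%N [set m | `|rho x - (cen e m)%:R| < 1].
have kapE e x m : `|rho x - (cen e m)%:R| < 1 -> kap e x = m.
  move=> H; have H1 := H; apply: cen_uniq H1.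
  exact: (@xgetPex _ 0%N [set m | `|rho x - (cen e m)%:R| < 1] (ex_intro _ m H)).
pose G e a x := window (rho x - (cen e (kap e x))%:R) * h (cen e (kap e x)) a x.
have nearr x (e : R) : 0 < e -> \forall y \near x, `|rho x - rho y| < e.
  by move=> e0; have /cvgrPdist_lt := crho x; exact.
have sG e a : smooth (G e a).
  apply: smooth_near => x.
  have [[m mx]|nm] := pselect (exists m, `|rho x - (cen e m)%:R| < 1).
    exists (fun y => window (rho y - (cen e m)%:R) * h (cen e m) a y); split.
      apply: smoothM => //; apply: (@smooth_comp1 _ _ (fun y => rho y - (cen e m)%:R)).
        exact: smooth1_window.
      apply: smoothB => //; exact: smooth_cst.
    have d0 : 0 < 1 - `|rho x - (cen e m)%:R| by rewrite subr_gt0.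
    apply: filterS (nearr x _ d0) => y xy; rewrite /G (@kapE e y m) //.
    rewrite (_ : rho y - _ = (rho x - (cen e m)%:R) - (rho x - rho y)); last by ring.
    by apply: le_lt_trans (ler_normB _ _) _; lra.
  exists (fun=> 0); split; first exact: smooth_cst.
  have d0 : 0 < 1 / 10 :> R by rewrite divr_gt0.
  apply: filterS (nearr x _ d0) => y xy; rewrite /G window0 ?mul0r //.
  have : 1 <= `|rho x - (cen e (kap e y))%:R|.
    by rewrite leNgt; apply/negP => H; apply: nm; exists (kap e y).
  rewrite (_ : rho x - (cen e (kap e y))%:R =
    (rho y - (cen e (kap e y))%:R) + (rho x - rho y)); last by ring.
  by have := ler_normD (rho y - (cen e (kap e y))%:R) (rho x - rho y); lra.
have Gh e m a x : lay (cen e m) x -> \near x, h (cen e m) a x = G e a x.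
  rewrite /lay /= => mx; have d0 : 0 < 1 / 20 :> R by rewrite divr_gt0.
  apply: filterS (nearr x _ d0) => y xy.
  have ym : `|rho y - (cen e m)%:R| <= 13 / 20.
    rewrite (_ : rho y - _ = (rho x - (cen e m)%:R) - (rho x - rho y)); last by ring.
    by apply: le_trans (ler_normB _ _) _; lra.
  rewrite /G (@kapE e y m); last by apply: le_lt_trans ym _; lra.
  by rewrite window1 ?mul1r.
exists (r + r)%N, (fun i => match fintype.split i with inl a => G false a | inr a => G true a end).
split=> [i|x]; first by case: (fintype.split i) => a; exact: sG.
pose k := Num.truncn (rho x + 1 / 2).
have kx : lay k x.
  have /truncn_itv/andP[] : 0 <= rho x + 1 / 2 by rewrite addr_ge0 // divr_ge0.
  rewrite -/k (_ : k.+1%:R = k%:R + 1 :> R) ?natr1 // /lay /= ler_norml => h1 h2.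
  by apply/andP; split; lra.
have kE : k = cen (odd k) k./2 by rewrite /cen odd_double_half.
have [_ imm] := hP k; move=> c Ac cx w w0; have [a ha] := imm x kx c Ac cx w w0.
rewrite kE in kx; have E := Gh (odd k) k./2 a x kx; rewrite -kE in E.
exists (if odd k then rshift r a else lshift r a).
rewrite (near_grad cx E) in ha.
case: (odd k) ha => ha.
  by rewrite -[rshift r a]/(unsplit (inr a)) unsplitK.
by rewrite -[lshift r a]/(unsplit (inl a)) unsplitK.
Qed.

End GlobalImmersion.

(** * Functions flat at a point *)
Section Cotangent.
Variables (R : realType) (M : manifold R).
Local Notation n := (Defs.dim M).

Definition Cinf_of (f : M -> R) (sf : smooth f) : Cinf M :=
  MkCinf (introT (asboolP _) sf : f \in @smooth_pred R M).

Lemma Cinf_ext (f g : Cinf M) : (forall x, ev x f = ev x g) -> f = g.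
Proof. by move=> fg; apply: val_inj; apply/funext => x; exact: fg. Qed.

Lemma evD x (f g : Cinf M) : ev x (f + g) = ev x f + ev x g.
Proof. exact: rmorphD. Qed.
Lemma evM x (f g : Cinf M) : ev x (f * g) = ev x f * ev x g.
Proof. exact: rmorphM. Qed.
Lemma evB x (f g : Cinf M) : ev x (f - g) = ev x f - ev x g.
Proof. exact: rmorphB. Qed.
Lemma ev_sum x I (r : seq I) (F : I -> Cinf M) :
  ev x (\sum_(i <- r) F i) = \sum_(i <- r) ev x (F i).
Proof. exact: rmorph_sum. Qed.
Lemma evS x (k : R) : ev x (scal k : Cinf M) = k. Proof. by []. Qed.
Lemma ev1 x : ev x (1 : Cinf M) = 1. Proof. exact: rmorph1. Qed.

(** Let b be a bump at x, equal to 1 near x.  Then f (1 - b^3) is a product of two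
    functions vanishing at x.  In the chart, b f extends by 0 to R^n and has a Hadamard
    decomposition sum_j (u_j - p_j) G_j, where G_j vanishes at p because the gradient
    does; the two remaining factors b carry the u_j - p_j and the G_j back to M. *)
Lemma flat_mu2 (f : Cinf M) (x : M) c : atlas c -> chart_dom c x -> f x = 0 ->
  grad c f x = 0 ->
  exists2 s : seq (Cinf M * Cinf M), (forall q, q \in s -> ev x q.1 = 0 /\ ev x q.2 = 0) &
    f = \sum_(q <- s) q.1 * q.2.
Proof.
move=> Ac cx fx0 gf0; have [r r0 rc] := cbox_chart_im cx; set p := c x.
pose b := cbump p r.
pose F (u : 'rV[R]_n) : R := if asbool (chart_im c u) then b u * f (chart_inv c u) else 0.
have FE u : chart_im c u -> F u = b u * f (chart_inv c u) by move=> cu; rewrite /F asboolT.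
have ocb : open (~` cbox p (2 * r)).
  apply: closed_openC; apply: (compact_closed _ (@cbox_compact R n p (2 * r))).
  exact: norm_hausdorff.
have sF : smooth_on setT F.
  apply: smooth_on_loc => u _; have [cu|cu] := pselect (chart_im c u).
    exists (chart_im c), (b * (f \o chart_inv c)); split=> //; first exact: chart_im_open.
      apply: smooth_onM; [exact: chart_im_open| |exact: (CinfP f Ac)].
      by apply: cbump_smooth; exact: chart_im_open.
    by move=> v cv; rewrite FE.
  exists (~` cbox p (2 * r)), (cst 0); split=> //; first by move/rc.
    exact: smooth_on_cst.
  move=> v nv; have [cv|cv] := pselect (chart_im c v); last by rewrite /F asboolF.
  rewrite FE //; suff -> : b v = 0 by rewrite mul0r.
  apply/eqP/negP => /negP /(cbump_supp r0) H; apply: nv => j; exact/ltW/H.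
have Fnear : \forall u \near p, F u = (f \o chart_inv c) u.
  have : nbhs p (chart_im c `&` ball p r).
    apply: open_nbhs_nbhs; split; first by apply: openI; [exact: chart_im_open|exact: ball_open].
    by split; [exact: chart_im_map|exact: ballxx].
  apply: (@filterS _ _ (nbhs_filter _)) => u [cu [_ bu]]; rewrite FE //= /b cbump1 ?mul1r //.
  by move=> j; have := bu 0 j; rewrite /ball /= distrC => /ltW.
pose G j := ray_avg p 0 (fun y => 'D_(evec R j) F y).
have sG j : smooth_on setT (G j) by apply: ray_avg_smooth; exact: smooth_on_derive.
have G0 j : G j p = 0.
  rewrite /G ray_avg0 (near_eq_derive _ Fnear).
  by have := congr1 (fun A : 'cV[R]_n => A j 0) gf0; rewrite !mxE.
have FG u : F u = \sum_j (u 0 j - p 0 j) * G j u.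
  rewrite -(hadamard p sF) [F p]FE; last exact: chart_im_map.
  by rewrite /p chart_mapK // fx0 mulr0 subr0.
have sub_T (H : 'rV[R]_n -> R) : smooth_on setT H -> smooth_on (chart_im c) H.
  exact: smooth_on_sub.
have sx j : smooth_on (chart_im c) (fun u => u 0 j - p 0 j).
  by apply: smooth_onB; [exact: chart_im_open|exact: smooth_on_coord|exact: smooth_on_cst].
pose beta := Cinf_of (bump_ext_smooth Ac r0 rc (smooth_on_cst (chart_im c) 1)).
pose P j := Cinf_of (bump_ext_smooth Ac r0 rc (sx j)).
pose Q j := Cinf_of (bump_ext_smooth Ac r0 rc (sub_T _ (sG j))).
exists ((f, 1 - beta * beta * beta) :: [seq (P j, Q j) | j <- index_enum 'I_n]).
  move=> q; rewrite inE => /orP[/eqP ->|/mapP[j _ ->]].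
    split=> //; change (ev x (1 - beta * beta * beta) = 0); rewrite evB !evM ev1.
    have -> : ev x beta = 1.
      have -> : ev x beta = bump_ext c p r (fun=> 1) x by [].
      by rewrite bump_extE // cbump1 ?mulr1 // => j; rewrite subrr normr0 ltW.
    by rewrite !mulr1 subrr.
  have evP : ev x (P j) = bump_ext c p r (fun u => u 0 j - p 0 j) x by [].
  have evQ : ev x (Q j) = bump_ext c p r (G j) x by [].
  change (ev x (P j) = 0 /\ ev x (Q j) = 0); rewrite evP evQ !bump_extE //.
  by rewrite G0 subrr !mulr0.
apply: Cinf_ext => y; rewrite big_cons big_map evD evM ev_sum evB !evM ev1.
rewrite mulrBr mulr1 -[LHS]addr0 -addrA; congr (_ + _); apply/esym/eqP.
rewrite addrC subr_eq0; apply/eqP.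
have bE : ev y beta = bump_ext c p r (fun=> 1) y by [].
have [cy|cy] := pselect (chart_dom c y); last first.
  rewrite bE bump_ext_out // !mulr0 big1 // => j _.
  rewrite evM (_ : ev y (P j) = bump_ext c p r (fun u => u 0 j - p 0 j) y) //.
  by rewrite bump_ext_out // mul0r.
have -> : ev y f * (ev y beta * ev y beta * ev y beta) = b (c y) * b (c y) * F (c y).
  rewrite bE bump_extE // FE; last exact: chart_im_map.
  by rewrite chart_mapK // mulr1 -/b -[f y]/(ev y f); ring.
rewrite FG mulr_sumr; apply: eq_bigr => j _.
rewrite evM (_ : ev y (P j) = bump_ext c p r (fun u => u 0 j - p 0 j) y) //.
rewrite (_ : ev y (Q j) = bump_ext c p r (G j) y) // !bump_extE // -/b.
by ring.
Qed.

End Cotangent.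

(** * The vector fields of an immersion *)
Section SmoothMx.
Variables (R : realType) (n : nat) (U : set 'rV[R]_n).
Hypothesis oU : open U.

Definition smooth_mx a b (A : 'rV[R]_n -> 'M[R]_(a, b)) : Prop :=
  forall i j, smooth_on U (fun u => A u i j).

Lemma smooth_mulmx a b d (A : 'rV[R]_n -> 'M[R]_(a, b)) (B : 'rV[R]_n -> 'M[R]_(b, d)) :
  smooth_mx A -> smooth_mx B -> smooth_mx (fun u => A u *m B u).
Proof.
move=> sA sB i j; rewrite (_ : (fun u => _) = (fun u => \sum_k A u i k * B u k j)).
  by apply: smooth_on_sum => // k _; apply: smooth_onM.
by apply/funext => u; rewrite mxE.
Qed.

Lemma smooth_trmx a b (A : 'rV[R]_n -> 'M[R]_(a, b)) :
  smooth_mx A -> smooth_mx (fun u => (A u)^T).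
Proof.
move=> sA i j; rewrite (_ : (fun u => _) = (fun u => A u j i)) //.
by apply/funext => u; rewrite mxE.
Qed.

Lemma smooth_det a (A : 'rV[R]_n -> 'M[R]_a) :
  smooth_mx A -> smooth_on U (fun u => \det (A u)).
Proof.
move=> sA; apply: smooth_on_sum => // s _; apply: smooth_onM => //; first exact: smooth_on_cst.
by apply: smooth_on_prod => // i _; exact: sA.
Qed.

Lemma smooth_invmx a (A : 'rV[R]_n -> 'M[R]_a) :
  smooth_mx A -> (forall u, U u -> A u \in unitmx) -> smooth_mx (fun u => invmx (A u)).
Proof.
move=> sA uA i j; pose B u := (\det (A u))^-1 * \adj (A u) i j.
apply: (@smooth_on_ext _ _ _ B) => // [u Uu|].
  by rewrite /B /invmx uA // [RHS]mxE.
apply: smooth_onM => //.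
  apply: smooth_onV => //; first exact: smooth_det.
  by move=> u /uA; rewrite unitmxE unitfE.
rewrite (_ : (fun u => _) = (fun u => (-1) ^+ (j + i) * \det (row' j (col' i (A u))))).
  apply: smooth_onM => //; first exact: smooth_on_cst.
  apply: smooth_det => k l; rewrite (_ : (fun u => _) = (fun u => A u (lift j k) (lift i l))) //.
  by apply/funext => u; rewrite !mxE.
by apply/funext => u; rewrite mxE.
Qed.
End SmoothMx.

Section Frame.
Variables (R : realType) (M : manifold R).
Local Notation n := (Defs.dim M).
Variables (p : nat) (g : 'I_p -> M -> R).
Hypothesis sg : forall i, smooth (g i).
Hypothesis ig : forall x, immersive_at g x.
Implicit Types (c : chart R n M) (x : M) (f : M -> R).

Definition jac c x : 'M[R]_(n, p) := \matrix_(j, i) grad c (g i) x j 0.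

(** The right inverse of the jacobian whose image is orthogonal to its kernel. *)
Definition jac_pinv c x : 'M[R]_(p, n) := (jac c x)^T *m invmx (jac c x *m (jac c x)^T).

Lemma jac_mul c x (w : 'rV[R]_n) i : (w *m jac c x) 0 i = (w *m grad c (g i) x) 0 0.
Proof. by rewrite !mxE; apply: eq_bigr => j _; rewrite !mxE. Qed.

Lemma row_norm0 q (v : 'rV[R]_q) : v *m v^T = 0 -> v = 0.
Proof.
move=> /(congr1 (fun A : 'M[R]_1 => A 0 0)); rewrite !mxE => /eqP.
have E i : v 0 i * v^T i 0 = v 0 i ^+ 2 by rewrite mxE expr2.
under eq_bigr do rewrite E.
rewrite psumr_eq0 => [/allP v0|i _]; last exact: sqr_ge0.
apply/rowP => i; rewrite mxE; apply/eqP; rewrite -sqrf_eq0.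
by apply: v0; rewrite mem_index_enum.
Qed.

(** A vector killed by the Gram matrix has a jacobian image of square length 0. *)
Lemma gram_unit c x : atlas c -> chart_dom c x -> jac c x *m (jac c x)^T \in unitmx.
Proof.
move=> Ac cx; rewrite -row_free_unit -kermx_eq0; apply/rowV0P => w /sub_kermxP w0.
apply/eqP/negP => /negP wn0; have [i /eqP] := ig Ac cx wn0; apply.
apply/matrixP => k l; rewrite !ord1 -jac_mul [RHS]mxE.
suff -> : w *m jac c x = 0 by rewrite mxE.
by apply: row_norm0; rewrite trmx_mul mulmxA -(mulmxA w) w0 mul0mx.
Qed.

Lemma jac_pinvK c x : atlas c -> chart_dom c x -> jac c x *m jac_pinv c x = 1%:M.
Proof. by move=> Ac cx; rewrite mulmxA mulmxV // gram_unit. Qed.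

(** A change of chart multiplies the jacobian and the gradients by the same T; the Gram
    matrix becomes T G T^T, and the factors T cancel. *)
Lemma jac_pinv_chart c c' x f : atlas c -> atlas c' -> chart_dom c x -> chart_dom c' x ->
  smooth f -> jac_pinv c' x *m grad c' f x = jac_pinv c x *m grad c f x.
Proof.
move=> Ac Ac' cx c'x sf; have [T Tu TP] := grad_change_unit Ac Ac' cx c'x.
have jE : jac c' x = T *m jac c x.
  apply/matrixP => j i; rewrite mxE TP // !mxE; by apply: eq_bigr => k _; rewrite !mxE.
have Gu := gram_unit Ac cx; have G'u := gram_unit Ac' c'x.
rewrite /jac_pinv -!mulmxA.
have -> : invmx (jac c' x *m (jac c' x)^T) *m grad c' f x =
    invmx T^T *m (invmx (jac c x *m (jac c x)^T) *m grad c f x).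
  rewrite -[RHS](mulKmx G'u); congr (_ *m _).
  rewrite TP // jE trmx_mul.
  rewrite -!mulmxA (mulmxA T^T) mulmxV ?unitmx_tr // mul1mx.
  by rewrite (mulmxA (jac c x)) mulKVmx.
by rewrite jE trmx_mul -!mulmxA (mulmxA T^T) mulmxV ?unitmx_tr // mul1mx.
Qed.

Definition chart_at (x : M) : chart R n M := projT1 (cid2 (atlas_cover x)).
Lemma chart_at_atlas x : atlas (chart_at x).
Proof. by rewrite /chart_at; case: cid2. Qed.
Lemma chart_at_dom x : chart_dom (chart_at x) x.
Proof. by rewrite /chart_at; case: cid2. Qed.

Definition vfield (i : 'I_p) f x : R := (jac_pinv (chart_at x) x *m grad (chart_at x) f x) i 0.

Lemma vfieldE c x i f : atlas c -> chart_dom c x -> smooth f ->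
  vfield i f x = (jac_pinv c x *m grad c f x) i 0.
Proof.
move=> Ac cx sf; rewrite /vfield.
by rewrite (jac_pinv_chart Ac (chart_at_atlas x) cx (chart_at_dom x) sf).
Qed.

Lemma vfield_smooth i f : smooth f -> smooth (vfield i f).
Proof.
move=> sf; apply: smooth_local => x; have [c Ac cx] := atlas_cover x.
exists c, (chart_im c); split=> //; [exact: chart_im_open|exact: chart_im_map|].
pose J (u : 'rV[R]_n) : 'M[R]_(n, p) := \matrix_(j, k) 'D_(evec R j) (g k \o chart_inv c) u.
pose df (u : 'rV[R]_n) : 'cV[R]_n := \col_j 'D_(evec R j) (f \o chart_inv c) u.
have JE u : chart_im c u -> J u = jac c (chart_inv c u).
  by move=> cu; apply/matrixP => j k; rewrite !mxE chart_invK.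
apply: (@smooth_on_ext _ _ _ (fun u => ((J u)^T *m invmx (J u *m (J u)^T) *m df u) i 0)).
- exact: chart_im_open.
- move=> u cu; rewrite /= (vfieldE i Ac (chart_inv_dom cu) sf) /jac_pinv -JE //.
  by congr ((_ *m _) _ _); apply/matrixP => j k; rewrite !mxE chart_invK.
have oc := chart_im_open c.
have sJ : smooth_mx (chart_im c) J.
  move=> j k; rewrite (_ : (fun u => _) = (fun u => 'D_(evec R j) (g k \o chart_inv c) u)).
    by apply: smooth_on_derive; exact: (sg k Ac).
  by apply/funext => u; rewrite mxE.
apply: (smooth_mulmx oc).
  apply: (smooth_mulmx oc); first exact: smooth_trmx.
  apply: (smooth_invmx oc); first by apply: (smooth_mulmx oc) => //; exact: smooth_trmx.
  by move=> u cu; rewrite JE // gram_unit //; exact: chart_inv_dom.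
move=> j k; rewrite (_ : (fun u => _) = (fun u => 'D_(evec R j) (f \o chart_inv c) u)).
  by apply: smooth_on_derive; exact: (sf c Ac).
by apply/funext => u; rewrite mxE.
Qed.

(** At x the vector field is the derivation of the tangent vector that is the i-th row
    of the right inverse; the curve is a straight line in the chart. *)
Lemma vfield_curve i x : exists gam : R -> M, gam 0 = x /\
  forall f, smooth f -> is_derive (0 : R) 1 (fun t => f (gam t)) (vfield i f x).
Proof.
have [c Ac cx] := atlas_cover x; pose V := row i (jac_pinv c x).
exists (fun t => chart_inv c (c x + t *: V)); split=> [|f sf].
  by rewrite scale0r addr0 chart_mapK.
rewrite (vfieldE i Ac cx sf).
have C : C1_at (f \o chart_inv c) (c x + 0 *: V) by rewrite scale0r addr0; exact: smooth_C1.
have D := is_derive_dir V C.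
have := is_derive_line (@ex_derive _ _ _ _ _ _ _ D).
rewrite (@derive_val _ _ _ _ _ _ _ D) scale0r addr0.
congr (is_derive _ _ _ _); rewrite mxE; apply: eq_bigr => j _; by rewrite !mxE.
Qed.

(** The jacobian times the coefficients vfield i f x is the gradient of f, by
    [jac_pinvK]. *)
Lemma grad0_rem f x c : atlas c -> chart_dom c x -> smooth f ->
  grad c (fun y => f y - (f x + \sum_i vfield i f x * (g i y - g i x))) x = 0.
Proof.
move=> Ac cx sf; apply/matrixP => j k; rewrite ord1 !mxE.
pose a i := vfield i f x.
have dr h : smooth h -> is_derive (c x) (evec R j) (h \o chart_inv c) (grad c h x j 0).
  move=> sh; rewrite mxE; apply: derivableP.
  exact: nbhs_singleton (smooth_C1 Ac sh cx j).1.
have D : is_derive (c x) (evec R j)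
    ((f \o chart_inv c) - (cst (f x) + \sum_i a i \*: ((g i \o chart_inv c) - cst (g i x))))
    (grad c f x j 0 - (0 + \sum_i a i *: (grad c (g i) x j 0 - 0))).
  apply: is_deriveB; first exact: dr.
  apply: is_deriveD; elim: (index_enum _) => [|i r IHr].
    by rewrite !big_nil; exact: is_derive_cst.
  rewrite !big_cons; apply: is_deriveD => //; apply: is_deriveZ.
  by apply: is_deriveB; exact: dr.
rewrite (_ : _ \o _ = (f \o chart_inv c) - (cst (f x) +
    \sum_i a i \*: ((g i \o chart_inv c) - cst (g i x)))); last first.
  by apply/funext => u; rewrite /= !fctE fct_sumE.
rewrite (@derive_val _ _ _ _ _ _ _ D) add0r; apply/eqP; rewrite subr_eq0; apply/eqP.
have : grad c f x j 0 = (jac c x *m (jac_pinv c x *m grad c f x)) j 0.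
  by rewrite mulmxA jac_pinvK // mul1mx.
rewrite [RHS]mxE => ->; apply: eq_bigr => i _.
by rewrite subr0 /a (vfieldE i Ac cx sf) [_ *: _]mulrC; congr (_ * _); rewrite !mxE.
Qed.
End Frame.

Section FrameExists.
Variables (R : realType) (M : manifold R).

(** The first condition makes X i differentiate along curves; the second one is a
    Taylor formula of first order, with a remainder in the square of the ideal of x. *)
Definition is_frame p (g : 'I_p -> Cinf M) (X : 'I_p -> Cinf M -> Cinf M) : Prop :=
  (forall i x, exists gam : R -> M, gam 0 = x /\
     forall f, is_derive (0 : R) 1 (fun t => ev (gam t) f) (ev x (X i f))) /\
  (forall f x, exists2 s : seq (Cinf M * Cinf M),
     (forall q, q \in s -> ev x q.1 = 0 /\ ev x q.2 = 0) &
     f = scal (ev x f) + \sum_i scal (ev x (X i f)) * (g i - scal (ev x (g i))) +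
         \sum_(q <- s) q.1 * q.2).

Lemma frame_exists : exists p (g : 'I_p -> Cinf M) X, is_frame g X.
Proof.
have [p [g [sg ig]]] := global_immersion M.
exists p, (fun i => Cinf_of (sg i)), (fun i f => Cinf_of (vfield_smooth sg ig i (CinfP f))).
split=> [i x|f x].
  have [gam [g0 dg]] := vfield_curve sg ig i x; exists gam; split=> // f.
  exact: dg (CinfP f).
pose X i (u : Cinf M) := Cinf_of (vfield_smooth sg ig i (CinfP u)).
pose L := scal (ev x f) + \sum_i scal (ev x (X i f)) * (Cinf_of (sg i) - scal (ev x (Cinf_of (sg i)))).
have [c Ac cx] := atlas_cover x.
have LE y : ev y L = f x + \sum_i vfield g i f x * (g i y - g i x).
  rewrite /L evD ev_sum evS; congr (_ + _); exact: eq_bigr.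
have [||s sP E] := @flat_mu2 R M (f - L) x c Ac cx.
- rewrite -[LHS]/(ev x (f - L)) evB LE big1 ?addr0 ?subrr // => i _.
  by rewrite subrr mulr0.
- have -> : Cinf_fun (f - L) = fun y => f y - (f x + \sum_i vfield g i f x * (g i y - g i x)).
    by apply/funext => y; rewrite -[LHS]/(ev y (f - L)) evB LE.
  exact: (grad0_rem sg ig Ac cx (CinfP f)).
by exists s => //; rewrite -E addrC subrK.
Qed.

Section Pull.
Variables (p : nat) (g : 'I_p -> Cinf M) (X : 'I_p -> Cinf M -> Cinf M).
Hypothesis gX : is_frame g X.

(** Additivity of the derivative along the curves attached to X i. *)
Lemma frameD i f f' : X i (f + f') = X i f + X i f'.
Proof.
apply: Cinf_ext => x; have [gam [_ dg]] := gX.1 i x.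
have [_ <-] := dg (f + f'); rewrite evD.
rewrite (_ : (fun t => _) = (fun t => ev (gam t) f) + (fun t => ev (gam t) f')).
  by have [] := is_deriveD (dg f) (dg f').
by apply/funext => t; rewrite evD.
Qed.

Lemma frameZ i k f : X i (scal k * f) = scal k * X i f.
Proof.
apply: Cinf_ext => x; have [gam [_ dg]] := gX.1 i x.
have [_ <-] := dg (scal k * f); rewrite evM evS.
rewrite (_ : (fun t => _) = k \*: (fun t => ev (gam t) f)).
  by have [] := is_deriveZ k (dg f).
by apply/funext => t; rewrite evM evS.
Qed.

(** In forms over B, both sides agree modulo the maximal ideal of every point h
    of B, since h induces a point of the manifold at which the first-order Taylor
    formula of the frame applies. *)
Lemma form_d_frame (B : geomAlgType R) (i : {rmorphism Cinf M -> B}) :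
  (forall k, i (scal k) = scal k) -> forall f,
  form_d (i f) = \sum_j i (X j f) *: form_d (i (g j)).
Proof.
move=> iS f; apply/eqP; rewrite -subr_eq0; apply/eqP/forms1_geom => h.
have [x hx] := spectrum_ev (spec_comp iS h).
have {}hx u : h (i u) = ev x u by exact: hx.
have [s sP E] := gX.2 f x.
have -> : form_d (i f) = \sum_j scal (ev x (X j f)) *: form_d (i (g j)) +
    \sum_(q <- s) (i q.1 *: form_d (i q.2) + i q.2 *: form_d (i q.1)).
  rewrite {1}E !rmorphD !rmorph_sum !form_dD iS form_d_scal add0r !form_d_sum.
  congr (_ + _); apply: eq_bigr => q _; last by rewrite rmorphM form_dM.
  by rewrite rmorphM rmorphB !iS form_dZ form_dB form_d_scal subr0.
rewrite addrAC -sumrB; apply: combD.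
  apply: (big_ind (comb (mu h) setT)) => [|u v|j _]; [exact: comb0|exact: combD|].
  by rewrite -scalerBl; apply: comb_mem; rewrite rmorphB spec_scal hx subrr.
rewrite big_seq; apply: (big_ind (comb (mu h) setT)) => [|u v|q /sP[q1 q2]].
- exact: comb0.
- exact: combD.
- by apply: combD; apply: comb_mem; rewrite hx.
Qed.
End Pull.
End FrameExists.

(** * The tensor product of two function algebras *)
Section Product.
Variables (R : realType) (M N : manifold R).
Local Notation X := (Cinf M).
Local Notation Y := (Cinf N).
Local Notation A := (atens X Y).

Let bp := apure_balanced X Y.

Definition left_factor (f : X) : A := apure f 1.
Definition right_factor (f : Y) : A := apure 1 f.

Lemma left_factor_zmod : zmod_morphism left_factor.
Proof. by move=> f g; rewrite /left_factor (bal_addl bp) (bal_oppl bp). Qed.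
Lemma left_factor_monoid : monoid_morphism left_factor.
Proof. by split=> // f g; rewrite /left_factor apureM mulr1. Qed.
Lemma right_factor_zmod : zmod_morphism right_factor.
Proof. by move=> f g; rewrite /right_factor (bal_addr bp) (bal_oppr bp). Qed.
Lemma right_factor_monoid : monoid_morphism right_factor.
Proof. by split=> // f g; rewrite /right_factor apureM mulr1. Qed.
HB.instance Definition _ := GRing.isZmodMorphism.Build X A left_factor left_factor_zmod.
HB.instance Definition _ := GRing.isMonoidMorphism.Build X A left_factor left_factor_monoid.
HB.instance Definition _ := GRing.isZmodMorphism.Build Y A right_factor right_factor_zmod.
HB.instance Definition _ := GRing.isMonoidMorphism.Build Y A right_factor right_factor_monoid.

Lemma left_factor_scal k : left_factor (scal k) = scal k. Proof. by []. Qed.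
Lemma right_factor_scal k : right_factor (scal k) = scal k.
Proof.
rewrite /right_factor -[RHS]/(apure (scal k) 1) -[scal k in LHS]mulr1 -[scal k in RHS]mulr1.
by rewrite (bal_mid bp).
Qed.

Lemma apureE f g : apure f g = left_factor f * right_factor g :> A.
Proof. by rewrite apureM mulr1 mul1r. Qed.

(** A point of the tensor product restricts to a point of each factor. *)
Lemma spec_product (h : spectrum A) : exists x y,
  forall a : A, h a = atens_spec (ev_spec x) (ev_spec y) a.
Proof.
have [x hx] := spectrum_ev (spec_comp left_factor_scal h).
have [y hy] := spectrum_ev (spec_comp right_factor_scal h).
exists x, y; elim/atens_ind=> [|f g|a b Ha Hb].
- by rewrite !rmorph0.
- transitivity (ev x f * ev y g); last by symmetry; exact: spec2_pure.
  by rewrite apureE rmorphM; congr (_ * _); [exact: hx|exact: hy].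
- by rewrite !rmorphD Ha Hb.
Qed.

Lemma lift_l_balanced (D : X -> X) :
  (forall f f', D (f + f') = D f + D f') -> (forall k f, D (scal k * f) = scal k * D f) ->
  balanced (fun (k : R) (f : X) => scal k * f)
    (fun (k : R) (g : Y) => scal k * g) (fun f g => apure (D f) g : A).
Proof.
move=> DD DZ; split=> [f f' g|f g g'|k f g].
- by rewrite DD (bal_addl bp).
- by rewrite (bal_addr bp).
- by rewrite DZ (bal_mid bp).
Qed.

Lemma lift_r_balanced (D : Y -> Y) :
  (forall f f', D (f + f') = D f + D f') -> (forall k f, D (scal k * f) = scal k * D f) ->
  balanced (fun (k : R) (f : X) => scal k * f)
    (fun (k : R) (g : Y) => scal k * g) (fun f g => apure f (D g) : A).
Proof.
move=> DD DZ; split=> [f f' g|f g g'|k f g].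
- by rewrite (bal_addl bp).
- by rewrite DD (bal_addr bp).
- by rewrite DZ (bal_mid bp).
Qed.

Lemma along_curves_l (D : X -> X) :
  (forall f f', D (f + f') = D f + D f') -> (forall k f, D (scal k * f) = scal k * D f) ->
  (forall x, exists gam : R -> M, gam 0 = x /\
     forall f, is_derive (0 : R) 1 (fun t => ev (gam t) f) (ev x (D f))) ->
  along_curves (fun a : A => tens_lift (fun f g => apure (D f) g) a : A).
Proof.
move=> DD DZ Dc h; have [x [y hE]] := spec_product h; have [gam [g0 dg]] := Dc x.
have bD := lift_l_balanced DD DZ.
exists (fun t => atens_spec (ev_spec (gam t)) (ev_spec y)); split=> a.
  by rewrite g0 hE.
rewrite hE; elim/atens_ind: a => [|f g|a b Ha Hb].
- rewrite (tens_lift0 bD) rmorph0 (_ : (fun t => _) = cst 0); first exact: is_derive_cst.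
  by apply/funext => t; rewrite rmorph0.
- rewrite (tens_lift_pure bD).
  rewrite (_ : atens_spec _ _ _ = ev y g *: ev x (D f)); last first.
    by rewrite [RHS]mulrC; exact: spec2_pure.
  rewrite (_ : (fun t => _) = ev y g \*: (fun t => ev (gam t) f)).
    exact: is_deriveZ.
  by apply/funext => t; rewrite [RHS]mulrC; exact: spec2_pure.
- rewrite (tens_liftD bD) rmorphD.
  rewrite (_ : (fun t => _) = (fun t => atens_spec (ev_spec (gam t)) (ev_spec y) a) +
     (fun t => atens_spec (ev_spec (gam t)) (ev_spec y) b)); first exact: is_deriveD.
  by apply/funext => t; rewrite rmorphD.
Qed.

Lemma along_curves_r (D : Y -> Y) :
  (forall f f', D (f + f') = D f + D f') -> (forall k f, D (scal k * f) = scal k * D f) ->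
  (forall x, exists gam : R -> N, gam 0 = x /\
     forall f, is_derive (0 : R) 1 (fun t => ev (gam t) f) (ev x (D f))) ->
  along_curves (fun a : A => tens_lift (fun f g => apure f (D g)) a : A).
Proof.
move=> DD DZ Dc h; have [x [y hE]] := spec_product h; have [gam [g0 dg]] := Dc y.
have bD := lift_r_balanced DD DZ.
exists (fun t => atens_spec (ev_spec x) (ev_spec (gam t))); split=> a.
  by rewrite g0 hE.
rewrite hE; elim/atens_ind: a => [|f g|a b Ha Hb].
- rewrite (tens_lift0 bD) rmorph0 (_ : (fun t => _) = cst 0); first exact: is_derive_cst.
  by apply/funext => t; rewrite rmorph0.
- rewrite (tens_lift_pure bD).
  rewrite (_ : atens_spec _ _ _ = ev x f *: ev y (D g)); last exact: spec2_pure.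
  rewrite (_ : (fun t => _) = ev x f \*: (fun t => ev (gam t) g)).
    exact: is_deriveZ.
  by apply/funext => t; exact: spec2_pure.
- rewrite (tens_liftD bD) rmorphD.
  rewrite (_ : (fun t => _) = (fun t => atens_spec (ev_spec x) (ev_spec (gam t)) a) +
     (fun t => atens_spec (ev_spec x) (ev_spec (gam t)) b)); first exact: is_deriveD.
  by apply/funext => t; rewrite rmorphD.
Qed.

End Product.

Theorem theorem1 (R : realType) (M N : manifold R) :
  let A : geomAlgType R := atens (Cinf M) (Cinf N) in
  exists phi : {linear smoothening (forms1 A) -> forms1 (envelope A)},
    (forall (f : envelope A) (a : A),
       phi (stens f (form_d a)) = f *: form_d (env_in a)) /\
    bijective phi.
Proof.
move=> A.
have [p [g [D fD]]] := frame_exists M; have [q [g' [D' fD']]] := frame_exists N.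
pose G (i : 'I_(p + q)) : A := match fintype.split i with
  inl i => left_factor N (g i) | inr i => right_factor M (g' i) end.
pose E (i : 'I_(p + q)) : A -> A := match fintype.split i with
  inl i => fun a => tens_lift (fun u v => apure (D i u) v) a
  | inr i => fun a => tens_lift (fun u v => apure u (D' i v)) a end.
apply: (@smoothening_criterion R A _ G E) => [i|a].
  rewrite /E; case: (fintype.split i) => j.
    by apply: along_curves_l; [exact: frameD fD j|exact: frameZ fD j|exact: fD.1 j].
  by apply: along_curves_r; [exact: frameD fD' j|exact: frameZ fD' j|exact: fD'.1 j].
rewrite big_split_ord /=.
pose DL j (b : A) : A := tens_lift (fun u v => apure (D j u) v) b.
pose DR j (b : A) : A := tens_lift (fun u v => apure u (D' j v)) b.
have GL j : G (lshift q j) = left_factor N (g j).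
  by rewrite /G -[lshift q j]/(unsplit (inl j)) unsplitK.
have GR j : G (rshift p j) = right_factor M (g' j).
  by rewrite /G -[rshift p j]/(unsplit (inr j)) unsplitK.
have EL j b : E (lshift q j) b = DL j b.
  by rewrite /E -[lshift q j]/(unsplit (inl j)) unsplitK.
have ER j b : E (rshift p j) b = DR j b.
  by rewrite /E -[rshift p j]/(unsplit (inr j)) unsplitK.
under eq_bigr do rewrite GL EL; under [X in _ + X]eq_bigr do rewrite GR ER.
have bL j := lift_l_balanced N (frameD fD j) (frameZ fD j).
have bR j := lift_r_balanced M (frameD fD' j) (frameZ fD' j).
elim/atens_ind: a => [|u v|a b Ha Hb].
- rewrite !big1 ?addr0 => [|j _|j _].
  + by rewrite -(rmorph0 (@scal R A)) form_d_scal.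
  + by rewrite /DR (tens_lift0 (bR j)) scale0r.
  + by rewrite /DL (tens_lift0 (bL j)) scale0r.
- rewrite [in LHS]apureE form_dM [LHS]addrC.
  rewrite (form_d_frame fD (@left_factor_scal R M N)) (form_d_frame fD' (@right_factor_scal R M N)).
  rewrite !scaler_sumr; congr (_ + _); apply: eq_bigr => j _; rewrite scalerA; congr (_ *: _).
    by rewrite /DL (tens_lift_pure (bL j)) mulrC -apureE.
  by rewrite /DR (tens_lift_pure (bR j)) -apureE.
- rewrite form_dD Ha Hb addrACA -!big_split; congr (_ + _); apply: eq_bigr => j _.
    by rewrite /DL (tens_liftD (bL j)) scalerDl.
  by rewrite /DR (tens_liftD (bR j)) scalerDl.
Qed.
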